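(* Let $M=\mathrm{diag}(m_1,\dots,m_d)$, $m_i\in\mathbb{Z}$, be a diagonal dilation matrix, $m=|\det M|$. Let $1\le p\le\infty$, $1/p+1/q=1$, and $N\ge0$. Suppose that $\{\widetilde\varphi_j\}_j\in\mathcal{S}'_{N,p}$, $\{\varphi_j\}_j\in\mathcal{B}$ with respect to the parameter $\delta\in(0,1/2)$, and $\{\varphi_j\}_j$ and $\{\widetilde\varphi_j\}_j$ are strictly compatible with respect to $\delta$. Then, for any $f\in\mathbb{B}_{p,1}^{d/p+N}(M)$ and $j\in\mathbb{N}$, we have $$\|f-Q_j(f,\varphi_j,\widetilde\varphi_j)\|_p\le C\,K_{\varphi_j,q}\,m^{-j(\frac1p+\frac Nd)}\sum_{\nu=j}^\infty m^{(\frac1p+\frac Nd)\nu}E_{\delta M^\nu}(f)_p.$$ If, additionally, $\{\widetilde\varphi_j\}_j\in\mathcal{L}_q$, then for any $f\in L_p$ and $j\in\mathbb N$ we have $$\|f-Q_j(f,\varphi_j,\widetilde\varphi_j)\|_p\le C\,K_{\varphi_j,q}\,\|\widetilde\varphi_j\|_{\mathcal{L}_{q,j}}\,E_{\delta M^j}(f)_p.$$ Here the constant $C$ does not depend on $f$ and $j$.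
   Context: Notation. $\mathbb{T}^d=\mathbb{R}^d/\mathbb{Z}^d$, $L_p=L_p(\mathbb{T}^d)$ with norm $\|\cdot\|_p$, $|\cdot|$ Euclidean norm, $\widehat f(k)$ Fourier coefficients with respect to $e^{2\pi i(k,x)}$. A dilation matrix is an integer matrix all of whose eigenvalues have absolute value $>1$. $M^*$ is the adjoint of $M$ (here $M^*=M$), $M^{*j}=(M^* )^j$, $M^{*-j}=(M^* )^{-j}$. $D(A):=A[-1/2,1/2)^d\cap\mathbb{Z}^d$. $B_r(a)$ is the ball of radius $r$ centered at $a$. $\operatorname{spec}T=\{k\in\mathbb{Z}^d:\widehat T(k)\ne0\}$. Periodic distributions are continuous linear functionals on $C^\infty(\mathbb{T}^d)$, with Fourier coefficients of at most polynomial growth; $T*\widetilde\varphi$ has Fourier coefficients $\widehat T(k)\widehat{\widetilde\varphi}(k)$. Sequences are indexed by $j\in\mathbb{N}$. Class $\mathcal{B}=\mathcal{B}_{\delta,R}$: sequences of trigonometric polynomials $\varphi_j$ such that, for some constants $R,\delta,C'_\varphi>0$ independent of $j$, $\operatorname{spec}\varphi_j\subset M^{*j}\big(B_R(\mathbf 0)\setminus\bigcup_{n\in\mathbb{Z}^d\setminus\{\mathbf 0\}}B_\delta(n)\big)$ and $|\widehat{\varphi_j}(l)|\le C'_\varphi$ for all $j\in\mathbb{N}$, $l\in\mathbb{Z}^d$; ''with respect to the parameter $\delta$'' refers to this $\delta$. Strict compatibility with respect to $\delta$: $\widehat{\widetilde\varphi_j}(l)\overline{\widehat{\varphi_j}(l)}=1$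 for all $j\in\mathbb{N}$ and all $l\in\mathbb{Z}^d$ with $|M^{*-j}l|\le\delta$. Class $\mathcal{S}'_{N,p}$: sequences of periodic distributions $\{\widetilde\varphi_j\}_j$ such that (with constants independent of $j$) $|\widehat{\widetilde\varphi_j}(k)|\le C_{\widetilde\varphi}|M^{*-j}k|^N$ for $k\in\mathbb{Z}^d\setminus D(M^{*j})$, $|\widehat{\widetilde\varphi_j}(k)|\le C_{\widetilde\varphi}$ for $k\in D(M^{*j})$, and for every trigonometric polynomial $T_n$ with $\operatorname{spec}T_n\subset\{k\in\mathbb{Z}^d:|M^{-n}k|\le1\}$ one has $\|T_n*\widetilde\varphi_j\|_p\le C_{\widetilde\varphi,p}\,m^{\frac Nd(n-j)}\|T_n\|_p$ for all $n\ge j$, $n,j\in\mathbb{N}$. Class $\mathcal{L}_q$: sequences of periodic functions $\{\widetilde\varphi_j\}_j$ such that for all $j\in\mathbb{N}$ the quantity $\|\widetilde\varphi_j\|_{\mathcal{L}_{q,j}}$ is finite, where $\|\widetilde\varphi_j\|_{\mathcal{L}_{q,j}}=\Big(m^j\int_{M^{-j}\mathbb{T}^d}\Big(\frac1{m^j}\sum_{k\in D(M^j)}|\widetilde\varphi_j(x-M^{-j}k)|\Big)^qdx\Big)^{1/q}$ for $1\le q<\infty$ (integration over $M^{-j}[-1/2,1/2)^d$) and $\|\widetilde\varphi_j\|_{\mathcal{L}_{\infty,j}}=\frac1{m^j}\sup_{x\in\mathbb{R}^d}\sum_{k\in D(M^j)}|\widetilde\varphi_j(x-M^{-j}k)|$.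 Best approximation: $E_A(f)_p=\inf\{\|f-T\|_p: T \text{ trigonometric polynomial},\ \operatorname{spec}T\subset\{k\in\mathbb{Z}^d:|A^{-1}k|<1\}\}$. Besov space: $f\in\mathbb{B}^s_{p,1}(M)$ iff $f\in L_p$ and $\|f\|_p+\sum_{\nu=1}^\infty m^{\frac sd\nu}E_{M^\nu}(f)_p<\infty$ (the same formula is used when $s=d/p+N=0$). Multiplier norm: $K_{\varphi_j,q}=\sup_{\|g\|_q\le1}\Big\|\sum_{k\in\mathbb{Z}^d}\widehat{\varphi_j}(k)\widehat g(k)e^{2\pi i(k,\cdot)}\Big\|_q$. Operators: $Q_j(f,\varphi_j,\widetilde\varphi_j)=\frac1{m^j}\sum_{k\in D(M^j)}\langle f,\widetilde\varphi_j(\cdot-M^{-j}k)\rangle\varphi_j(\cdot-M^{-j}k)$. For a trigonometric polynomial $T$, $\langle T,\widetilde\varphi_j(\cdot-M^{-j}k)\rangle=\sum_{l}\widehat T(l)\overline{\widehat{\widetilde\varphi_j}(l)}e^{2\pi i(k,M^{*-j}l)}$. For $\{\widetilde\varphi_j\}_j\in\mathcal{S}'_{N,p}$ and $f\in\mathbb{B}_{p,1}^{d/p+N}(M)$, $\langle f,\widetilde\varphi_j(\cdot-M^{-j}k)\rangle:=\lim_{\mu\to\infty}\langle T_\mu,\widetilde\varphi_j(\cdot-M^{-j}k)\rangle$, where $T_\mu$, $\mu\in\mathbb{Z}_+$, are any trigonometric polynomials with $\operatorname{spec}T_\mu\subset D(M^\mu)$ and $\|f-T_\mu\|_p\le\sigma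 E_{\delta M^\mu}(f)_p$, $\sigma$ being independent of $f$ and $\mu$ (the limit exists and does not depend on the choice of $T_\mu$). If $\{\widetilde\varphi_j\}_j\in\mathcal{L}_q$ and $f\in L_p$, then $\langle f,\widetilde\varphi_j(\cdot-M^{-j}k)\rangle=\int_{\mathbb{T}^d}f(t)\overline{\widetilde\varphi_j(t-M^{-j}k)}\,dt$. *)

(* Defs.v *)
From HB Require Import structures.
From mathcomp Require Import all_boot all_order all_algebra.
From mathcomp Require Import all_classical all_reals all_analysis.
From mathcomp Require Import complex.

Set Implicit Arguments.
Unset Strict Implicit.
Unset Printing Implicit Defensive.

Import Order.TTheory GRing.Theory Num.Theory numFieldNormedType.Exports.

Local Open Scope classical_set_scope.
Local Open Scope ring_scope.

(** Column vectors carry the product (= Borel) sigma-algebra, generated by the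
    coordinates. *)
Definition measure_cvec_display : measure_display -> measure_display.
Proof. exact. Qed.

Section measurable_cvec.
Variables (R : realType) (n : nat).

Definition cvec_coord (i : 'I_n) (x : 'cV[R]_n) : measurableTypeR R := x i 0.

Let cvec_set0 : g_sigma_preimage cvec_coord set0.
Proof. exact: sigma_algebra0. Qed.

Let cvec_setC A : g_sigma_preimage cvec_coord A ->
  g_sigma_preimage cvec_coord (~` A).
Proof. exact: sigma_algebraC. Qed.

Let cvec_bigcup (F : _^nat) : (forall i, g_sigma_preimage cvec_coord (F i)) ->
  g_sigma_preimage cvec_coord (\bigcup_i (F i)).
Proof. exact: sigma_algebra_bigcup. Qed.

HB.instance Definition _ :=
  @isMeasurable.Build
    (measure_cvec_display default_measure_display)
    'cV[R]_n (g_sigma_preimage cvec_coord) cvec_set0 cvec_setC cvec_bigcup.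

Lemma measurable_cvec_coord i : measurable_fun setT (cvec_coord i).
Proof.
move=> _ Y mY; rewrite setTI; apply: sub_sigma_algebra => /=.
rewrite -bigcup_seq/=; exists i => /=; first by rewrite mem_index_enum.
by exists Y => //; rewrite setTI.
Qed.

End measurable_cvec.

Lemma measurable_fun_cvecP (R : realType) n d (T : measurableType d)
  (f : T -> 'cV[R]_n) :
  (forall i, measurable_fun setT (cvec_coord i \o f)) ->
  measurable_fun setT f.
Proof.
move=> mf.
suff prefS : g_sigma_preimage (fun i => cvec_coord i \o f) `<=` measurable.
  move=> _ A mA; apply: prefS.
  by rewrite g_sigma_preimage_comp; exists A.
apply: smallest_sub; first exact: sigma_algebra_measurable.
case: n f mf => [|k] f mf; first by rewrite big_ord0.
rewrite -bigcup_mkord_ord; apply: bigcup_sub => i Ii.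
by move=> A [B mB <-]; exact: mf.
Qed.

Definition cvec_cons (R : realType) n (p : measurableTypeR R * 'cV[R]_n) :
  'cV[R]_n.+1 := col_mx (const_mx p.1 : 'cV[R]_1) p.2.

Lemma measurable_cvec_cons (R : realType) n :
  measurable_fun setT (@cvec_cons R n).
Proof.
apply: measurable_fun_cvecP => i.
case: (@fintype.splitP 1 n i) => j ij.
  have -> : i = lshift n j by apply: val_inj.
  rewrite (_ : _ \o _ = fst); first exact: measurable_fst.
  apply/funext => p /=; rewrite /cvec_coord /cvec_cons.
  by rewrite (@col_mxEu _ 1 n) mxE.
have -> : i = rshift 1 j by apply: val_inj.
rewrite (_ : _ \o _ = cvec_coord j \o snd).
  by apply: measurableT_comp;
    [exact: measurable_cvec_coord|exact: measurable_snd].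
apply/funext => p /=; rewrite /cvec_coord /cvec_cons.
by rewrite (@col_mxEd _ 1 n).
Qed.

Definition cvec_uncons (R : realType) n (x : 'cV[R]_n.+1) :
  measurableTypeR R * 'cV[R]_n := (x 0 0, @dsubmx R 1 n 1 x).

Lemma cvec_consK (R : realType) n : cancel (@cvec_cons R n) (@cvec_uncons R n).
Proof.
move=> [a v]; rewrite /cvec_uncons /cvec_cons /= col_mxKd.
by have -> : 0 = lshift n 0 :> 'I_(1 + n); [apply: val_inj|rewrite (@col_mxEu _ 1 n) mxE].
Qed.

Lemma measurable_cvec_uncons (R : realType) n :
  measurable_fun setT (@cvec_uncons R n).
Proof.
apply/measurable_fun_pairP; split.
  exact: (measurable_cvec_coord (ord0 : 'I_n.+1)).
apply: measurable_fun_cvecP => i.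
rewrite (_ : _ \o _ = cvec_coord (rshift 1 i : 'I_n.+1)).
  exact: measurable_cvec_coord.
by apply/funext => x; rewrite /cvec_coord /= mxE.
Qed.

Section lebesgue_step.
Local Open Scope ereal_scope.
Variables (R : realType) (n : nat).
Variable m : {sigma_finite_measure set 'cV[R]_n -> \bar R}.

Definition lebesgue_step (A : set 'cV[R]_n.+1) : \bar R :=
  (lebesgue_measure \x m) (@cvec_cons R n @^-1` A).

Let mcons A : measurable A -> measurable (@cvec_cons R n @^-1` A).
Proof. by move=> mA; rewrite -[X in measurable X]setTI; exact: measurable_cvec_cons. Qed.

Let lebesgue_step0 : lebesgue_step set0 = 0.
Proof. by rewrite /lebesgue_step preimage_set0 measure0. Qed.

Let lebesgue_step_ge0 A : 0 <= lebesgue_step A.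
Proof. exact: measure_ge0. Qed.

Let lebesgue_step_sigma_additive : semi_sigma_additive lebesgue_step.
Proof.
move=> F mF tF mUF; rewrite /lebesgue_step preimage_bigcup.
apply: measure_semi_sigma_additive.
- by move=> k; exact: mcons.
- apply/trivIsetP => /= i j _ _ ij; rewrite -preimage_setI.
  by move/trivIsetP : tF => /(_ _ _ _ _ ij) ->//; rewrite preimage_set0.
- by rewrite -preimage_bigcup; exact: mcons.
Qed.

HB.instance Definition _ := isMeasure.Build _ _ _ lebesgue_step
  lebesgue_step0 lebesgue_step_ge0 lebesgue_step_sigma_additive.

Let lebesgue_step_sigma_finite : sigma_finite setT lebesgue_step.
Proof.
have /sigma_finiteP[F [FT ndF Foo]] := sigma_finiteT (@lebesgue_measure R).
have /sigma_finiteP[G [GT ndG Goo]] := sigma_finiteT m.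
exists (fun k => @cvec_uncons R n @^-1` (F k `*` G k)).
  apply/esym; rewrite -subTset => x _.
  have [i _ Fi] : (\bigcup_i F i) (cvec_uncons x).1 by rewrite -FT.
  have [j _ Gj] : (\bigcup_j G j) (cvec_uncons x).2 by rewrite -GT.
  exists (maxn i j) => //; split.
  - by move: Fi; exact/subsetPset/ndF/leq_maxl.
  - by move: Gj; exact/subsetPset/ndG/leq_maxr.
move=> k; have [mF Fk] := Foo k; have [mG Gk] := Goo k; split.
  rewrite -[X in measurable X]setTI; apply: measurable_cvec_uncons => //.
  exact: measurableX.
rewrite /lebesgue_step -comp_preimage (_ : _ \o _ = id); last first.
  by apply/funext => x /=; rewrite cvec_consK.
by rewrite preimage_id product_measure1E// lte_mul_pinfty// ge0_fin_numE.
Qed.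

HB.instance Definition _ := Measure_isSigmaFinite.Build _ _ _ lebesgue_step
  lebesgue_step_sigma_finite.

End lebesgue_step.

(** Lebesgue measure on [R^n], as an iterated product; the product measures of
    the library are on pairs only. *)
Fixpoint lebesgue_cvec (R : realType) (n : nat) :
    {sigma_finite_measure set 'cV[R]_n -> \bar R} :=
  match n with
  | 0 => (\d_(0 : 'cV[R]_0))
  | k.+1 => (lebesgue_step (lebesgue_cvec R k))
  end.

Section Torus.
Variables (R : realType) (d : nat).
Implicit Types (x : 'cV[R]_d) (k l : 'cV[int]_d) (p q : \bar R).

Definition enorm x : R := Num.sqrt (\sum_i x i 0 ^+ 2).

Definition cube : set 'cV[R]_d :=
  [set x | forall i, - 2^-1 <= x i 0 < 2^-1].

Lemma measurable_cube : measurable cube.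
Proof.
rewrite (_ : cube =
    \bigcap_(i in [set: 'I_d]) (cvec_coord i @^-1` `[- 2^-1, 2^-1[)).
  apply: fin_bigcap_measurable => // i _; rewrite -[X in measurable X]setTI.
  by apply: measurable_cvec_coord => //; exact: measurable_itv.
apply/seteqP; split => x xc i.
  by move=> _ /=; rewrite in_itv/=; exact: xc.
by have := xc i I; rewrite /= in_itv.
Qed.

(** The torus is handled through periodic functions on [R^d], integrated over
    the fundamental domain [cube]. *)
Definition torus_measure : {measure set 'cV[R]_d -> \bar R} :=
  mrestr (lebesgue_cvec R d) measurable_cube.

Definition ivec k : 'cV[R]_d := map_mx intr k.

Definition periodic (f : 'cV[R]_d -> R[i]) :=
  forall k x, f (x + ivec k) = f x.

Definition measurable_cfun (f : 'cV[R]_d -> R[i]) :=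
  measurable_fun setT (fun x => complex.Re (f x) : measurableTypeR R) /\
  measurable_fun setT (fun x => complex.Im (f x) : measurableTypeR R).

Definition pnorm p (f : 'cV[R]_d -> R[i]) : \bar R :=
  Lnorm torus_measure p (fun x => (Normc.normc (f x))%:E).

Definition Lp p (f : 'cV[R]_d -> R[i]) :=
  [/\ periodic f, measurable_cfun f & (pnorm p f < +oo)%E].

Definition integralC (f : 'cV[R]_d -> R[i]) : R[i] :=
  Complex (\int[torus_measure]_x complex.Re (f x))
          (\int[torus_measure]_x complex.Im (f x)).

(** [exp (2 pi i (k, x))] *)
Definition character k x : R[i] :=
  let t := 2 * pi * \sum_i (k i 0)%:~R * x i 0 in Complex (cos t) (sin t).

Definition fourier (f : 'cV[R]_d -> R[i]) k : R[i] :=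
  integralC (fun x => f x * conjc (character k x)).

Definition spectrum (f : 'cV[R]_d -> R[i]) : set 'cV[int]_d :=
  [set k | fourier f k != 0].

Definition trigpoly (T : 'cV[R]_d -> R[i]) :=
  exists (s : seq 'cV[int]_d) (c : 'cV[int]_d -> R[i]),
    T = fun x => \sum_(k <- s) c k * character k x.

(** For [s = [:: i1; ...; ir]], the partial derivative [d_i1 ... d_ir g]. *)
Definition iter_partial (s : seq 'I_d) (g : 'cV[R]_d -> R) : 'cV[R]_d -> R :=
  foldr (fun i h x => 'D_(delta_mx i 0) h x) g s.

Definition smooth_real (g : 'cV[R]_d -> R) :=
  forall s : seq 'I_d, continuous (iter_partial s g) /\
    forall i x, derivable (iter_partial s g) x (delta_mx i 0).

Definition Cinfty (u : 'cV[R]_d -> R[i]) :=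
  [/\ periodic u, smooth_real (fun x => complex.Re (u x)) &
      smooth_real (fun x => complex.Im (u x))].

(** All partial derivatives of order at most [n] are bounded by [b]; this
    encodes the seminorms defining the topology of [Cinfty]. *)
Definition Cbound (n : nat) (u : 'cV[R]_d -> R[i]) (b : R) :=
  forall (s : seq 'I_d) x, (size s <= n)%N ->
    `|iter_partial s (fun y => complex.Re (u y)) x| <= b /\
    `|iter_partial s (fun y => complex.Im (u y)) x| <= b.

(** A continuous linear functional on [Cinfty]; its values outside of [Cinfty]
    are irrelevant. *)
Record periodic_distribution := PeriodicDistribution {
  pairing :> ('cV[R]_d -> R[i]) -> R[i];
  pairing_linear : forall (a : R[i]) u v, Cinfty u -> Cinfty v ->
    pairing (fun x => a * u x + v x) = a * pairing u + pairing v;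
  pairing_continuous : exists (n : nat) (c : R), forall u b,
    Cinfty u -> Cbound n u b -> Normc.normc (pairing u) <= c * b }.

(** The pairing of distributions with test functions is bilinear, hence the
    conjugate: for [u] given by a function [g] this is [fourier g k]. *)
Definition dfourier (u : periodic_distribution) k : R[i] :=
  u (fun x => conjc (character k x)).

(** [u] is the regular distribution given by the periodic function [g]. *)
Definition regular_distribution (u : periodic_distribution)
    (g : 'cV[R]_d -> R[i]) :=
  forall v, Cinfty v -> u v = integralC (fun x => g x * v x).

Definition dconv (T : 'cV[R]_d -> R[i]) (u : periodic_distribution) :
    'cV[R]_d -> R[i] := fun x =>
  \sum_(k \in [set: 'cV[int]_d]) fourier T k * dfourier u k * character k x.

Definition best_approx (A : 'M[R]_d) p (f : 'cV[R]_d -> R[i]) : \bar R :=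
  ereal_inf [set pnorm p (fun x => f x - T x) | T in
    [set T | trigpoly T /\
      spectrum T `<=` [set k | enorm (invmx A *m ivec k) < 1]]].

Definition multiplier_norm q (phi : 'cV[R]_d -> R[i]) : \bar R :=
  ereal_sup [set pnorm q (fun x => \sum_(k \in [set: 'cV[int]_d])
      fourier phi k * fourier g k * character k x) | g in
    [set g | Lp q g /\ (pnorm q g <= 1)%E]].

(** [digits A] is the set written D(A). *)
Definition digits (A : 'M[R]_d) : set 'cV[int]_d :=
  [set k | exists2 x, cube x & ivec k = A *m x].

End Torus.

Section Dilation.
Variables (R : realType) (d : nat) (M : 'M[int]_d).
Implicit Types (p q : \bar R) (N delta : R) (f : 'cV[R]_d -> R[i]).
Implicit Types (phi : nat -> 'cV[R]_d -> R[i]).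
Implicit Types (psi : nat -> periodic_distribution R d).

Definition dilation :=
  forall a : R[i], eigenvalue (map_mx intr M : 'M[R[i]]_d) a -> 1 < `|a|.

(** The powers of [M] and of its adjoint, as real matrices. *)
Definition mpow (j : nat) : 'M[R]_d := map_mx intr (M ^+ j).

Definition adjpow (j : nat) : 'M[R]_d := map_mx intr (M^T ^+ j).

Definition absdet : R := `|(\det M)%:~R|.

(** [1 / p], which is [0] for [p = +oo]. *)
Definition rinv p : R := fine p^-1%E.

Definition besov p (s : R) f := Lp p f /\
  (pnorm p f + \sum_(1 <= nu <oo)
     (absdet `^ (s / d%:R * nu%:R))%:E * best_approx (mpow nu) p f < +oo)%E.

(** Sequences indexed by the positive integers are functions on [nat] whose
    value at [0] is ignored. The balls are open, so that a frequency at distance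
    exactly [delta] from a nonzero integer point is allowed. *)
Definition class_B delta phi :=
  exists rho c : R, [/\ 0 < rho, 0 < c & forall j, (0 < j)%N ->
    [/\ trigpoly (phi j),
        forall l, spectrum (phi j) l -> exists x : 'cV[R]_d,
          [/\ ivec R l = adjpow j *m x, enorm x < rho &
              forall n, n != 0 -> ~ enorm (x - ivec R n) < delta] &
        forall l, Normc.normc (fourier (phi j) l) <= c]].

Definition strictly_compatible delta phi psi :=
  forall j l, (0 < j)%N -> enorm (invmx (adjpow j) *m ivec R l) <= delta ->
    dfourier (psi j) l * conjc (fourier (phi j) l) = 1.

Definition class_S N p psi := exists c cp : R,
  [/\ 0 < c, 0 < cp,
    forall j k, (0 < j)%N ->
      (~ digits (adjpow j) k -> Normc.normc (dfourier (psi j) k) <=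
         c * enorm (invmx (adjpow j) *m ivec R k) `^ N) /\
      (digits (adjpow j) k -> Normc.normc (dfourier (psi j) k) <= c) &
    forall n j T, (0 < j)%N -> (j <= n)%N -> trigpoly T ->
      spectrum T `<=` [set k | enorm (invmx (mpow n) *m ivec R k) <= 1] ->
      (pnorm p (dconv T (psi j)) <=
        (cp * absdet `^ (N / d%:R * (n%:R - j%:R)))%:E * pnorm p T)%E].

Definition mean_abs j (g : 'cV[R]_d -> R[i]) x : R :=
  (absdet ^+ j)^-1 * \sum_(k \in digits (mpow j))
     Normc.normc (g (x - invmx (mpow j) *m ivec R k)).

(** For [q < +oo], the integral is over [M^(-j) cube], a fundamental domain for
    the lattice [M^(-j) Z^d]. The value at [q = -oo] is irrelevant. *)
Definition Lnormj q j (g : 'cV[R]_d -> R[i]) : \bar R :=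
  (match q with
  | r%:E => ((absdet ^+ j)%:E *
      \int[lebesgue_cvec R d]_(x in [set invmx (mpow j) *m y | y in @cube R d])
        (mean_abs j g x `^ r)%:E) `^ r^-1
  | +oo => ereal_sup [set (mean_abs j g x)%:E | x in setT]
  | -oo => 0
  end)%E.

Definition class_L q (g : nat -> 'cV[R]_d -> R[i]) :=
  forall j, (0 < j)%N ->
    [/\ periodic (g j), measurable_cfun (g j) & (Lnormj q j (g j) < +oo)%E].

(** [<T, psi (. - M^(-j) k)>] for a trigonometric polynomial [T]. *)
Definition pair_trigpoly (T : 'cV[R]_d -> R[i]) (u : periodic_distribution R d)
    j k : R[i] :=
  \sum_(l \in [set: 'cV[int]_d]) fourier T l * conjc (dfourier u l) *
    character k (invmx (adjpow j) *m ivec R l).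

Definition near_best delta p f (sigma : R) (T : nat -> 'cV[R]_d -> R[i]) :=
  forall mu, [/\ trigpoly (T mu), spectrum (T mu) `<=` digits (mpow mu) &
    (pnorm p (fun x => f x - T mu x)%R <=
      sigma%:E * best_approx (delta *: mpow mu) p f)%E].

(** [<f, psi (. - M^(-j) k)>], the common limit along all sequences of
    near-best approximants of [f]. *)
Definition pair_limit delta p f (u : periodic_distribution R d) j k : R[i] :=
  xget 0 [set c | forall sigma T, near_best delta p f sigma T ->
    Normc.normc (pair_trigpoly (T mu) u j k - c) @[mu --> \oo] --> (0 : R)].

(** [<f, g (. - M^(-j) k)>] for an integrable function [g]. *)
Definition pair_integral f (g : 'cV[R]_d -> R[i]) j k : R[i] :=
  integralC (fun t => f t * conjc (g (t - invmx (mpow j) *m ivec R k))).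

(** The quasi-interpolation operator with the samples
    [a k = <f, psi_j (. - M^(-j) k)>]. *)
Definition Qop j (a : 'cV[int]_d -> R[i]) (phi : 'cV[R]_d -> R[i]) :
    'cV[R]_d -> R[i] := fun x =>
  (real_complex _ (absdet ^+ j)^-1) * \sum_(k \in digits (mpow j))
     a k * phi (x - invmx (mpow j) *m ivec R k).

End Dilation.

(* Main.v *)
Require Import Defs.
From HB Require Import structures.
From mathcomp Require Import all_boot all_order all_algebra.
From mathcomp Require Import finmap.
From mathcomp Require Import all_classical all_reals all_analysis.
From mathcomp Require Import complex.
From mathcomp Require Import measurable_realfun ess_sup_inf simple_functions.
From mathcomp Require Import ring lra zify.

Set Implicit Arguments.
Unset Strict Implicit.
Unset Printing Implicit Defensive.

Import Order.TTheory GRing.Theory Num.Theory numFieldNormedType.Exports.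

Local Open Scope classical_set_scope.
Local Open Scope ring_scope.

(** Put [m = |det M|] and [K = multiplier_norm q phi_j]. If the spectrum of a trigonometric
    polynomial [T] lies in [{l : |M^-j l| < delta}], then [Q_j T = T]: aliasing replaces a
    frequency [l] by its coset modulo [M^j], the spectral gap of [phi_j] leaves only [l],
    and strict compatibility makes its coefficient [1].

    By duality, [|Q_j a|_p] is at most the supremum of [m^-j sum_k a_k H (- M^-j k)] over
    trigonometric polynomials [H] with [|H|_q <= K] and spectrum in that of [phi_j]; for
    such [H], and for the polynomials [T * psi_j], a Marcinkiewicz-Zygmund inequality
    compares the discrete norms on the grid [M^-j Z^d] with the norms on the torus.

    First estimate: take near-best [T_nu] with spectrum in [{l : |M^-nu l| < delta}] and
    error at most [2 E_nu], where [E_nu] is the error of best approximation; apply this to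
    the samples of [T_(nu+1) - T_nu], whose norm is at most [2 (E_(nu+1) + E_nu)].
    The class S bound and Marcinkiewicz-Zygmund contribute the factor
    [m^((1/p + N/d) (nu - j))]. Summation over [nu >= j] bounds [Q_j (f - T_j)].

    Second estimate: the samples of [F = f - T] paired with [H] are bounded by
    [int |F| Theta], where [Theta t = m^-j sum_k |psi_j (t - M^-j k)| |H (- M^-j k)|].
    Jensen's inequality and the invariance of the mean of [|psi_j|] under the grid give
    [|Theta|_q <= C |psi_j|_(L_q,j) |H|_q].

    In both cases [|f - T|_p] itself is absorbed because at the frequency [0] strict
    compatibility gives [1 <= K * |psi_j^(0)|]. *)

(** The norm of [phi_j] is taken on L_q because pairing [Q_j a] with a test function lets the
    multiplier act on the test function; the samples [a] then only meet its values on the grid. The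
    endpoints [p = 1] and [p = +oo] are included, which excludes projections onto a spectrum:
    Dirichlet kernels are not uniformly bounded in L_1. The sampling inequality therefore rests on a
    kernel that reproduces polynomials and has bounded mass on the torus as well as on the grid. It
    is dominated by squares of Dirichlet kernels, so both masses come from counting frequencies, on
    the grid from counting those that coincide modulo [M^j]. At order [nu] this count is at most a
    constant times [m^(nu-j)], and Jensen's inequality lets it enter with the exponent [1/p]; the
    rest of the growth factor is that of class S. Spectra are prescribed in scaled Euclidean balls,
    whereas kernels factor over boxes. As [M] is diagonal, such a ball lies in a box with sides
    proportional to [|m_i|^nu], and the counts multiply coordinatewise to powers of [m], however
    unequal the [m_i] are. *)

Section LebesgueCvec.
Variable R : realType.
Local Notation mu := (@lebesgue_measure R).

(** * Invariance of Lebesgue measure under coordinatewise maps *)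

Lemma measurable_addr (c : R) : measurable_fun setT ((fun x => x + c) : measurableTypeR R ->
  measurableTypeR R).
Proof. exact: measurable_funD. Qed.

Lemma lebesgue_measureD (c : R) (A : set R) : measurable A ->
  mu ((fun x => x + c) @^-1` A) = mu A.
Proof.
move=> mA; rewrite -[LHS]/(pushforward mu ((fun x => x + c) : measurableTypeR R ->
  measurableTypeR R) A).
have mc := measurable_addr c.
apply/esym/lebesgue_measure_unique => //= _ [[a b]] _ <-.
rewrite /pushforward /=.
rewrite (_ : _ @^-1` _ = [set` `]a - c, b - c]]); last first.
  apply/seteqP; split => x /=; rewrite !in_itv/=; lra.
rewrite !lebesgue_measure_itv/= !lte_fin ltrD2r; case: ifPn => // _.
rewrite -!EFinD; congr EFin; lra.
Qed.

Lemma measurable_coord n (i : 'I_n) :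
  measurable_fun setT (fun x : 'cV[R]_n => x i 0 : measurableTypeR R).
Proof. exact: measurable_cvec_coord. Qed.

Lemma measurable_cvec_map n (f : 'I_n -> measurableTypeR R -> measurableTypeR R) :
  (forall i, measurable_fun setT (f i)) ->
  measurable_fun setT (fun x : 'cV[R]_n => (\col_i f i (x i 0) : 'cV[R]_n)).
Proof.
move=> mf; apply: measurable_fun_cvecP => i.
rewrite (_ : _ \o _ = f i \o (fun x : 'cV[R]_n => x i 0)).
  by apply: measurableT_comp => //; exact: measurable_coord.
by apply/funext => x /=; rewrite /cvec_coord mxE.
Qed.

Lemma measurable_cvec_preimage n (f : 'cV[R]_n -> 'cV[R]_n) (A : set 'cV[R]_n) :
  measurable_fun setT f -> measurable A -> measurable (f @^-1` A).
Proof. by move=> mf mA; rewrite -[X in measurable X]setTI; exact: mf. Qed.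

(** Induction on the dimension through the sections of [product_measure1]: since the map is
    coordinatewise, the section of the preimage at [x] is the preimage, under the remaining
    coordinate maps, of the section of [A] at [f ord0 x]. The first coordinate is absorbed by a
    pushforward integral. *)
Lemma lebesgue_cvec_map n (f : 'I_n -> measurableTypeR R -> measurableTypeR R) :
  (forall i, measurable_fun setT (f i)) ->
  (forall i A, measurable A -> lebesgue_measure (f i @^-1` A) = lebesgue_measure A) ->
  forall A, measurable A ->
  lebesgue_cvec R n ((fun x : 'cV[R]_n => (\col_i f i (x i 0) : 'cV[R]_n)) @^-1` A) =
    lebesgue_cvec R n A.
Proof.
elim: n f => [|n IH] f mf pf A mA.
  congr (lebesgue_cvec R 0 _); apply/seteqP; split => x /=.
    by rewrite (_ : (\col_i _) = x)//; apply/matrixP => -[].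
  by rewrite [in X in _ -> X](_ : (\col_i _) = x)//; apply/matrixP => -[].
rewrite /= /lebesgue_step /product_measure1.
set B := @cvec_cons R n @^-1` A.
have mB : measurable B by rewrite -[X in measurable X]setTI; exact: measurable_cvec_cons.
pose g i := f (lift ord0 i).
have E : forall x : R, xsection (@cvec_cons R n @^-1` ((fun x : 'cV[R]_n.+1 => (\col_i f i (x i 0)
  : 'cV[R]_n.+1)) @^-1` A)) x =
   (fun x : 'cV[R]_n => (\col_i g i (x i 0) : 'cV[R]_n)) @^-1` xsection B (f ord0 x).
  move=> x; apply/seteqP; split => v /=; rewrite /xsection /= !inE /= /B /=;
  have -> : \col_i f i (cvec_cons (x, v) i 0) = cvec_cons (f ord0 x, \col_i g i (v i 0)); 
    by [|apply/matrixP => i j; rewrite !mxE /=; case: splitP => k ik; rewrite !mxE ?ord1 /=;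
      [congr (f _ _)|congr (f _ _)]; apply: val_inj => /=; rewrite ik ?ord1 ?bump0].
transitivity (\int[mu]_x (lebesgue_cvec R n (xsection B (f ord0 x))))%E.
  apply: eq_integral => x _ /=; rewrite E IH//; first by move=> i; exact: mf.
    by move=> i C mC; exact: pf.
  exact: measurable_xsection.
have mF : measurable_fun setT (fun x => lebesgue_cvec R n (xsection B x)).
  exact: measurable_fun_xsection.
rewrite -[LHS](@ge0_integral_pushforward _ _ _ _ _ _ (mf ord0) (@lebesgue_measure R) setT (fun x =>
  lebesgue_cvec R n (xsection B x)))//.
apply: eq_measure_integral => C mC _; exact: pf.
Qed.

Lemma measurable_box n (I : 'I_n -> set R) : (forall i, measurable (I i : set (measurableTypeR R)))
  ->
  measurable [set x : 'cV[R]_n | forall i, I i (x i 0)].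
Proof.
move=> mI.
rewrite (_ : [set x | _] = \bigcap_(i in [set: 'I_n]) ((fun x : 'cV[R]_n => x i 0) @^-1` I i)).
  apply: fin_bigcap_measurable => // i _; rewrite -[X in measurable X]setTI.
  exact: measurable_coord.
by apply/seteqP; split => x xc i; [move=> _; exact: xc|exact: xc].
Qed.

Lemma lebesgue_cvec_box n (I : 'I_n -> set R) : (forall i, measurable (I i : set (measurableTypeR
  R))) ->
  lebesgue_cvec R n [set x : 'cV[R]_n | forall i, I i (x i 0)] = (\prod_(i < n) mu (I i))%E.
Proof.
elim: n I => [|n IH] I mI.
  rewrite big_ord0 /= diracE mem_set//=; by case.
rewrite big_ord_recl /= /lebesgue_step.
pose J i := I (lift ord0 i).
rewrite (_ : _ @^-1` _ = I ord0 `*` [set x : 'cV[R]_n | forall i, J i (x i 0)]).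
  rewrite product_measure1E//; last by apply: measurable_box => i; exact: mI.
  by rewrite IH// => i; exact: mI.
have E0 (a : R) (v : 'cV[R]_n) : cvec_cons (a, v) ord0 0 = a.
  by rewrite /cvec_cons mxE; case: splitP => // k _; rewrite mxE.
have E1 (a : R) (v : 'cV[R]_n) i : cvec_cons (a, v) (lift ord0 i) 0 = v i 0.
  rewrite /cvec_cons mxE; case: splitP => k /= ik; rewrite ?mxE /=.
    by move: (ltn_ord k); rewrite -ik.
  by congr (v _ _); apply: val_inj => /=; move: ik; rewrite /bump /=; lia.
apply/seteqP; split; case=> a v /=.
  move=> H; split => [|i]; first by have := H ord0; rewrite E0.
  by have := H (lift ord0 i); rewrite E1.
move=> [Ha Hv] i; case: (unliftP ord0 i) => [j ->|->]; first by rewrite E1; exact: Hv.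
by rewrite E0.
Qed.

(** * Fundamental domains of the integer lattice *)

Section FundamentalDomain.
Variable d : nat.
Local Notation lam := (lebesgue_cvec R d).

(** Kept abstract rather than fixed to [cube]: shifts and reflections of the cube and the union
    [tiles] of small cells also serve as domains of integration. *)
Definition fundamental (A : set 'cV[R]_d) := [/\ measurable A, forall x, exists k, A (x + ivec R k)
  & forall x k, A x -> A (x + ivec R k) -> k = 0].

Lemma measurable_shift (c : 'cV[R]_d) : measurable_fun setT (fun x : 'cV[R]_d => x + c).
Proof.
rewrite (_ : (fun x => _) = (fun x : 'cV[R]_d => (\col_i (fun i t => t + c i 0) i (x i 0) :
  'cV[R]_d))).
  by apply: (@measurable_cvec_map d (fun i t => t + c i 0)) => i; exact: measurable_addr.
by apply/funext => x; apply/matrixP => i j; rewrite !mxE !ord1.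
Qed.

Lemma lebesgue_cvec_shift (c : 'cV[R]_d) A : measurable A -> lam ((fun x => x + c) @^-1` A) = lam A.
Proof.
move=> mA.
rewrite (_ : (fun x => _) = (fun x : 'cV[R]_d => (\col_i (fun i t => t + c i 0) i (x i 0) :
  'cV[R]_d))).
  apply: (@lebesgue_cvec_map d (fun i t => t + c i 0)) => // [i|i B mB]; [exact: measurable_addr|
    exact: lebesgue_measureD].
by apply/funext => x; apply/matrixP => i j; rewrite !mxE !ord1.
Qed.

Lemma measurable_cvec_opp : measurable_fun setT (fun x : 'cV[R]_d => - x).
Proof.
rewrite (_ : (fun x => _) = (fun x : 'cV[R]_d => (\col_i (fun (_ : 'I_d) t => - t) i (x i 0) :
  'cV[R]_d))).
  by apply: (@measurable_cvec_map d (fun i t => - t)) => i; exact: oppr_measurable.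
by apply/funext => x; apply/matrixP => i j; rewrite !mxE !ord1.
Qed.

Lemma lebesgue_cvec_opp (A : set 'cV[R]_d) : measurable A -> lam ((fun x => - x) @^-1` A) = lam A.
Proof.
move=> mA.
rewrite (_ : (fun x => _) = (fun x : 'cV[R]_d => (\col_i (fun (_ : 'I_d) t => - t) i (x i 0) :
  'cV[R]_d))).
  apply: (@lebesgue_cvec_map d (fun i t => - t)) => // [i|i B mB]; [exact: oppr_measurable|
    exact: lebesgue_measureN].
by apply/funext => x; apply/matrixP => i j; rewrite !mxE !ord1.
Qed.

Local Open Scope ereal_scope.

Lemma integral_lebesgue_preserve (s : 'cV[R]_d -> 'cV[R]_d) (F : 'cV[R]_d -> \bar R) D :
  measurable_fun setT s -> (forall A, measurable A -> lam (s @^-1` A) = lam A) ->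
  measurable D -> measurable_fun setT F -> (forall x, 0 <= F x) ->
  \int[lam]_(x in s @^-1` D) F (s x) = \int[lam]_(x in D) F x.
Proof.
move=> ms ps mD mF F0.
rewrite -[LHS](@ge0_integral_pushforward _ _ _ _ _ _ ms lam D F)//.
  apply: eq_measure_integral => C mC _; exact: ps.
exact: measurable_funTS.
Qed.

Lemma ivecD (k l : 'cV[int]_d) : ivec R (k + l)%R = (ivec R k + ivec R l)%R.
Proof. by rewrite /ivec map_mxD. Qed.

Lemma ivecN (k : 'cV[int]_d) : ivec R (- k)%R = (- ivec R k)%R.
Proof. by rewrite /ivec map_mxN. Qed.

Lemma ivec0 : ivec R (0 : 'cV[int]_d) = 0%R.
Proof. by rewrite /ivec map_mx0. Qed.

(** Both sets consist of the same pieces up to translation: [A] is the disjoint union of the sets A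
    ∩ (B - k), [B] that of the sets (A + k) ∩ B, and translation by [k] carries the former to the
    latter without changing [F] or the measure. *)
Lemma fundamental_integral A B (F : 'cV[R]_d -> \bar R) : fundamental A -> fundamental B ->
  measurable_fun setT F -> (forall x, 0 <= F x) -> (forall k x, F (x + ivec R k)%R = F x) ->
  \int[lam]_(x in A) F x = \int[lam]_(x in B) F x.
Proof.
move=> [mA cA uA] [mB cB uB] mF F0 pF.
pose sh (k : 'cV[int]_d) := fun x : 'cV[R]_d => (x + ivec R k)%R.
(* Lattice vectors are numbered by [pickle]; the test [pickle k == n] discards other numbers that
   decode to the same [k], so that no piece is counted twice. *)
pose dec (n : nat) (S : 'cV[int]_d -> set 'cV[R]_d) :=
  if (choice.unpickle n : option 'cV[int]_d) is Some k then
    if choice.pickle k == n then S k else set0 else set0.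
have key (S : 'cV[int]_d -> set 'cV[R]_d) U : (forall k, measurable (S k)) ->
  (forall x k l, S k x -> S l x -> k = l) -> U = \bigcup_k S k ->
  \int[lam]_(x in U) F x = \sum_(n <oo) \int[lam]_(x in dec n S) F x.
  move=> mS tS ->.
  rewrite -ge0_integral_bigcup//.
  - congr (integral lam _ _); apply/seteqP; split => x.
      move=> [k _ Sk]; exists (choice.pickle k) => //=.
      by rewrite /dec choice.pickleK eqxx.
    move=> [n _]; rewrite /dec; case: choice.unpickle => // k; case: ifP => // _ Sk.
    by exists k.
  - by move=> n; rewrite /dec; case: choice.unpickle => // k; case: ifP.
  - exact: measurable_funTS.
  - apply/trivIsetP => i j _ _ ij; rewrite /dec.
    case Ei: choice.unpickle => [k|]; last by rewrite set0I.
    case: eqP => ik; last by rewrite set0I.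
    case Ej: choice.unpickle => [l|]; last by rewrite setI0.
    case: eqP => jl; last by rewrite setI0.
    rewrite -subset0 => x [Sk Sl].
    by move: ij; rewrite -ik -jl (tS _ _ _ Sk Sl) eqxx.
have msh k : measurable_fun setT (sh k) by exact: measurable_shift.
have mshp k C : measurable C -> measurable (sh k @^-1` C).
  by move=> mC; apply: measurable_cvec_preimage.
rewrite (key (fun k => A `&` sh k @^-1` B)); first last.
- apply/seteqP; split => x; last by case=> k _ [].
  by move=> Ax; have [k Bk] := cB x; exists k.
- move=> x k l [_ Bk] [_ Bl]; apply/eqP; rewrite eq_sym -subr_eq0; apply/eqP.
  by apply: uB Bk _; rewrite /sh -addrA -ivecD addrCA subrr addr0.
- by move=> k; apply: measurableI => //; exact: mshp.
rewrite (key (fun k => sh (- k)%R @^-1` A `&` B)); first last.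
- apply/seteqP; split => x; last by case=> k _ [].
  by move=> Bx; have [k Ak] := cA x; exists (- k)%R => //; rewrite opprK.
- move=> x k l [Ak _] [Al _]; apply/eqP; rewrite -subr_eq0; apply/eqP.
  by apply: uA Ak _; rewrite /sh -addrA -ivecD addrA addNr sub0r.
- by move=> k; apply: measurableI => //; exact: mshp.
apply: eq_eseriesr => n _; rewrite /dec; case: choice.unpickle => [k|];
  last by rewrite !integral_set0.
case: eqP => _; last by rewrite !integral_set0.
rewrite -(@integral_lebesgue_preserve (sh k) F (sh (- k)%R @^-1` A `&` B))//; first last.
- by apply: measurableI => //; exact: mshp.
- by move=> C mC; exact: lebesgue_cvec_shift.
rewrite preimage_setI -comp_preimage.
rewrite (_ : sh _ \o sh k = id) ?preimage_id; last first.
  by apply/funext => x /=; rewrite /sh -addrA -ivecD subrr ivec0 addr0.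
by apply: eq_integral => x _; rewrite /sh pF.
Qed.

End FundamentalDomain.
End LebesgueCvec.

(** * The torus: tilings by grid cells and invariance of the integral *)

Section Torus.
Variables (R : realType) (d : nat).
Local Notation lam := (lebesgue_cvec R d).
Local Notation tor := (torus_measure R d).
Local Notation mu := (@lebesgue_measure R).

Lemma fundamental_cube : fundamental (@cube R d).
Proof.
split; first exact: measurable_cube.
- move=> x; exists (\col_i - Num.floor (x i 0 + 2^-1)) => i; rewrite !mxE /= mulrNz.
  have /andP[h1 h2] := floor_itv (x i 0 + 2^-1).
  by rewrite intrD in h2; lra.
- move=> x k cx cxk; apply/matrixP => i j; rewrite ord1 [RHS]mxE.
  have := cx i; have := cxk i; rewrite !mxE /= => /andP[h1 h2] /andP[h3 h4].
  have h5 : (k i 0)%:~R < (1%:~R : R) by rewrite [1%:~R]/1 /=; lra.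
  have h6 : ((-1)%:~R : R) < (k i 0)%:~R by rewrite mulrN1z; lra.
  by move: h5 h6; rewrite !ltr_int; lia.
Qed.

Lemma measurable_scale1 (c : R) : measurable_fun setT ((fun x => c * x) : measurableTypeR R ->
  measurableTypeR R).
Proof. exact: measurable_funM. Qed.

Lemma measurable_cell1 (c : R) : measurable ([set t | - 2^-1 <=
  c * t < 2^-1] : set (measurableTypeR R)).
Proof.
rewrite (_ : [set t | _] = (fun x => c * x) @^-1` `[- 2^-1, 2^-1[).
  by rewrite -[X in measurable X]setTI; apply: measurable_scale1 => //; exact: measurable_itv.
by apply/seteqP; split => x /=; rewrite in_itv.
Qed.

Lemma lebesgue_cell1 (c : R) : c != 0 -> mu [set t | - 2^-1 <= c * t < 2^-1] = (`|c|^-1)%:E.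
Proof.
move=> c0; have [cp|cn] : 0 < c \/ c < 0 by apply/orP; rewrite -neq_lt eq_sym.
  rewrite (_ : [set t | _] = [set` `[- 2^-1 / c, 2^-1 / c[]).
    rewrite lebesgue_measure_itv /= lte_fin ltr_pM2r ?invr_gt0//.
    rewrite ifT; last by lra.
    by rewrite -EFinD -mulrBl gtr0_norm//; congr EFin; field.
  by apply/seteqP; split => x /=; rewrite in_itv/= ler_pdivrMr// ltr_pdivlMr// mulrC.
rewrite (_ : [set t | _] = [set` `]2^-1 / c, - 2^-1 / c]]).
  rewrite lebesgue_measure_itv /= lte_fin ltr_nM2r ?invr_lt0//.
  rewrite ifT; last by lra.
  by rewrite -EFinD -mulrBl ltr0_norm//; congr EFin; field.
by apply/seteqP; split => x /=; rewrite in_itv/= ltr_ndivrMr// ler_ndivlMr// mulrC andbC.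
Qed.

Lemma lebesgue_cube : lam (@cube R d) = 1%E.
Proof.
rewrite (_ : @cube R d = [set x | forall i, [set t | - 2^-1 <= 1 * t < 2^-1] (x i 0)]).
  rewrite (@lebesgue_cvec_box R d (fun i => [set t | - 2^-1 <= 1 * t < 2^-1])); last by move=> i;
    exact: measurable_cell1.
  by rewrite big1// => i _; rewrite lebesgue_cell1 ?oner_eq0// normr1 invr1.
by apply/seteqP; split => x H i; have := H i; rewrite /= mul1r.
Qed.

Section Tiling.
Variable e : 'I_d -> int.
Hypothesis e0 : forall i, e i != 0.

(** For [e] the diagonal of [M ^ j], these four are [M^-j cube], the point [M^-j k], the digit set
    [D(M^j)] and the vector [M^j r]; the first three are identified in [cellE], [invmpow_ivec] and
    [digitsE]. *)
Definition cell : set 'cV[R]_d := [set x | forall i, - 2^-1 <= (e i)%:~R * x i 0 < 2^-1].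
Definition grid (k : 'cV[int]_d) : 'cV[R]_d := \col_i ((k i 0)%:~R / (e i)%:~R).
Definition dig : set 'cV[int]_d := [set k | cube (grid k)].
Definition smul (r : 'cV[int]_d) : 'cV[int]_d := \col_i (e i * r i 0).

Let eR0 i : (e i)%:~R != 0 :> R. Proof. by rewrite intr_eq0. Qed.

Lemma gridD k l : grid (k + l) = grid k + grid l.
Proof. by apply/matrixP => i j; rewrite !mxE intrD mulrDl. Qed.

Lemma gridN k : grid (- k) = - grid k.
Proof. by apply/matrixP => i j; rewrite !mxE mulrNz mulNr. Qed.

Lemma grid0 : grid 0 = 0.
Proof. by apply/matrixP => i j; rewrite !mxE mul0r. Qed.

Lemma grid_smul r : grid (smul r) = ivec R r.
Proof. by apply/matrixP => i j; rewrite !mxE ord1 intrM mulrAC divff// mul1r. Qed.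

Lemma dig_ex k : exists r, dig (k + smul r).
Proof.
have [_ /(_ (grid k)) [r hr] _] := fundamental_cube.
by exists r; rewrite /dig /= gridD grid_smul.
Qed.

Lemma dig_uniq k r : dig k -> dig (k + smul r) -> r = 0.
Proof.
have [_ _ u] := fundamental_cube; rewrite /dig /= gridD grid_smul; exact: u.
Qed.

Lemma smul0 : smul 0 = 0.
Proof. by apply/matrixP => i j; rewrite !mxE mulr0. Qed.

Lemma smulD r s : smul (r + s) = smul r + smul s.
Proof. by apply/matrixP => i j; rewrite !mxE mulrDr. Qed.

Lemma smulN r : smul (- r) = - smul r.
Proof. by apply/matrixP => i j; rewrite !mxE mulrN. Qed.

Definition boxset (L : 'I_d -> nat) : set 'cV[int]_d := [set k : 'cV[int]_d | forall i, (`|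
  k i ord0| <= L i)%N].

(** The offset [L i] moves the range [0 .. 2 L i] to [- L i .. L i]; finiteness and cardinality of
    integer boxes are read off from this parametrisation. *)
Definition boxmap (L : 'I_d -> nat) (c : {dffun forall i : 'I_d, 'I_(L i).*2.+1}) : 'cV[int]_d :=
  \col_i ((c i : nat)%:Z - (L i)%:Z).

Lemma boxset_image L : boxset L = [set boxmap c | c in [set: {dffun forall i : 'I_d,
  'I_(L i).*2.+1}]].
Proof.
apply/seteqP; split => [k hk|k [c _ <-] i]; last first.
  by rewrite mxE; have := ltn_ord (c i); lia.
exists [ffun i => inord (absz (k i ord0 + (L i)%:Z))] => //.
apply/matrixP => i j; rewrite mxE ffunE (_ : j = ord0); last exact: ord1.
have hi : (`|k i ord0| <= L i)%N := hk i.
by rewrite inordK; lia.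
Qed.

Lemma finite_boxset L : finite_set (boxset L).
Proof. by rewrite boxset_image; apply: finite_image; exact: finite_finset. Qed.

Lemma boxmap_inj L : injective (@boxmap L).
Proof.
move=> a b /matrixP ab; apply/ffunP => i; apply: val_inj => /=.
by have := ab i 0; rewrite !mxE; lia.
Qed.

Lemma dig_box k : dig k -> boxset (fun i => `|e i|%N) k.
Proof.
move=> hk i; have := hk i; rewrite mxE => h.
have : `|(k i 0)%:~R / (e i)%:~R : R| <= 1 by rewrite ler_norml; lra.
rewrite normrM normfV ler_pdivrMr ?normr_gt0// mul1r -!intr_norm ler_int [X in k i X](_ : _ =
  ord0)//; lia.
Qed.

Lemma finite_dig : finite_set dig.
Proof. by apply: sub_finite_set dig_box _; exact: finite_boxset. Qed.

(** [dig] holds exactly one representative of each class modulo [smul], so sending [k] to the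
    representative of [k + n] permutes [dig]. *)
Lemma dig_sum_shift (V : nmodType) (F : 'cV[int]_d -> V) n :
  (forall k r, F (k + smul r) = F k) ->
  \sum_(k \in dig) F (k + n) = \sum_(k \in dig) F k.
Proof.
move=> pF.
pose red k := k + smul (projT1 (cid (dig_ex k))).
have redP k : dig (red k) by rewrite /red; case: cid.
have redE k : exists r, red k = k + smul r by rewrite /red; eexists.
have redu k l r : dig l -> red k = l + smul r -> r = 0.
  by move=> dl E; apply: (dig_uniq dl); rewrite -E.
rewrite [RHS](reindex_fsbig (fun k => red (k + n)) dig dig); last first.
  split.
  - by move=> k _; exact: redP.
  - move=> k l; rewrite !inE => dk dl /=.
    have [r ->] := redE (k + n); have [s ->] := redE (l + n) => E.
    have E2 : k = l + smul (s - r).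
      rewrite smulD smulN -[LHS](addrK n) -[X in X - n](addrK (smul r)) E.
      by rewrite (addrAC l n) (addrAC _ n) addrK addrA.
    by rewrite E2 in dk *; rewrite (dig_uniq dl dk) smul0 addr0.
  - move=> l dl; exists (red (l - n)) => //=.
    have [r E1] := redE (l - n); have [s E2] := redE (red (l - n) + n).
    have E3 : red (red (l - n) + n) = l + smul (r + s).
      by rewrite E2 E1 smulD addrA; congr (_ + _); rewrite addrAC subrK.
    by rewrite E3 (redu _ _ _ dl E3) smul0 addr0.
apply: eq_fsbigr => k _; have [r ->] := redE (k + n); by rewrite pF.
Qed.

Lemma measurable_cell : measurable cell.
Proof. by apply: (@measurable_box R d (fun i => [set t | - 2^-1 <= (e i)%:~R * t < 2^-1])) => i;
  exact: measurable_cell1. Qed.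

Lemma lebesgue_cell : lam cell = (\prod_(i < d) `|(e i)%:~R : R|^-1)%:E.
Proof.
rewrite (@lebesgue_cvec_box R d (fun i => [set t | - 2^-1 <= (e i)%:~R * t < 2^-1]));
  last by move=> i; exact: measurable_cell1.
rewrite -prodEFin; apply: eq_bigr => i _; exact: lebesgue_cell1.
Qed.

Definition tiles : set 'cV[R]_d := [set x | exists2 k, dig k & cell (x - grid k)].

Lemma grid_cell x k : cell (x - grid k) <-> cube ((\col_i ((e i)%:~R * x i 0)) - ivec R k).
Proof.
by split => H i; have := H i; rewrite !mxE mulrBr mulrCA divff// mulr1.
Qed.

Lemma tilesE : tiles = \big[setU/set0]_(k <- fset_set dig) [set x | cell (x - grid k)].
Proof.
rewrite -bigcup_seq; apply/seteqP; split => x /=.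
  by move=> [k dk ck]; exists k => //=; rewrite in_fset_set ?inE//; exact: finite_dig.
by move=> [k /= + ck]; rewrite in_fset_set ?inE//; [exists k|exact: finite_dig].
Qed.

Lemma measurable_shift_cell k : measurable [set x | cell (x - grid k)].
Proof.
rewrite -[X in measurable X]/((fun x => x + - grid k) @^-1` cell).
by apply: measurable_cvec_preimage; [exact: measurable_shift|exact: measurable_cell].
Qed.

(** After scaling by [e], [grid_cell] turns the cells into unit cubes around integer points. The
    scaled point lies in exactly one of these; reducing its center to a digit modulo [smul] amounts
    to one integer translation of [x]. *)
Lemma fundamental_tiles : fundamental tiles.
Proof.
have [_ ex u] := fundamental_cube.
split.
- rewrite tilesE; apply: bigsetU_measurable => k _; exact: measurable_shift_cell.
- move=> x; have [n hn] := ex (\col_i ((e i)%:~R * x i 0)).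
  have [r hr] := dig_ex (- n); exists r; exists (- n + smul r) => //.
  apply/grid_cell; rewrite ivecD ivecN opprD opprK.
  rewrite (_ : _ + _ = \col_i ((e i)%:~R * x i 0) + ivec R n)//.
  by apply/matrixP => i j; rewrite !mxE !ord1 intrM; ring.
- move=> x l [k dk /grid_cell ck] [k' dk' /grid_cell ck'].
  have E : k' = k + smul l.
    apply/eqP; rewrite -subr_eq0; apply/eqP.
    rewrite -[LHS]opprK -[RHS]oppr0; congr (- _); apply: u ck _.
    move: ck'; rewrite (_ : \col_i ((e i)%:~R * (x + ivec R l) i 0) - ivec R k' =
      \col_i ((e i)%:~R * x i 0) - ivec R k + ivec R (- (k' - (k + smul l))))//.
    by apply/matrixP => i j; rewrite !mxE !ord1 !(intrD, intrM, mulrNz); ring.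
  by apply: (dig_uniq dk); rewrite -E.
Qed.

Local Open Scope ereal_scope.

Lemma tile_integral (F : 'cV[R]_d -> \bar R) : measurable_fun setT F ->
  (forall x, 0 <= F x) -> (forall k x, F (x + ivec R k)%R = F x) ->
  (forall k x, F (x + grid k)%R = F x) ->
  \int[lam]_(x in @cube R d) F x = (size (fset_set dig))%:R%:E * \int[lam]_(x in cell) F x.
Proof.
move=> mF F0 pF gF.
rewrite (fundamental_integral fundamental_cube fundamental_tiles)// tilesE.
rewrite ge0_integral_bigsetU//.
- rewrite (eq_bigr (fun=> \int[lam]_(x in cell) F x)); last first.
    move=> k _.
    rewrite -(@integral_lebesgue_preserve _ _ (fun x => x + - grid k)%R F cell)//.
    + by apply: eq_integral => x _; rewrite -gridN gF.
    + exact: measurable_shift.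
    + by move=> A mA; exact: lebesgue_cvec_shift.
    + exact: measurable_cell.
  by rewrite big_const_seq count_predT iter_addr_0 mule_natl.
- by move=> k; exact: measurable_shift_cell.
- apply/trivIsetP => k l; rewrite /= !in_fset_set ?inE//; [|exact: finite_dig..].
  move=> dk dl kl; rewrite -subset0 => x [/= /grid_cell ck /grid_cell cl].
  have [_ _ u] := fundamental_cube.
  have := u _ (k - l)%R ck; rewrite ivecD ivecN addrA subrK => /(_ cl) /eqP.
  by rewrite subr_eq0 (negbTE kl).
- exact: measurable_funTS.
Qed.

(** A volume count: for the constant 1, [tile_integral] says that the cells indexed by [dig] fill
    the unit cube, and the volume of one cell is known. *)
Lemma size_dig : ((size (fset_set dig))%:R = \prod_(i < d) `|(e i)%:~R : R|)%R.
Proof.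
have := @tile_integral (cst 1) (measurable_cst _) (fun _ => lee01) (fun _ _ => erefl) (fun _ _ =>
  erefl).
have -> : \int[lam]_(x in @cube R d) cst 1 x = 1.
  by rewrite integral_cst ?mul1e; [exact: lebesgue_cube|exact: measurable_cube].
have -> : \int[lam]_(x in cell) cst 1 x = (\prod_(i < d) `|(e i)%:~R : R|^-1)%R%:E.
  by rewrite integral_cst ?mul1e; [exact: lebesgue_cell|exact: measurable_cell].
rewrite -EFinM => -[].
rewrite prodrV; last by move=> i _; rewrite unitfE normr_eq0.
move=> H.
have P0 : (\prod_(i < d) `|(e i)%:~R : R| != 0)%R.
  by apply/prodf_neq0 => i _; rewrite normr_eq0.
by apply: (mulIf (invr_neq0 P0)); rewrite -H divff.
Qed.
Local Close Scope ereal_scope.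

End Tiling.

Local Open Scope ereal_scope.

Lemma integral_torus (F : 'cV[R]_d -> \bar R) : measurable_fun setT F ->
  \int[tor]_x F x = \int[lam]_(x in @cube R d) F x.
Proof.
have mc := @measurable_cube R d.
move=> mF; transitivity (\int[tor]_(x in @cube R d) F x).
  rewrite -(@setUv _ (@cube R d)) integral_setU//; first last.
  - by apply/disj_setPS => x [].
  - by rewrite setUv.
  - exact: measurableC.
  rewrite [X in _ + X](_ : _ = 0) ?adde0//.
  have N0 : tor (~` @cube R d) = 0 by rewrite /torus_measure /= /mrestr setICl measure0.
  rewrite (ae_eq_integral (cst 0))//.
  - by rewrite integral0.
  - exact: measurableC.
  - exact: measurable_funTS.
  - exists (~` @cube R d); split => //; first exact: measurableC.
    by move=> x /= h xc; apply: h.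
apply: eq_measure_integral => A mA Ac.
by rewrite /torus_measure /= /mrestr setIidl.
Qed.

Lemma torus1 : tor setT = 1.
Proof. by rewrite /torus_measure /= /mrestr setTI lebesgue_cube. Qed.

Definition eperiodic (F : 'cV[R]_d -> \bar R) := forall k x, F (x + ivec R k)%R = F x.

(** [s] need not preserve the cube. It carries the cube to [B], which only has to be another
    fundamental domain; periodicity of [F] moves the integral back. *)
Lemma integral_torus_preserve (s : 'cV[R]_d -> 'cV[R]_d) B (F : 'cV[R]_d -> \bar R) :
  measurable_fun setT s -> (forall A, measurable A -> lam (s @^-1` A) = lam A) ->
  fundamental B -> s @^-1` B = @cube R d -> measurable_fun setT F -> eperiodic F ->
  \int[tor]_x F (s x) = \int[tor]_x F x.
Proof.
move=> ms ps fB sB mF pF.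
suff ge0 G : measurable_fun setT G -> eperiodic G -> (forall x, 0 <= G x) ->
    \int[tor]_x G (s x) = \int[tor]_x G x.
  rewrite integralE [RHS]integralE; congr (_ - _).
    rewrite (_ : (fun x => F (s x))^\+ = (fun x => F^\+ (s x))); last by rewrite funepos.unlock.
    apply: ge0 => [|k x|x]; [exact: measurable_funepos|by rewrite funepos.unlock pF|
      exact: funepos_ge0].
  rewrite (_ : (fun x => F (s x))^\- = (fun x => F^\- (s x))); last by rewrite funeneg.unlock.
  apply: ge0 => [|k x|x]; [exact: measurable_funeneg|by rewrite funeneg.unlock pF|
    exact: funeneg_ge0].
move=> mG pG G0; rewrite !integral_torus//; last exact: measurableT_comp.
rewrite [RHS](fundamental_integral fundamental_cube fB)// -sB.
by case: fB => mB _ _; rewrite integral_lebesgue_preserve.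
Qed.

Lemma integral_torus_shift (c : 'cV[R]_d) (F : 'cV[R]_d -> \bar R) :
  measurable_fun setT F -> eperiodic F -> \int[tor]_x F (x + c)%R = \int[tor]_x F x.
Proof.
have [mc ex u] := fundamental_cube.
apply: (@integral_torus_preserve _ ((fun x => x - c)%R @^-1` @cube R d)).
- exact: measurable_shift.
- by move=> A; exact: lebesgue_cvec_shift.
- split; first by apply: measurable_cvec_preimage => //; exact: measurable_shift.
    by move=> x; have [k hk] := ex (x - c)%R; exists k; rewrite /= addrAC.
  by move=> x k h; rewrite /= addrAC => h2; exact: u h h2.
- by apply/seteqP; split => x /=; rewrite addrK.
Qed.

Lemma integral_torus_opp (F : 'cV[R]_d -> \bar R) :
  measurable_fun setT F -> eperiodic F -> \int[tor]_x F (- x)%R = \int[tor]_x F x.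
Proof.
have [mc ex u] := fundamental_cube.
apply: (@integral_torus_preserve _ ((fun x => - x)%R @^-1` @cube R d)).
- exact: measurable_cvec_opp.
- by move=> A; exact: lebesgue_cvec_opp.
- split; first by apply: measurable_cvec_preimage => //; exact: measurable_cvec_opp.
    by move=> x; have [k hk] := ex (- x)%R; exists (- k)%R; rewrite /= ivecN opprB addrC.
  move=> x k h; rewrite /= opprD -ivecN => h2; apply/eqP; rewrite -oppr_eq0; apply/eqP.
  exact: u h h2.
- by apply/seteqP; split => x /=; rewrite opprK.
Qed.

End Torus.

Notation nc := Normc.normc.

(** * Complex numbers and the exponential [e1] *)

Section ComplexNumbers.
Variable R : realType.
Implicit Types z w : R[i].

Lemma ReM z w : complex.Re (z * w) = complex.Re z * complex.Re w - complex.Im z * complex.Im w.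
Proof. by case: z => a b; case: w. Qed.

Lemma ImM z w : complex.Im (z * w) = complex.Re z * complex.Im w + complex.Im z * complex.Re w.
Proof. by case: z => a b; case: w => c d /=; rewrite addrC. Qed.

Lemma ReD z w : complex.Re (z + w) = complex.Re z + complex.Re w.
Proof. by case: z => a b; case: w. Qed.

Lemma ImD z w : complex.Im (z + w) = complex.Im z + complex.Im w.
Proof. by case: z => a b; case: w. Qed.

Lemma ReN z : complex.Re (- z) = - complex.Re z.
Proof. by case: z. Qed.

Lemma ImN z : complex.Im (- z) = - complex.Im z.
Proof. by case: z. Qed.

Lemma ReJ z : complex.Re (conjc z) = complex.Re z.
Proof. by case: z. Qed.

Lemma ImJ z : complex.Im (conjc z) = - complex.Im z.
Proof. by case: z. Qed.

Lemma ncE z : nc z = Num.sqrt (complex.Re z ^+ 2 + complex.Im z ^+ 2).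
Proof. by case: z. Qed.

Lemma nc_ge0 z : 0 <= nc z.
Proof. by rewrite ncE sqrtr_ge0. Qed.

Lemma ncM z w : nc (z * w) = nc z * nc w.
Proof. exact: Normc.normcM. Qed.

Lemma nc0 : nc (0 : R[i]) = 0.
Proof. exact: Normc.normc0. Qed.

Lemma nc1 : nc (1 : R[i]) = 1.
Proof. exact: Normc.normc1. Qed.

Lemma ncD z w : nc (z + w) <= nc z + nc w.
Proof. exact: le_normcD. Qed.

Lemma ncN z : nc (- z) = nc z.
Proof. exact: normcN. Qed.

Lemma ncB z w : nc (z - w) = nc (w - z).
Proof. by rewrite -ncN opprB. Qed.

Lemma ncJ z : nc (conjc z) = nc z.
Proof. by rewrite !ncE ReJ ImJ sqrrN. Qed.

Lemma nc_real (a : R) : nc (real_complex _ a) = `|a|.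
Proof. by rewrite ncE /= expr0n/= addr0 sqrtr_sqr. Qed.

Lemma Re_le_nc z : `|complex.Re z| <= nc z.
Proof. by rewrite ncE -sqrtr_sqr ler_wsqrtr// lerDl sqr_ge0. Qed.

Lemma Im_le_nc z : `|complex.Im z| <= nc z.
Proof. by rewrite ncE -sqrtr_sqr ler_wsqrtr// lerDr sqr_ge0. Qed.

Lemma nc_sqr z : nc z ^+ 2 = complex.Re z ^+ 2 + complex.Im z ^+ 2.
Proof. by rewrite ncE sqr_sqrtr// addr_ge0// sqr_ge0. Qed.

Lemma mulJ z : z * conjc z = real_complex _ (nc z ^+ 2).
Proof. by rewrite nc_sqr; case: z => a b /=; congr Complex; ring. Qed.

Lemma nc_sum (I : Type) (s : seq I) (P : pred I) (F : I -> R[i]) :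
  nc (\sum_(i <- s | P i) F i) <= \sum_(i <- s | P i) nc (F i).
Proof.
elim/big_ind2 : _ => //; first by rewrite nc0.
by move=> z a w b za wb; apply: (le_trans (ncD _ _)); exact: lerD.
Qed.

Lemma conjc_sum (I : Type) (s : seq I) (P : pred I) (F : I -> R[i]) :
  conjc (\sum_(i <- s | P i) F i) = \sum_(i <- s | P i) conjc (F i).
Proof. exact: raddf_sum. Qed.

Lemma conjcM z w : conjc (z * w) = conjc z * conjc w.
Proof. exact: rmorphM. Qed.

Definition e1 (t : R) : R[i] := Complex (cos (2 * pi * t)) (sin (2 * pi * t)).

Lemma e1D s t : e1 (s + t) = e1 s * e1 t.
Proof. by rewrite /e1 mulrDr cosD sinD; congr Complex; rewrite addrC. Qed.

Lemma e1_0 : e1 0 = 1.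
Proof. by rewrite /e1 mulr0 cos0 sin0. Qed.

Lemma nc_e1 t : nc (e1 t) = 1.
Proof. by rewrite ncE /= cos2Dsin2 sqrtr1. Qed.

Lemma e1J t : conjc (e1 t) = e1 (- t).
Proof. by rewrite /e1 /= mulrN cosN sinN. Qed.

Lemma e1_1 : e1 1 = 1.
Proof. by rewrite /e1 mulr1 mulr_natl cos2pi sin2pi. Qed.

Lemma e1_half : e1 2^-1 = -1.
Proof.
by rewrite /e1 [_ * 2^-1]mulrC mulKf// cospi sinpi; apply/eqP; rewrite eq_complex /= oppr0 !eqxx.
Qed.

Lemma e1_nat (n : nat) : e1 n%:R = 1.
Proof. by elim: n => [|n IH]; [rewrite e1_0|rewrite -natr1 e1D IH e1_1 mulr1]. Qed.

Lemma e1_int (n : int) : e1 n%:~R = 1.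
Proof.
case: n => n; first exact: e1_nat.
by rewrite NegzE mulrNz -e1J -[_%:~R]/(n.+1%:R) e1_nat conjc1.
Qed.

(** With [r] the fractional part of [t], the real part gives cos (2 pi r) = 1, hence sin (pi r) = 0,
    whereas 0 < pi r < pi unless [r] is 0. *)
Lemma e1_eq1 t : e1 t = 1 -> exists n : int, t = n%:~R.
Proof.
move=> h; exists (Num.floor t).
have /andP[h1 h2] := floor_itv t; rewrite intrD in h2.
set r := t - (Num.floor t)%:~R.
have : e1 r = 1 by rewrite /r e1D h mul1r -mulrNz e1_int.
have [/eqP|r0] := eqVneq r 0; first by rewrite subr_eq0 => /eqP.
have rp : 0 < r by rewrite lt0r r0 subr_ge0.
have r1 : r < 1 by rewrite /r; lra.
rewrite /e1 => -[+ _]; rewrite -mulrA mulr_natl cos_mulr2n => E.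
have : 0 < sin (pi * r).
  by apply: sin_gt0_pi; rewrite mulr_gt0 ?pi_gt0//= -[ltRHS]mulr1 ltr_pM2l ?pi_gt0.
have := cos2Dsin2 (pi * r); set c := cos _ in E *; set s := sin _ => E2 sp.
have : s ^+ 2 = 0 by move: E; rewrite -mulr_natl; lra.
by move/eqP; rewrite sqrf_eq0 gt_eqF.
Qed.
End ComplexNumbers.

(** * Integration of complex functions on the torus *)

Section ComplexIntegral.
Variables (R : realType) (d : nat).
Local Notation tor := (torus_measure R d).
Local Notation V := 'cV[R]_d.
Implicit Types (f g : V -> R[i]).

Lemma mcfun_nc f : measurable_cfun f -> measurable_fun setT (fun x => nc (f x)).
Proof.
move=> [mr mi].
rewrite (_ : (fun x => _) = (fun x => (complex.Re (f x) ^+ 2 + complex.Im (f x) ^+ 2) `^ 2^-1));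
  last first.
  by apply/funext => x; rewrite ncE powR12_sqrt// addr_ge0 ?sqr_ge0.
apply: (@measurableT_comp _ _ _ _ _ _ (@powR R ^~ 2^-1)); first exact: measurable_powR.
by apply: measurable_funD; apply: measurable_funX.
Qed.

Lemma mcfunD f g : measurable_cfun f -> measurable_cfun g -> measurable_cfun (fun x => f x + g x).
Proof.
move=> [fr fi] [gr gi]; split.
  by under eq_fun do rewrite ReD; exact: measurable_funD.
by under eq_fun do rewrite ImD; exact: measurable_funD.
Qed.

Lemma mcfunM f g : measurable_cfun f -> measurable_cfun g -> measurable_cfun (fun x => f x * g x).
Proof.
move=> [fr fi] [gr gi]; split.
  by under eq_fun do rewrite ReM; apply: measurable_funB; exact: measurable_funM.
by under eq_fun do rewrite ImM; apply: measurable_funD; exact: measurable_funM.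
Qed.

Lemma mcfunN f : measurable_cfun f -> measurable_cfun (fun x => - f x).
Proof.
move=> [fr fi]; split.
  by under eq_fun do rewrite ReN; exact: measurable_funN fr.
by under eq_fun do rewrite ImN; exact: measurable_funN fi.
Qed.

Lemma mcfunB f g : measurable_cfun f -> measurable_cfun g -> measurable_cfun (fun x => f x - g x).
Proof. by move=> mf mg; apply: mcfunD => //; exact: mcfunN. Qed.

Lemma mcfunJ f : measurable_cfun f -> measurable_cfun (fun x => conjc (f x)).
Proof.
move=> [fr fi]; split.
  by under eq_fun do rewrite ReJ.
by under eq_fun do rewrite ImJ; exact: measurable_funN fi.
Qed.

Lemma mcfun_cst (c : R[i]) : measurable_cfun (fun _ : V => c).
Proof. by split; exact: measurable_cst. Qed.

Lemma mcfun_sum (I : Type) (s : seq I) (F : I -> V -> R[i]) :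
  (forall i, measurable_cfun (F i)) -> measurable_cfun (fun x => \sum_(i <- s) F i x).
Proof.
move=> mF; elim: s => [|i s IH].
  by under eq_fun do rewrite big_nil; exact: mcfun_cst.
by under eq_fun do rewrite big_cons; exact: mcfunD.
Qed.

Lemma mcfun_real (h : V -> R) : measurable_fun setT (h : V -> measurableTypeR R) ->
  measurable_cfun (fun x => real_complex R (h x)).
Proof. by move=> mh; split => //; exact: measurable_cst. Qed.

Lemma mcfun_comp f (s : V -> V) : measurable_cfun f -> measurable_fun setT s ->
  measurable_cfun (fun x => f (s x)).
Proof.
move=> [fr fi] ms; split.
  exact: (measurableT_comp (f := fun x => complex.Re (f x))).
exact: (measurableT_comp (f := fun x => complex.Im (f x))).
Qed.

Definition cintegrable f := measurable_cfun f /\ (\int[tor]_x (nc (f x))%:E < +oo)%E.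

Lemma cint_Re f : cintegrable f -> tor.-integrable setT (EFin \o (fun x => complex.Re (f x))).
Proof.
move=> [mf lf]; apply/integrableP; split; first by apply/measurable_EFinP; exact: mf.1.
apply: le_lt_trans lf; apply: ge0_le_integral => //.
- by apply: measurableT_comp => //; apply/measurable_EFinP; exact: mf.1.
- by apply/measurable_EFinP; exact: mcfun_nc.
- by move=> x _ /=; rewrite lee_fin; exact: Re_le_nc.
Qed.

Lemma cint_Im f : cintegrable f -> tor.-integrable setT (EFin \o (fun x => complex.Im (f x))).
Proof.
move=> [mf lf]; apply/integrableP; split; first by apply/measurable_EFinP; exact: mf.2.
apply: le_lt_trans lf; apply: ge0_le_integral => //.
- by apply: measurableT_comp => //; apply/measurable_EFinP; exact: mf.2.
- by apply/measurable_EFinP; exact: mcfun_nc.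
- by move=> x _ /=; rewrite lee_fin; exact: Im_le_nc.
Qed.

Lemma cintD f g : cintegrable f -> cintegrable g -> cintegrable (fun x => f x + g x).
Proof.
move=> [mf lf] [mg lg]; split; first exact: mcfunD.
apply: (@le_lt_trans _ _ (\int[tor]_x ((nc (f x))%:E + (nc (g x))%:E))%E).
  apply: ge0_le_integral => //.
  - by move=> x _; rewrite lee_fin nc_ge0.
  - by apply/measurable_EFinP; apply: mcfun_nc; exact: mcfunD.
  - by apply: emeasurable_funD; apply/measurable_EFinP; exact: mcfun_nc.
  - by move=> x _; rewrite -EFinD lee_fin; exact: ncD.
rewrite ge0_integralD//.
- by rewrite lte_add_pinfty.
- by move=> x _; rewrite lee_fin nc_ge0.
- by apply/measurable_EFinP; exact: mcfun_nc.
- by move=> x _; rewrite lee_fin nc_ge0.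
- by apply/measurable_EFinP; exact: mcfun_nc.
Qed.

Lemma cintZ (c : R[i]) f : cintegrable f -> cintegrable (fun x => c * f x).
Proof.
move=> [mf lf]; split; first by apply: mcfunM => //; exact: mcfun_cst.
under eq_integral do rewrite ncM EFinM.
rewrite ge0_integralZl//.
- by rewrite lte_mul_pinfty// lee_fin nc_ge0.
- by apply/measurable_EFinP; exact: mcfun_nc.
- by move=> x _; rewrite lee_fin nc_ge0.
- by rewrite lee_fin nc_ge0.
Qed.

Lemma cint_bounded f (b : R) : measurable_cfun f -> (forall x, nc (f x) <= b) -> cintegrable f.
Proof.
move=> mf fb; split=> //.
apply: (@le_lt_trans _ _ (\int[tor]_x (cst b%:E x))%E).
  apply: ge0_le_integral => //.
  - by move=> x _; rewrite lee_fin nc_ge0.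
  - by apply/measurable_EFinP; exact: mcfun_nc.
  - by move=> x _; rewrite lee_fin.
rewrite integral_cst//; have -> : tor setT = 1%E by exact: torus1.
by rewrite mule1 ltry.
Qed.

Lemma cint_cst (c : R[i]) : cintegrable (fun _ => c).
Proof. by apply: (@cint_bounded _ (nc c)) => //; exact: mcfun_cst. Qed.

Lemma cint_mul_bounded f g (b : R) : cintegrable f -> measurable_cfun g -> (forall x, nc (g x) <=
  b) ->
  cintegrable (fun x => f x * g x).
Proof.
move=> [mf lf] mg gb; split; first exact: mcfunM.
have b0 : 0 <= b by apply: le_trans (gb 0); exact: nc_ge0.
apply: (@le_lt_trans _ _ (\int[tor]_x (b%:E * (nc (f x))%:E))%E).
  apply: ge0_le_integral => //.
  - by move=> x _; rewrite lee_fin nc_ge0.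
  - by apply/measurable_EFinP; apply: mcfun_nc; exact: mcfunM.
  - by apply: emeasurable_funM => //; apply/measurable_EFinP; exact: mcfun_nc.
  - by move=> x _; rewrite -EFinM lee_fin ncM mulrC; apply: ler_wpM2r => //; exact: nc_ge0.
rewrite ge0_integralZl//.
- by rewrite lte_mul_pinfty// lee_fin.
- by apply/measurable_EFinP; exact: mcfun_nc.
- by move=> x _; rewrite lee_fin nc_ge0.
Qed.

Lemma integralCD f g : cintegrable f -> cintegrable g ->
  integralC (fun x => f x + g x) = integralC f + integralC g.
Proof.
move=> cf cg; rewrite /integralC; apply/eqP; rewrite eq_complex /=; apply/andP; split; apply/eqP.
  by under eq_Rintegral do rewrite ReD; rewrite RintegralD//; exact: cint_Re.
by under eq_Rintegral do rewrite ImD; rewrite RintegralD//; exact: cint_Im.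
Qed.

Lemma integralCZ (c : R[i]) f : cintegrable f ->
  integralC (fun x => c * f x) = c * integralC f.
Proof.
move=> cf; rewrite /integralC; apply/eqP; rewrite eq_complex ReM ImM /=; apply/andP; split;
  apply/eqP.
  under eq_Rintegral do rewrite ReM.
  rewrite RintegralB// ?RintegralZl//; try (exact: cint_Re); try (exact: cint_Im).
    exact: (integrableZl measurableT (complex.Re c) (cint_Re cf)).
  exact: (integrableZl measurableT (complex.Im c) (cint_Im cf)).
under eq_Rintegral do rewrite ImM.
rewrite RintegralD// ?RintegralZl//; try (exact: cint_Re); try (exact: cint_Im).
  exact: (integrableZl measurableT (complex.Re c) (cint_Im cf)).
exact: (integrableZl measurableT (complex.Im c) (cint_Re cf)).
Qed.

Lemma integralC0 : integralC (fun _ : V => 0 : R[i]) = 0.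
Proof.
rewrite -[RHS](mul0r (integralC (fun _ : V => 0 : R[i]))) -integralCZ; last exact: cint_cst.
by congr integralC; apply/funext => x; rewrite mul0r.
Qed.

Lemma cint_sum (I : Type) (s : seq I) (F : I -> V -> R[i]) :
  (forall i, cintegrable (F i)) -> cintegrable (fun x => \sum_(i <- s) F i x).
Proof.
move=> mF; elim: s => [|i s IH].
  by under eq_fun do rewrite big_nil; exact: cint_cst.
by under eq_fun do rewrite big_cons; exact: cintD.
Qed.

Lemma integralC_sum (I : Type) (s : seq I) (F : I -> V -> R[i]) : (forall i, cintegrable (F i)) ->
  integralC (fun x => \sum_(i <- s) F i x) = \sum_(i <- s) integralC (F i).
Proof.
move=> mF; elim: s => [|i s IH].
  by under eq_fun do rewrite big_nil; rewrite big_nil integralC0.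
under eq_fun do rewrite big_cons.
by rewrite integralCD// ?IH ?big_cons//; exact: cint_sum.
Qed.

Lemma integralC_cst (c : R[i]) : integralC (fun _ : V => c) = c.
Proof.
have T1 : tor setT = 1%E by exact: torus1.
rewrite /integralC !Rintegral_cst//.
by rewrite T1 /= !mulr1; case: c.
Qed.

Lemma Re_integralC_le f : cintegrable f -> (`|complex.Re (integralC f)|%:E <=
  \int[tor]_x (nc (f x))%:E)%E.
Proof.
move=> cf; rewrite /integralC /=.
have E := EFin_normr_Rintegral measurableT (cint_Re cf).
rewrite E; apply: le_trans (le_abse_integral _ _ _) _ => //.
  by apply: measurable_int; exact: cint_Re.
apply: ge0_le_integral => //.
- by apply: measurableT_comp => //; apply/measurable_EFinP; exact: cf.1.1.
- by apply/measurable_EFinP; exact: mcfun_nc cf.1.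
- by move=> x _ /=; rewrite lee_fin; exact: Re_le_nc.
Qed.

(** Multiplying [f] by the constant [c] of modulus 1 makes its integral real and equal to [nc z], so
    the estimate of the real part suffices. *)
Lemma nc_integralC f : cintegrable f -> ((nc (integralC f))%:E <= \int[tor]_x (nc (f x))%:E)%E.
Proof.
move=> cf; set z := integralC f.
have [z0|z0] := eqVneq (nc z) 0; first by rewrite z0; apply: integral_ge0 => x _;
  rewrite lee_fin nc_ge0.
have zp : 0 < nc z by rewrite lt0r z0 nc_ge0.
pose c := conjc z * real_complex _ (nc z)^-1.
have c1 : nc c = 1 by rewrite ncM ncJ nc_real gtr0_norm ?invr_gt0// divff.
have cz : c * z = real_complex _ (nc z).
  rewrite /c mulrAC (mulrC _ z) mulJ -rmorphM /= expr2 -mulrA divff// mulr1//.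
have := Re_integralC_le (cintZ c cf); rewrite integralCZ// -/z cz /=.
rewrite ger0_norm ?nc_ge0//.
by under eq_integral do rewrite ncM c1 mul1r.
Qed.

Lemma integralC_shift (c : V) f : measurable_cfun f -> Defs.periodic f ->
  integralC (fun x => f (x + c)) = integralC f.
Proof.
move=> [mr mi] pf; rewrite /integralC /Rintegral; congr Complex; congr fine.
  apply: (@integral_torus_shift _ _ c (fun x => (complex.Re (f x))%:E));
    first exact/measurable_EFinP.
  by move=> k x; rewrite pf.
apply: (@integral_torus_shift _ _ c (fun x => (complex.Im (f x))%:E)); first exact/measurable_EFinP.
by move=> k x; rewrite pf.
Qed.
End ComplexIntegral.

(** * Characters, Fourier coefficients and trigonometric polynomials *)

Section Fourier.
Variables (R : realType) (d : nat).
Local Notation V := 'cV[R]_d.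
Local Notation Z := 'cV[int]_d.
Implicit Types (f g T : V -> R[i]) (k l : Z) (x y : V).

Definition dot k x : R := \sum_i (k i 0)%:~R * x i 0.

Lemma characterE k x : character k x = e1 (dot k x).
Proof. by []. Qed.

Lemma dotDl k l x : dot (k + l) x = dot k x + dot l x.
Proof. by rewrite /dot -big_split; apply: eq_bigr => i _; rewrite mxE intrD mulrDl. Qed.

Lemma dotNl k x : dot (- k) x = - dot k x.
Proof. by rewrite /dot -sumrN; apply: eq_bigr => i _; rewrite mxE mulrNz mulNr. Qed.

Lemma dotDr k x y : dot k (x + y) = dot k x + dot k y.
Proof. by rewrite /dot -big_split; apply: eq_bigr => i _; rewrite mxE mulrDr. Qed.

Lemma dotNr k x : dot k (- x) = - dot k x.
Proof. by rewrite /dot -sumrN; apply: eq_bigr => i _; rewrite mxE mulrN. Qed.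

Lemma dot_int k l : dot k (ivec R l) = (\sum_i k i 0 * l i 0)%:~R.
Proof. by rewrite /dot rmorph_sum /=; apply: eq_bigr => i _; rewrite mxE rmorphM. Qed.

Lemma ch0 x : character (0 : Z) x = 1.
Proof. by rewrite characterE (_ : dot _ _ = 0) ?e1_0// /dot big1// => i _; rewrite mxE mul0r. Qed.

Lemma chDl k l x : character (k + l) x = character k x * character l x.
Proof. by rewrite !characterE dotDl e1D. Qed.

Lemma chDr k x y : character k (x + y) = character k x * character k y.
Proof. by rewrite !characterE dotDr e1D. Qed.

Lemma chNl k x : character (- k) x = conjc (character k x).
Proof. by rewrite !characterE dotNl e1J. Qed.

Lemma chNr k x : character k (- x) = conjc (character k x).
Proof. by rewrite !characterE dotNr e1J. Qed.

Lemma ch_int k l : character k (ivec R l) = 1.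
Proof. by rewrite characterE dot_int e1_int. Qed.

Lemma nc_ch k x : nc (character k x) = 1.
Proof. exact: nc_e1. Qed.

Lemma ch_per k : Defs.periodic (@character R d k).
Proof. by move=> l x; rewrite chDr ch_int mulr1. Qed.

Lemma measurable_dot k : measurable_fun setT (dot k : V -> measurableTypeR R).
Proof.
rewrite (_ : dot k = (fun x => \sum_(i <- index_enum 'I_d) (k i 0)%:~R * x i 0))//.
elim: (index_enum _) => [|i s IH].
  by under eq_fun do rewrite big_nil; exact: measurable_cst.
under eq_fun do rewrite big_cons.
apply: measurable_funD => //; apply: measurable_funM => //; exact: measurable_coord.
Qed.

Lemma mcfun_ch k : measurable_cfun (@character R d k).
Proof.
have mt : measurable_fun setT ((fun x => 2 * pi * dot k x) : V -> measurableTypeR R).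
  by apply: measurable_funM => //; exact: measurable_dot.
split.
  apply: (@measurableT_comp _ _ _ _ _ _ (@cos R)) => //.
  by apply: continuous_measurable_fun; exact: continuous_cos.
apply: (@measurableT_comp _ _ _ _ _ _ (@sin R)) => //.
by apply: continuous_measurable_fun; exact: continuous_sin.
Qed.

Lemma cint_ch k : cintegrable (@character R d k).
Proof. by apply: (@cint_bounded _ _ _ 1); [exact: mcfun_ch|move=> x; rewrite nc_ch]. Qed.

Lemma integralC_ch k : integralC (@character R d k) = (k == 0)%:R.
Proof.
have [->|k0] := eqVneq k 0.
  rewrite -[RHS](@integralC_cst R d 1); congr integralC; apply/funext => x; exact: ch0.
have [i ki] : exists i, k i 0 != 0.
  apply/existsP; rewrite -negb_forall; apply: contra k0 => /forallP H.
  by apply/eqP/matrixP => i j; rewrite ord1 mxE; exact/eqP.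
(* Translation by [c] multiplies the character by [e1 2^-1 = -1] and leaves the integral unchanged,
   so the integral equals its own opposite. *)
pose c : V := \col_j (if j == i then (2 * (k i 0)%:~R)^-1 else 0).
have kc : dot k c = 2^-1.
  rewrite /dot (bigD1 i)//= big1 ?addr0; last first.
    by move=> j /negbTE ji; rewrite mxE ji mulr0.
  rewrite mxE eqxx invfM mulrCA divff ?mulr1// intr_eq0 //.
have := integralC_shift c (mcfun_ch k) (@ch_per k).
under eq_fun => x do rewrite chDr (characterE k c) kc e1_half mulrC.
rewrite integralCZ; last exact: cint_ch.
set I := integralC _; rewrite mulN1r => E.
have : I *+ 2 = 0 by rewrite mulr2n -{1}E addNr.
by move/eqP; rewrite mulrn_eq0 /= => /eqP.
Qed.

Definition TP (s : seq Z) (c : Z -> R[i]) : V -> R[i] := fun x => \sum_(k <- s) c k * character k x.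

Lemma trigpoly_TP s c : trigpoly (TP s c).
Proof. by exists s, c. Qed.

Lemma mcfun_TP s c : measurable_cfun (TP s c).
Proof. by apply: mcfun_sum => k; apply: mcfunM; [exact: mcfun_cst|exact: mcfun_ch]. Qed.

Lemma TP_per s c : Defs.periodic (TP s c).
Proof. by move=> l x; apply: eq_bigr => k _; rewrite ch_per. Qed.

Lemma nc_TP s c x : nc (TP s c x) <= \sum_(k <- s) nc (c k).
Proof.
apply: (le_trans (nc_sum _ _ _)); apply: ler_sum => k _; by rewrite ncM nc_ch mulr1.
Qed.

Lemma cint_TP s c : cintegrable (TP s c).
Proof. by apply: (@cint_bounded _ _ _ (\sum_(k <- s) nc (c k)));
  [exact: mcfun_TP|exact: nc_TP]. Qed.

Lemma cint_mulch f k : cintegrable f -> cintegrable (fun x => f x * conjc (character k x)).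
Proof.
move=> cf; apply: (@cint_mul_bounded _ _ _ _ 1) => //; first by apply: mcfunJ; exact: mcfun_ch.
by move=> x; rewrite ncJ nc_ch.
Qed.

Lemma fourierD f g k : cintegrable f -> cintegrable g -> fourier (fun x => f x + g x) k =
  fourier f k + fourier g k.
Proof.
move=> cf cg; rewrite /fourier -integralCD; try exact: cint_mulch.
by congr integralC; apply/funext => x; rewrite mulrDl.
Qed.

Lemma fourierZ (a : R[i]) f k : cintegrable f -> fourier (fun x => a * f x) k = a * fourier f k.
Proof.
move=> cf; rewrite /fourier -integralCZ; last exact: cint_mulch.
by congr integralC; apply/funext => x; rewrite mulrA.
Qed.

Lemma fourierB f g k : cintegrable f -> cintegrable g -> fourier (fun x => f x - g x) k =
  fourier f k - fourier g k.
Proof.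
move=> cf cg; rewrite -mulN1r -fourierZ// -fourierD//; last exact: cintZ.
by congr fourier; apply/funext => x; rewrite mulN1r.
Qed.

Lemma fourier_ch k l : fourier (@character R d k) l = (k == l)%:R.
Proof.
rewrite /fourier -subr_eq0 -integralC_ch; congr integralC; apply/funext => x.
by rewrite chDl chNl.
Qed.

Lemma fourier_TP s c k : uniq s -> fourier (TP s c) k = if k \in s then c k else 0.
Proof.
move=> us; rewrite /fourier (_ : (fun x => _) = (fun x => \sum_(l <- s) (c l * (character l x *
  conjc (character k x))))); last first.
  by apply/funext => x; rewrite /TP mulr_suml; apply: eq_bigr => l _; rewrite mulrA.
rewrite integralC_sum; last by move=> l; apply: cintZ; apply: cint_mulch; exact: cint_ch.
under eq_bigr => l _.
  rewrite integralCZ; last by apply: cint_mulch; exact: cint_ch.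
  rewrite -/(fourier (@character R d l) k) fourier_ch.
  over.
case: ifPn => ks.
  rewrite (bigD1_seq k)//= eqxx mulr1 big1 ?addr0// => l /negbTE ->; by rewrite mulr0.
rewrite big_seq big1// => l ls; case: eqP => [lk|]; last by rewrite mulr0.
by rewrite -lk ls in ks.
Qed.

(** A list of frequencies may contain repetitions. Merging them multiplies each coefficient by its
    multiplicity, and over a list without duplicates orthogonality forces the coefficients to be the
    Fourier coefficients. *)
Lemma trigpolyP T : trigpoly T -> exists s, [/\ uniq s, forall k, fourier T k != 0 ->
  k \in s & T = TP s (fourier T)].
Proof.
move=> [s [c ->]].
have E : (fun x => \sum_(k <- s) c k * character k x) = TP (undup s) (fun k => c k *+ count_mem k
  s).
  apply/funext => x; rewrite -big_undup_iterop_count /TP; apply: eq_bigr => k _.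
  by rewrite Monoid.iteropE /= iter_addr_0 mulrnAl.
rewrite E; exists (undup s); split; first exact: undup_uniq.
- by move=> k; rewrite fourier_TP ?undup_uniq//; case: ifP => //; rewrite eqxx.
- apply/funext => x; apply: eq_big_seq => k ks; by rewrite fourier_TP ?undup_uniq// ks.
Qed.

(** Allows several polynomials to be expanded over one common list: frequencies outside the spectrum
    contribute 0. *)
Lemma TP_widen T s : trigpoly T -> uniq s -> (forall k, fourier T k != 0 -> k \in s) ->
  T = TP s (fourier T).
Proof.
move=> /trigpolyP[t [ut ht E]] us hs; rewrite {1}E; apply/funext => x; rewrite /TP.
rewrite (bigID (fun k => fourier T k == 0))/= big1 ?add0r; last by move=> k /eqP ->; rewrite mul0r.
rewrite [RHS](bigID (fun k => fourier T k == 0))/= [X in _ = X + _]big1 ?add0r;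
  last by move=> k /eqP ->; rewrite mul0r.
rewrite -big_filter -[RHS]big_filter; apply: perm_big; apply: uniq_perm;
  rewrite ?filter_uniq// => k.
by rewrite !mem_filter; case: eqP => //= /eqP k0; rewrite ht// hs.
Qed.

Lemma fsum_support (W : nmodType) (F : Z -> W) s : uniq s -> (forall k, F k != 0 -> k \in s) ->
  \sum_(k \in [set: Z]) F k = \sum_(k <- s) F k.
Proof.
move=> us hs; rewrite -(fsbig_widen [set` s] setT)//=; first by rewrite -fsbig_seq.
move=> k [_ /= ks]; apply/eqP; apply: contra_notT ks => k0; exact: hs.
Qed.

End Fourier.

(** * Conjugate exponents, Hoelder's and Jensen's inequalities *)

Section Exponents.
Variable R : realType.
Local Open Scope ereal_scope.

Lemma conj_exponent_cases (p q : \bar R) : 1 <= p -> 1 <= q -> p^-1 + q^-1 = 1 ->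
  [\/ p = 1 /\ q = +oo, p = +oo /\ q = 1 |
      exists r s : R, [/\ p = r%:E, q = s%:E, (1 < r)%R, (1 < s)%R & (r^-1 + s^-1 = 1)%R]].
Proof.
move: p q => [r| |] [s| |] //; rewrite ?lee_fin => p1 q1.
- have r0 : r != 0%R by rewrite gt_eqF// (lt_le_trans ltr01).
  have s0 : s != 0%R by rewrite gt_eqF// (lt_le_trans ltr01).
  rewrite !inver (negbTE r0) (negbTE s0) -EFinD => -[E]; apply: Or33; exists r, s; split=> //.
    rewrite lt_neqAle p1 andbT; apply/eqP => r1; move: E; rewrite -r1 invr1 => /eqP.
    by rewrite -subr_eq0 addrAC subrr add0r invr_eq0 (negbTE s0).
  rewrite lt_neqAle q1 andbT; apply/eqP => r1; move: E; rewrite -r1 invr1 => /eqP.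
  by rewrite -subr_eq0 addrK invr_eq0 (negbTE r0).
- have r0 : r != 0%R by rewrite gt_eqF// (lt_le_trans ltr01).
  rewrite invey adde0 inver (negbTE r0) => -[E]; apply: Or31; split=> //.
  by rewrite -(invrK r) E invr1.
- have s0 : s != 0%R by rewrite gt_eqF// (lt_le_trans ltr01).
  rewrite invey add0e inver (negbTE s0) => -[E]; apply: Or32; split=> //.
  by rewrite -(invrK s) E invr1.
- by rewrite invey adde0 => /eqP; rewrite eqe eq_sym oner_eq0.
Qed.

Lemma le_poweR (x y : \bar R) (r : R) : (0 <= r)%R -> 0 <= x -> x <= y -> x `^ r <= y `^ r.
Proof.
move=> r0 x0 xy; apply: gt0_ler_poweR => //; rewrite in_itv /= leey andbT//.
exact: le_trans xy.
Qed.
End Exponents.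

Section Lnorms.
Context d (T : measurableType d) (R : realType).
Variable mu : {measure set T -> \bar R}.
Hypothesis mu0 : (0 < mu setT)%E.
Local Open Scope ereal_scope.
Implicit Types f g w b : T -> R.
Local Notation "'N_ p [ f ]" := (Lnorm mu p (EFin \o f)).

Let measurable_abspow f (r : R) : measurable_fun setT f -> measurable_fun setT (fun x => `|
  (f x)%:E| `^ r).
Proof.
move=> mf; apply: (@measurableT_comp _ _ _ _ _ _ (fun x => x `^ r)); first exact: measurable_poweR.
by apply: measurableT_comp => //; exact/measurable_EFinP.
Qed.

Lemma le_Lnorm p f g : measurable_fun setT f -> measurable_fun setT g -> 1 <= p ->
  (forall x, `|f x| <= `|g x|)%R -> 'N_p[f] <= 'N_p[g].
Proof.
move=> mf mg p1 fg; rewrite unlock /Lnorm; case: p p1 => [r r1| |//].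
  have r0 : (0 < r)%R by rewrite (lt_le_trans ltr01)// -lee_fin.
  apply: le_poweR.
  - by rewrite invr_ge0 ltW.
  - by apply: integral_ge0 => x _; exact: poweR_ge0.
  apply: ge0_le_integral => //.
  - by move=> x _; exact: poweR_ge0.
  - exact: measurable_abspow.
  - exact: measurable_abspow.
  - by move=> x _; apply: le_poweR; [exact: ltW|exact: abse_ge0|rewrite lee_fin; exact: fg].
move=> _; rewrite mu0; apply: le_ess_sup; apply/nearW => x /=; rewrite lee_fin; exact: fg.
Qed.

Lemma Lnorm_bounded p f (c : R) : measurable_fun setT f -> 1 <= p -> mu setT = 1 ->
  (forall x, `|f x| <= c)%R -> 'N_p[f] <= c%:E.
Proof.
move=> mf p1 m1 fc.
have [x0|nx] := pselect (exists x : T, True); last first.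
  by move: mu0; rewrite (_ : setT = set0) ?measure0 ?ltxx//; apply/seteqP; split => // x _;
    apply: nx; exists x.
have c0 : (0 <= c)%R by case: x0 => x _; exact: le_trans (fc x).
apply: (@le_trans _ _ 'N_p[cst c]).
  by apply: le_Lnorm => //= x; rewrite (ger0_norm c0).
rewrite unlock /Lnorm; case: p p1 => [r r1| |//].
  have r0 : (0 < r)%R by rewrite (lt_le_trans ltr01)// -lee_fin.
  under eq_integral do rewrite /= ger0_norm//.
  rewrite integral_cst// m1 mule1 poweR_EFin -powRrM divff ?gt_eqF// powRr1// lexx.
move=> _; rewrite mu0 (_ : abse \o _ = cst c%:E) ?ess_sup_cst//.
by apply/funext => x /=; rewrite ger0_norm.
Qed.

Lemma hoelder1y f g : measurable_fun setT f -> measurable_fun setT g ->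
  'N_1[(f \* g)%R] <= 'N_1[f] * 'N_+oo[g].
Proof.
move=> mf mg; rewrite !Lnorm1 unlock /Lnorm mu0.
rewrite -ge0_integralZr//; first last.
- by rewrite -(ess_sup_cst 0 mu0); apply: le_ess_sup; apply/nearW => x /=.
- by apply: measurableT_comp => //; exact/measurable_EFinP.
apply: ae_ge0_le_integral => //.
- by apply: measurableT_comp => //; apply/measurable_EFinP; exact: measurable_funM.
- by move=> x _; rewrite mule_ge0// -(ess_sup_cst 0 mu0); apply: le_ess_sup; apply/nearW => y /=.
- apply: emeasurable_funM => //; apply: measurableT_comp => //; exact/measurable_EFinP.
- apply: filterS (ess_sup_ge mu (abse \o (EFin \o g))) => x hx _.
  by rewrite /= normrM EFinM; apply: lee_wpmul2l => //; rewrite lee_fin.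
Qed.

Lemma ehoelder p q f g : measurable_fun setT f -> measurable_fun setT g ->
  1 <= p -> 1 <= q -> p^-1 + q^-1 = 1 -> 'N_1[(f \* g)%R] <= 'N_p[f] * 'N_q[g].
Proof.
move=> mf mg p1 q1 pq; have [[-> ->]|[-> ->]|[r [s [-> ->
  r1 s1 rs]]]] := conj_exponent_cases p1 q1 pq.
- exact: hoelder1y.
- rewrite muleC (_ : (f \* g)%R = (g \* f)%R); first exact: hoelder1y.
  by apply/funext => x /=; rewrite mulrC.
- by apply: hoelder => //; apply: lt_trans ltr01 _.
Qed.

(** Hoelder with the exponents [s] and [r] for the factorisation [w b = w^(1/s) (w^(1/r) b)], raised
    to the power [r]. The weight is not normalised; its mass appears with the exponent [r - 1]. *)
Lemma jensen_weighted w b (r : R) : measurable_fun setT w -> measurable_fun setT b ->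
  (forall x, 0 <= w x)%R -> (forall x, 0 <= b x)%R -> (1 <= r)%R ->
  (\int[mu]_x (w x * b x)%:E) `^ r <= (\int[mu]_x (w x)%:E) `^ (r - 1) * \int[mu]_x (w x * b x `^
    r)%:E.
Proof.
move=> mw mb w0 b0; rewrite le_eqVlt => /predU1P[<-|r1].
  rewrite subrr poweRe0 mul1e poweRe1; last by apply: integral_ge0 => x _; rewrite lee_fin mulr_ge0.
  by under [in leRHS]eq_integral do rewrite powRr1//.
have r0 : (0 < r)%R by apply: lt_trans r1.
pose s := (r / (r - 1))%R.
have r10 : (0 < r - 1)%R by rewrite subr_gt0.
have s0 : (0 < s)%R by rewrite divr_gt0.
have sr : (s^-1 + r^-1 = 1)%R by rewrite /s invf_div; field; rewrite gt_eqF.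
have mpow (u : T -> R) a : measurable_fun setT u -> measurable_fun setT (fun x => u x `^ a)%R.
  by move=> mu_; apply: (@measurableT_comp _ _ _ _ _ _ (@powR R ^~ a)) => //;
    exact: measurable_powR.
have := hoelder mu (mpow w s^-1%R mw) (measurable_funM (mpow w r^-1%R mw) mb) s0 r0 sr.
set A := \int[mu]_x (w x)%:E; set B := \int[mu]_x (w x * b x `^ r)%:E.
rewrite Lnorm1.
have -> : \int[mu]_x `|(EFin \o ((fun x => w x `^ s^-1) \* ((fun x => w x `^ r^-1) \* b))%R) x| =
  \int[mu]_x (w x * b x)%:E.
  apply: eq_integral => x _ /=; rewrite mulrA -powRD; last by rewrite sr oner_eq0.
  by rewrite sr powRr1// ger0_norm// mulr_ge0.
have -> : 'N_s%:E[(fun x => w x `^ s^-1)%R] = A `^ s^-1.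
  rewrite unlock /Lnorm; congr (_ `^ _); apply: eq_integral => x _ /=.
  by rewrite ger0_norm ?powR_ge0// -powRrM mulVf ?gt_eqF// powRr1.
have -> : 'N_r%:E[((fun x => w x `^ r^-1) \* b)%R] = B `^ r^-1.
  rewrite unlock /Lnorm; congr (_ `^ _); apply: eq_integral => x _ /=.
  rewrite ger0_norm ?mulr_ge0 ?powR_ge0// powRM ?powR_ge0//.
  by rewrite -powRrM mulVf ?gt_eqF// powRr1.
move=> H.
have B0 : 0 <= B by apply: integral_ge0 => x _; rewrite lee_fin mulr_ge0 ?powR_ge0.
have L0 : 0 <= \int[mu]_x (w x * b x)%:E by apply: integral_ge0 => x _; rewrite lee_fin mulr_ge0.
apply: (le_trans (le_poweR (ltW r0) L0 H)).
rewrite poweRM ?poweR_ge0// -!poweRrM mulVf ?gt_eqF// poweRe1//.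
by rewrite (_ : s^-1 * r = r - 1)%R// /s invf_div; field; rewrite gt_eqF.
Qed.
End Lnorms.

(** * Norms on the torus and their duality *)

Section Pnorm.
Variables (R : realType) (d : nat).
Local Notation tor := (torus_measure R d).
Local Notation V := 'cV[R]_d.
Implicit Types (f g F h : V -> R[i]) (p q : \bar R).

Lemma torT : tor setT = 1%E. Proof. exact: torus1. Qed.

Lemma tor_gt0 : (0 < tor setT)%E. Proof. by rewrite torT. Qed.

Local Open Scope ereal_scope.

Lemma pnorm_ge0 p f : 0 <= pnorm p f.
Proof. exact: Lnorm_ge0. Qed.

Lemma eq_pnorm p f g : (forall x, nc (f x) = nc (g x)) -> pnorm p f = pnorm p g.
Proof. by move=> fg; rewrite /pnorm; congr Lnorm; apply/funext => x; rewrite fg. Qed.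

Lemma pnorm_bounded p f (c : R) : measurable_cfun f -> 1 <= p ->
  (forall x, nc (f x) <= c)%R -> pnorm p f <= c%:E.
Proof.
move=> mf p1 fc; apply: (Lnorm_bounded tor_gt0) => //; [exact: mcfun_nc|exact: torT|].
by move=> x; rewrite ger0_norm ?nc_ge0.
Qed.

Lemma pnormD p f g : measurable_cfun f -> measurable_cfun g -> 1 <= p ->
  pnorm p (fun x => f x + g x)%R <= pnorm p f + pnorm p g.
Proof.
move=> mf mg p1.
apply: (@le_trans _ _ (Lnorm tor p (EFin \o ((fun x => nc (f x)) \+ (fun x => nc (g x)))%R))).
  apply: (le_Lnorm tor_gt0) => //; [by apply: mcfun_nc; exact: mcfunD|by apply: measurable_funD;
    exact: mcfun_nc|].
  by move=> x /=; rewrite !ger0_norm ?addr_ge0 ?nc_ge0//; exact: ncD.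
by apply: eminkowski => //; exact: mcfun_nc.
Qed.

Lemma pnormN p f : pnorm p (fun x => - f x)%R = pnorm p f.
Proof. by apply: eq_pnorm => x; exact: ncN. Qed.

Lemma pnormB p f g : measurable_cfun f -> measurable_cfun g -> 1 <= p ->
  pnorm p (fun x => f x - g x)%R <= pnorm p f + pnorm p g.
Proof. by move=> mf mg p1; rewrite -(pnormN p g); apply: pnormD => //; exact: mcfunN. Qed.

Lemma pnorm1E f : pnorm 1 f = \int[tor]_x (nc (f x))%:E.
Proof.
rewrite /pnorm Lnorm1; apply: eq_integral => x _ /=; by rewrite ger0_norm// nc_ge0.
Qed.

Lemma pnorm_rE (r : R) f : pnorm r%:E f = (\int[tor]_x (nc (f x) `^ r)%:E) `^ r^-1.
Proof.
rewrite /pnorm unlock /Lnorm; apply: (congr1 (fun z => z `^ r^-1)); apply: eq_integral => x _ /=;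
  by rewrite ger0_norm// nc_ge0.
Qed.

Lemma pnorm_yE f : pnorm +oo f = ess_sup tor (fun x => (nc (f x))%:E).
Proof.
rewrite /pnorm unlock /Lnorm tor_gt0; congr ess_sup; apply/funext => x /=;
  by rewrite ger0_norm// nc_ge0.
Qed.

Lemma hoelder_torus p q f g : measurable_cfun f -> measurable_cfun g ->
  1 <= p -> 1 <= q -> p^-1 + q^-1 = 1 ->
  \int[tor]_x (nc (f x) * nc (g x))%:E <= pnorm p f * pnorm q g.
Proof.
move=> mf mg p1 q1 pq.
have := ehoelder tor_gt0 (mcfun_nc mf) (mcfun_nc mg) p1 q1 pq.
rewrite Lnorm1 => H; apply: le_trans H; rewrite le_eqVlt; apply/orP; left; apply/eqP.
by apply: eq_integral => x _ /=; rewrite ger0_norm// mulr_ge0 ?nc_ge0.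
Qed.

Lemma conj_exponent_exists p : 1 <= p -> exists q, 1 <= q /\ p^-1 + q^-1 = 1.
Proof.
case: p => [r| |//]; last by exists 1; rewrite invey inver oner_eq0 invr1 add0e.
rewrite lee_fin le_eqVlt => /predU1P[<-|r1].
  by exists +oo; rewrite invey inver oner_eq0 invr1 adde0 leey.
have r0 : (0 < r)%R by apply: lt_trans r1.
have r10 : (0 < r - 1)%R by rewrite subr_gt0.
exists (r / (r - 1))%:E; split; first by rewrite lee_fin ler_pdivlMr// mul1r; lra.
rewrite !inver !gt_eqF ?divr_gt0// -EFinD invf_div; congr EFin; field.
by rewrite gt_eqF.
Qed.

Lemma pnorm1_le p f : measurable_cfun f -> 1 <= p -> pnorm 1 f <= pnorm p f.
Proof.
move=> mf p1; have [q [q1 pq]] := conj_exponent_exists p1.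
rewrite pnorm1E.
have := hoelder_torus mf (mcfun_cst d (1%R : R[i])) p1 q1 pq.
under eq_integral do rewrite nc1 mulr1.
move/le_trans; apply; rewrite -[leRHS]mule1; apply: lee_wpmul2l; first exact: pnorm_ge0.
by apply: pnorm_bounded => [|//|x]; [exact: mcfun_cst|rewrite nc1].
Qed.

Lemma Lp_cint p f : 1 <= p -> Lp p f -> cintegrable f.
Proof.
move=> p1 [_ mf lf]; split => //; rewrite -pnorm1E; exact: le_lt_trans (pnorm1_le mf p1) lf.
Qed.

Lemma fourier_le p f k : 1 <= p -> cintegrable f -> (nc (fourier f k))%:E <= pnorm p f.
Proof.
move=> p1 cf; apply: le_trans (pnorm1_le cf.1 p1).
rewrite pnorm1E; apply: le_trans (nc_integralC (cint_mulch k cf)) _.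
by under eq_integral do rewrite ncM ncJ nc_ch mulr1.
Qed.

Lemma measurable_nc_pow (r : R) f : measurable_cfun f ->
  measurable_fun setT (fun x => nc (f x) `^ r)%R.
Proof.
move=> mf; apply: (@measurableT_comp _ _ _ _ _ _ (@powR R ^~ r)); first exact: measurable_powR.
exact: mcfun_nc.
Qed.

Lemma pnorm_opp p f : measurable_cfun f -> Defs.periodic f -> 1 <= p ->
  pnorm p (fun x => f (- x)%R) = pnorm p f.
Proof.
move=> mf pf; case: p => [r r1| |//].
  rewrite !pnorm_rE; apply: (congr1 (fun z => z `^ r^-1)).
  apply: (@integral_torus_opp _ _ (fun x => (nc (f x) `^ r)%:E)).
    by apply/measurable_EFinP; exact: measurable_nc_pow.
  by move=> k x; rewrite pf.
move=> _; rewrite !pnorm_yE.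
have mn : measurable_fun setT (fun x => (nc (f x))%:E) by apply/measurable_EFinP; exact: mcfun_nc.
have mo : measurable_fun setT (fun x : V => (nc (f (- x)%R))%:E).
  by apply/measurable_EFinP; apply: mcfun_nc; apply: mcfun_comp => //; exact: measurable_cvec_opp.
rewrite !ess_supEmu0//.
(* For the infinite exponent, the essential supremum depends only on the measures of the superlevel
   sets, which the reflection preserves. *)
have E y : tor ((fun x : V => (nc (f (- x)%R))%:E) @^-1` `]y, +oo[) =
  tor ((fun x => (nc (f x))%:E) @^-1` `]y, +oo[).
  set A := ((fun x => (nc (f x))%:E) @^-1` `]y, +oo[).
  have mA : measurable A by rewrite -[X in measurable X]setTI; apply: mn => //;
    exact: emeasurable_itv.
  have mB : measurable ((fun x : V => (nc (f (- x)%R))%:E) @^-1` `]y, +oo[).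
    by rewrite -[X in measurable X]setTI; apply: mo => //; exact: emeasurable_itv.
  have H := @integral_torus_opp _ _ (fun x => (\1_A x)%:E).
  transitivity (\int[tor]_x (\1_A (- x)%R)%:E).
    by rewrite -[LHS]/(tor _) -[X in tor X]setIT -integral_indic.
  rewrite H; first by rewrite integral_indic// setIT.
  - by apply/measurable_EFinP; exact: measurable_indic.
  - by move=> k x; rewrite !indicE (_ : (x + ivec R k \in A) = (x \in A))%R//; apply/idP/idP;
      rewrite !inE /A /= pf.
by congr ereal_inf; apply/seteqP; split => y /=; rewrite E.
Qed.

Lemma integralC_real (v : V -> R) :
  integralC (fun x => real_complex R (v x)) = real_complex R (fine (\int[tor]_x (v x)%:E)).
Proof. by rewrite /integralC /= /Rintegral integral0. Qed.

(** Conjugate sign of [z]; since [0^-1 = 0] it vanishes at 0, and [mul_usgn] holds there too. *)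
Definition usgn (z : R[i]) : R[i] := (conjc z * real_complex R (nc z)^-1)%R.

Lemma nc_usgn (z : R[i]) : (nc (usgn z) <= 1)%R.
Proof.
rewrite ncM ncJ nc_real; have [->|z0] := eqVneq (nc z) 0%R; first by rewrite mul0r.
by rewrite ger0_norm ?invr_ge0 ?nc_ge0// divff.
Qed.

Lemma mul_usgn (z : R[i]) : (z * usgn z = real_complex R (nc z))%R.
Proof.
rewrite /usgn mulrA mulJ -rmorphM /=; congr (real_complex R _).
have [->|z0] := eqVneq (nc z) 0%R; first by rewrite expr0n/= mul0r.
by rewrite expr2 -mulrA divff// mulr1.
Qed.

Lemma mcfun_usgn F : measurable_cfun F -> measurable_cfun (fun x => usgn (F x)).
Proof.
move=> mF; apply: mcfunM; first exact: mcfunJ.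
apply: mcfun_real.
under eq_fun do rewrite -powR_inv1 ?nc_ge0//.
exact: measurable_nc_pow.
Qed.

(** Converse of Hoelder by an explicit test function [usgn F * v] with [v >= 0]: the constant 1 for
    [p = 1], a normalised indicator of a superlevel set for [p = +oo], a normalised power
    [|F|^(r-1)] otherwise. The bound [b] makes the integrals finite, so that [integralC], which
    passes through [fine], has its true value. *)
Lemma duality p q F (b B : R) : 1 <= p -> 1 <= q -> p^-1 + q^-1 = 1 ->
  measurable_cfun F -> Defs.periodic F -> (forall x, nc (F x) <= b)%R ->
  (forall h, measurable_cfun h -> Defs.periodic h -> pnorm q h <= 1 ->
     (nc (integralC (fun x => F x * h x)) <= B)%R) ->
  pnorm p F <= B%:E.
Proof.
move=> p1 q1 pq mF pF Fb H.
have mn := mcfun_nc mF.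
have key (v : V -> R) : measurable_fun setT (v : V -> measurableTypeR R) ->
  (forall x, 0 <= v x)%R ->
    (forall k x, v (x + ivec R k) = v x)%R ->
    pnorm q (fun x => usgn (F x) * real_complex R (v x))%R <= 1 ->
    \int[tor]_x (nc (F x) * v x)%:E \is a fin_num ->
    \int[tor]_x (nc (F x) * v x)%:E <= B%:E.
  move=> mv v0 pv hq fin.
  have := H _ _ _ hq.
  rewrite (_ : (fun x => _ * (_ * _))%R = (fun x => real_complex R (nc (F x) * v x)%R)); last first.
    by apply/funext => x; rewrite mulrA mul_usgn -rmorphM.
  rewrite integralC_real nc_real => h.
  rewrite -(fineK fin) lee_fin -[leLHS]ger0_norm; last first.
    by apply: fine_ge0; apply: integral_ge0 => x _; rewrite lee_fin mulr_ge0 ?nc_ge0.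
  apply: h; first by apply: mcfunM; [exact: mcfun_usgn|exact: mcfun_real].
  by move=> k x; rewrite pF pv.
have finv (v : V -> R) (c : R) : measurable_fun setT (v : V -> measurableTypeR R) ->
  (forall x, 0 <= v x <= c)%R ->
    \int[tor]_x (nc (F x) * v x)%:E \is a fin_num.
  move=> mv vc.
  rewrite ge0_fin_numE; last by apply: integral_ge0 => x _; rewrite lee_fin mulr_ge0 ?nc_ge0//;
    case/andP: (vc x).
  apply: (@le_lt_trans _ _ (\int[tor]_x (cst (b * c)%:E x))).
    apply: ge0_le_integral => //.
    - by move=> x _; rewrite lee_fin mulr_ge0 ?nc_ge0//; case/andP: (vc x).
    - by apply/measurable_EFinP; exact: measurable_funM.
    - by move=> x _; case/andP: (vc x) => v0 vc'; rewrite lee_fin ler_pM// nc_ge0.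
  by rewrite integral_cst// torT mule1 ltry.
have [[-> qy]|[py q1']|[r [s [pr qs r1 s1 rs]]]] := conj_exponent_cases p1 q1 pq.
- have := key (cst 1%R); rewrite pnorm1E.
  under eq_integral do rewrite mulr1.
  apply => //; first by apply: pnorm_bounded => [|//|x]; [apply: mcfunM; [exact: mcfun_usgn|
    by apply: mcfun_real]|rewrite mulr1 nc_usgn].
  rewrite (_ : \int[tor]_x (nc (F x))%:E = \int[tor]_x (nc (F x) * cst 1%R x)%:E); last first.
    by apply: eq_integral => x _; rewrite mulr1.
  by apply: (finv (cst 1%R) 1%R (measurable_cst _)) => x; rewrite ler01 lexx.
- rewrite py pnorm_yE; apply/lee_addgt0Pr => e e0.
  have mE : measurable_fun setT (fun x => (nc (F x))%:E) by exact/measurable_EFinP.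
  rewrite -EFinD; apply/ess_supP/ae_le_measureP => //.
  (* If [|F| > B + e] on a set [A] of positive measure [a], the weight [v = \1_A / a] gives an
     integral of at least [B + e], against the bound [B] from [key]. *)
  set A := (X in tor X).
  have mA : measurable A by rewrite -[X in measurable X]setTI; apply: mE => //;
    exact: emeasurable_itv.
  apply/eqP; apply: contraT => A0.
  have A1 : tor A <= 1 by rewrite -torT; apply: le_measure; rewrite ?inE.
  have Afin : tor A \is a fin_num by rewrite ge0_fin_numE ?(le_lt_trans A1) ?ltry.
  pose a := fine (tor A).
  have a0 : (0 < a)%R by rewrite fine_gt0// lt0e A0 measure_ge0 /= -ge0_fin_numE.
  have Ea : tor A = a%:E by rewrite fineK.
  pose v := (fun x => a^-1 * \1_A x)%R.
  have mv : measurable_fun setT (v : V -> measurableTypeR R).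
    by apply: measurable_funM => //; exact: measurable_indic.
  have v0 x : (0 <= v x)%R by apply: mulr_ge0; rewrite ?invr_ge0 ?(ltW a0) ?indicE ?ler0n.
  have I1 : \int[tor]_x (v x)%:E = 1.
    under eq_integral do rewrite EFinM.
    rewrite ge0_integralZl//; last by rewrite lee_fin invr_ge0 ltW.
      by rewrite integral_indic// setIT Ea -EFinM mulVf ?gt_eqF.
    by apply/measurable_EFinP; exact: measurable_indic.
  have := key v mv v0; rewrite q1' pnorm1E => K.
  have : \int[tor]_x (nc (F x) * v x)%:E <= B%:E.
    apply: K.
    - by move=> k x; rewrite /v !indicE (_ : (x + ivec R k \in A) = (x \in A))%R//; apply/idP/idP;
        rewrite !inE /A /= pF.
    - apply: (@le_trans _ _ (\int[tor]_x (v x)%:E)); last by rewrite I1.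
      apply: ge0_le_integral => //.
      + by move=> x _; rewrite lee_fin nc_ge0.
      + apply/measurable_EFinP; apply: mcfun_nc; apply: mcfunM; [exact: mcfun_usgn|
          exact: mcfun_real].
      + exact/measurable_EFinP.
      + move=> x _; rewrite lee_fin ncM nc_real ger0_norm// -[leRHS]mul1r; apply: ler_wpM2r => //;
          exact: nc_usgn.
    - apply: (finv v a^-1%R) => // x; rewrite v0 /= /v -[leRHS]mulr1; apply: ler_wpM2l;
        first by rewrite invr_ge0 ltW.
      by rewrite indicE; case: (_ \in _).
  have : (B + e)%:E <= \int[tor]_x (nc (F x) * v x)%:E.
    rewrite -[leLHS]mule1 -I1 -ge0_integralZl//; first last.
    - have B0 : (0 <= B)%R.
        apply: le_trans (H (cst 0%R) _ _ _); first exact: nc_ge0.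
        + exact: mcfun_cst.
        + by [].
        + by apply: pnorm_bounded => [|//|x]; [exact: mcfun_cst|rewrite nc0].
      by rewrite lee_fin addr_ge0// ltW.
    - by move=> x _; rewrite lee_fin.
    - exact/measurable_EFinP.
    apply: ge0_le_integral => //.
    - move=> x _; rewrite mule_ge0// ?lee_fin// addr_ge0 ?(ltW e0)//.
      apply: le_trans (H (cst 0%R) _ _ _); first exact: nc_ge0.
      + exact: mcfun_cst.
      + by [].
      + by apply: pnorm_bounded => [|//|y]; [exact: mcfun_cst|rewrite nc0].
    - by apply: emeasurable_funM => //; exact/measurable_EFinP.
    - by apply/measurable_EFinP; exact: measurable_funM.
    - move=> x _; rewrite -EFinM lee_fin /v indicE.
      case: (boolP (x \in A)) => [|_]; last by rewrite !mulr0.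
      rewrite inE /A /= in_itv/= andbT lte_fin mulr1 => /ltW ?; apply: ler_wpM2r => //.
      by rewrite invr_ge0 ltW.
  move=> h1 h2; have := le_trans h1 h2; rewrite lee_fin => h3.
  by exfalso; move: h3 e0; lra.
- have r0 : (0 < r)%R by apply: lt_trans r1.
  have s0 : (0 < s)%R by apply: lt_trans s1.
  rewrite pr pnorm_rE; set I := \int[tor]_x _.
  have I0 : 0 <= I by apply: integral_ge0 => x _; rewrite lee_fin powR_ge0.
  have r10 : (0 < r - 1)%R by rewrite subr_gt0.
  have EI : \int[tor]_x (nc (F x) * nc (F x) `^ (r - 1))%:E = I.
    by apply: eq_integral => x _; rewrite mulr_powRB1 ?nc_ge0.
  have b0 : (0 <= b)%R by apply: le_trans (Fb 0%R); exact: nc_ge0.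
  have Ifin : I \is a fin_num.
    rewrite -EI; apply: (finv _ (b `^ (r - 1))%R); first exact: measurable_nc_pow.
    move=> x; rewrite powR_ge0 /=; apply: ge0_ler_powR; rewrite ?nnegrE ?nc_ge0 ?(ltW r10)//.
  have [Iz|Inz] := eqVneq I 0.
    rewrite Iz poweR0r ?invr_eq0 ?gt_eqF// lee_fin.
    apply: le_trans (H (cst 0%R) _ _ _); first exact: nc_ge0.
    + exact: mcfun_cst.
    + by [].
    + by apply: pnorm_bounded => [|//|y]; [exact: mcfun_cst|rewrite nc0].
  (* Here [a] is the norm of [F] itself. With [c = a^-(r-1)] the weight [v] satisfies
     [int |F| v = a], and its dual norm is at most 1 because [(r - 1) s = r]. *)
  pose a := (fine I `^ r^-1)%R.
  have fI0 : (0 < fine I)%R by rewrite fine_gt0// lt0e Inz I0 /= -ge0_fin_numE.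
  have a0 : (0 < a)%R by rewrite powR_gt0.
  have Ea : I `^ r^-1 = a%:E by rewrite -(fineK Ifin) poweR_EFin.
  pose c := (a `^ (r - 1))^-1%R.
  have c0 : (0 < c)%R by rewrite invr_gt0 powR_gt0.
  pose v := (fun x => c * nc (F x) `^ (r - 1))%R.
  have mv : measurable_fun setT (v : V -> measurableTypeR R).
    by apply: measurable_funM => //; exact: measurable_nc_pow.
  have v0 x : (0 <= v x)%R by rewrite mulr_ge0 ?(ltW c0) ?powR_ge0.
  have Ear : (a `^ r = fine I)%R by rewrite /a -powRrM mulVf ?gt_eqF// powRr1// ltW.
  have EFv : \int[tor]_x (nc (F x) * v x)%:E = a%:E.
    under eq_integral do rewrite /v mulrCA EFinM.
    rewrite ge0_integralZl//; last 3 first.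
    - by apply/measurable_EFinP; apply: measurable_funM => //; exact: measurable_nc_pow.
    - by move=> x _; rewrite lee_fin mulr_ge0 ?nc_ge0 ?powR_ge0.
    - by rewrite lee_fin ltW.
    rewrite EI -(fineK Ifin) -EFinM -Ear /c; congr EFin.
    by rewrite -[in LHS](mulr_powRB1 (ltW a0) r0) mulrC mulfK// gt_eqF// powR_gt0.
  rewrite Ea -EFv; apply: key => //.
  + by move=> k x; rewrite /v pF.
  + rewrite qs pnorm_rE.
    apply: (@le_trans _ _ ((1 : \bar R) `^ s^-1)); last by rewrite poweR1r.
    apply: le_poweR; first by rewrite invr_ge0 ltW.
      by apply: integral_ge0 => x _; rewrite lee_fin powR_ge0.
    apply: (@le_trans _ _ (\int[tor]_x ((c `^ s)%:E * (nc (F x) `^ r)%:E))).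
      apply: ge0_le_integral => //.
      * by move=> x _; rewrite lee_fin powR_ge0.
      * by apply/measurable_EFinP; apply: measurable_nc_pow; apply: mcfunM; [exact: mcfun_usgn|
          exact: mcfun_real].
      * by apply: emeasurable_funM => //; apply/measurable_EFinP; exact: measurable_nc_pow.
      move=> x _; rewrite -EFinM lee_fin ncM nc_real (ger0_norm (v0 x)).
      apply: (@le_trans _ _ (v x `^ s)%R).
        apply: (@ge0_ler_powR _ _ (ltW s0)); first by rewrite nnegrE; apply: mulr_ge0;
          [exact: nc_ge0|exact: v0].
          by rewrite nnegrE; exact: v0.
        by rewrite -[leRHS]mul1r; apply: ler_wpM2r => //; exact: nc_usgn.
      rewrite /v powRM ?(ltW c0) ?powR_ge0// -powRrM.
      suff -> : ((r - 1) * s = r)%R by [].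
      have : (r * s * (r^-1 + s^-1) = r * s)%R by rewrite rs mulr1.
      rewrite mulrDr mulrAC divff ?gt_eqF// mulfK ?gt_eqF//; lra.
    rewrite ge0_integralZl//; last 3 first.
    * by apply/measurable_EFinP; exact: measurable_nc_pow.
    * by move=> x _; rewrite lee_fin powR_ge0.
    * by rewrite lee_fin powR_ge0.
    rewrite -/I -(fineK Ifin) -EFinM lee_fin /c -Ear.
    have rs' : ((r - 1) * s = r)%R.
      have : (r * s * (r^-1 + s^-1) = r * s)%R by rewrite rs mulr1.
      rewrite mulrDr mulrAC divff ?gt_eqF// mulfK ?gt_eqF//; lra.
    rewrite -powRN -powRrM mulNr rs' powRN mulVf// gt_eqF// powR_gt0//.
  + by rewrite EFv.
Qed.

End Pnorm.

Lemma rcM (R : realType) (a b : R) : real_complex R (a * b) = real_complex R a * real_complex R b.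
Proof. by rewrite rmorphM. Qed.

Lemma rc_sum (R : realType) (I : Type) (s : seq I) (F : I -> R) :
  real_complex R (\sum_(i <- s) F i) = \sum_(i <- s) real_complex R (F i).
Proof. by rewrite rmorph_sum. Qed.

(** * Integer boxes, sampling on the grid and the Marcinkiewicz-Zygmund inequality *)

Section Boxes.
Variables (d : nat).
Local Notation Z := 'cV[int]_d.
Definition box (L : 'I_d -> nat) : seq Z := [seq boxmap c | c <- enum {dffun forall i : 'I_d,
  'I_(L i).*2.+1}].

Lemma box_uniq L : uniq (box L).
Proof. by rewrite map_inj_uniq ?enum_uniq//; exact: boxmap_inj. Qed.

Lemma mem_box L k : (k \in box L) <-> boxset L k.
Proof.
split => [/mapP[c _ ->]|]; first by rewrite boxset_image; exists c.
by rewrite boxset_image => -[c _ <-]; apply/mapP; exists c => //; rewrite mem_enum.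
Qed.

Lemma size_box L : size (box L) = (\prod_(i < d) (L i).*2.+1)%N.
Proof.
rewrite size_map -cardE card_dep_ffun foldrE big_image /=.
by apply: eq_bigr => i _; rewrite card_ord.
Qed.
End Boxes.

Section Sampling.
Variables (R : realType) (d : nat) (e : 'I_d -> int).
Hypothesis e0 : forall i, e i != 0.
Local Notation V := 'cV[R]_d.
Local Notation Z := 'cV[int]_d.
Local Notation grid := (grid R e).
Local Notation ds := (fset_set (dig R e)).

Definition vol : R := \prod_(i < d) `|(e i)%:~R : R|.

Lemma vol_gt0 : 0 < vol.
Proof. by apply: prodr_gt0 => i _; rewrite normr_gt0 intr_eq0. Qed.

Lemma size_ds : (size ds)%:R = vol.
Proof. exact: size_dig. Qed.

Lemma ch_smul_grid r k : character (smul e r) (grid k) = 1 :> R[i].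
Proof.
rewrite characterE (_ : dot _ _ = (\sum_i r i 0 * k i 0)%:~R) ?e1_int//.
rewrite /dot rmorph_sum; apply: eq_bigr => i _; rewrite !mxE !rmorphM /=.
by field; rewrite intr_eq0.
Qed.

Lemma sum_ch_smul r : \sum_(k <- ds) character (smul e r) (grid k) = (size ds)%:R :> R[i].
Proof.
by rewrite (eq_bigr (fun=> 1)) ?big_const_seq ?count_predT ?iter_addr_0// => k _;
  exact: ch_smul_grid.
Qed.

(** Some quotient [l i / e i] is not an integer. Shifting the summation index by the i-th unit
    vector permutes the digits modulo [smul] and multiplies the sum by [e1 (l i / e i)], which
    differs from 1. *)
Lemma sum_ch_nsmul l : ~ (exists r, l = smul e r) -> \sum_(k <- ds) character l (grid k) =
  0 :> R[i].
Proof.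
move=> nl.
have [i hi] : exists i, e1 ((l i 0)%:~R / (e i)%:~R : R) != 1.
  apply: contrapT => H; apply: nl.
  have K i : {z : int | l i 0 = e i * z}.
    apply: cid; have : e1 ((l i 0)%:~R / (e i)%:~R : R) = 1.
      by apply/eqP; apply: contrapT => h; apply: H; exists i; apply/negP.
    move=> /e1_eq1[z hz]; exists z.
    by apply: (@intr_inj R); rewrite intrM -hz mulrC divfK// intr_eq0.
  exists (\col_i projT1 (K i)); apply/matrixP => i j; rewrite !mxE ord1; exact: (projT2 (K i)).
pose n : Z := delta_mx i 0.
have S := @dig_sum_shift R d e e0 _ (fun k => character l (grid k)) n.
have fd := finite_dig R e0.
rewrite !fsbig_finite//= in S.
have cn : character l (grid n) = e1 ((l i 0)%:~R / (e i)%:~R : R).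
  rewrite characterE; congr e1; rewrite /dot (bigD1 i)//= big1 ?addr0 => [|j ji].
    by rewrite !mxE !eqxx /= mul1r.
  by rewrite !mxE (negbTE ji) /= mul0r mulr0.
move: S; under eq_bigr do rewrite gridD chDr cn mulrC.
rewrite -mulr_sumr => S.
have {}S := S (fun k r => _).
have : (e1 ((l i 0)%:~R / (e i)%:~R : R) - 1) * \sum_(k <- ds) character l (grid k) = 0.
  rewrite mulrBl mul1r S ?subrr// => k r.
  by rewrite gridD grid_smul// chDr ch_int mulr1.
by move/eqP; rewrite mulf_eq0 subr_eq0 (negbTE hi) /= => /eqP.
Qed.

Local Open Scope ereal_scope.
Let volV : (0 <= vol^-1)%R. Proof. by rewrite invr_ge0 ltW// vol_gt0. Qed.

(** The reflection is forced by the duality of [Q_duality]: pairing [phi (. - grid k)]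
    with [h] evaluates a trigonometric polynomial at [- grid k]. *)
Definition nu : {measure set V -> \bar R} :=
  mscale (NngNum volV) (msum (fun n => \d_(- grid (nth 0%R ds n))%R : {measure set V ->
    \bar R}) (size ds)).

Lemma integral_nu (f : V -> \bar R) : measurable_fun setT f -> (forall x, 0 <= f x) ->
  \int[nu]_x f x = (vol^-1)%:E * \sum_(k <- ds) f (- grid k)%R.
Proof.
move=> mf f0; rewrite ge0_integral_mscale//=; congr (_ * _).
rewrite ge0_integral_measure_sum// (big_nth 0%R) big_mkord; apply: eq_bigr => i _.
by rewrite integral_dirac// diracT mul1e.
Qed.

Lemma nuT : nu setT = 1.
Proof.
have := @integral_nu (cst 1) (measurable_cst _) (fun=> lee01).
rewrite integral_cst// mul1e => ->.
rewrite (eq_bigr (fun=> 1%R%:E))// sumEFin big_const_seq count_predT iter_addr_0 -EFinM size_ds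
  mulVf//.
by rewrite gt_eqF// vol_gt0.
Qed.

Local Close Scope ereal_scope.

Definition dirichlet (S : seq Z) (y : V) : R[i] := \sum_(a <- S) character a y.
(** For a box [S] this is the Fejer kernel times the number of points of [S]. It is nonnegative, and
    its integral and its sample mean both reduce to counting pairs of frequencies. *)
Definition fejer (S : seq Z) (y : V) : R := nc (dirichlet S y) ^+ 2.

Lemma mcfun_dirichlet S : measurable_cfun (dirichlet S).
Proof. by apply: mcfun_sum => a; exact: mcfun_ch. Qed.

Lemma nc_dirichlet S y : nc (dirichlet S y) <= (size S)%:R.
Proof.
apply: (le_trans (nc_sum _ _ _)); under eq_bigr do rewrite nc_ch.
by rewrite big_const_seq count_predT iter_addr_0.
Qed.

Lemma fejer_ge0 S y : 0 <= fejer S y. Proof. exact: sqr_ge0. Qed.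

Lemma fejer_le S y : fejer S y <= (size S)%:R ^+ 2.
Proof. by rewrite /fejer ler_sqr ?nnegrE ?nc_ge0// nc_dirichlet. Qed.

Lemma measurable_fejer S : measurable_fun setT (fejer S : V -> measurableTypeR R).
Proof. by apply: measurable_funX; apply: mcfun_nc; exact: mcfun_dirichlet. Qed.

Lemma fejer_complex S y : real_complex R (fejer S y) = \sum_(a <- S) \sum_(b <- S) character (a -
  b) y.
Proof.
rewrite /fejer -mulJ conjc_sum /dirichlet mulr_suml; apply: eq_bigr => a _.
by rewrite mulr_sumr; apply: eq_bigr => b _; rewrite chDl chNl.
Qed.

Lemma measurable_refl_shift (x : V) : measurable_fun setT (fun t : V => x - t).
Proof.
rewrite (_ : (fun t => _) = (fun t : V => t + x) \o (fun t : V => - t)).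
  by apply: measurableT_comp; [exact: measurable_shift|exact: measurable_cvec_opp].
by apply/funext => t /=; rewrite addrC.
Qed.

Lemma integral_fejer S x : uniq S -> (\int[torus_measure R d]_t (fejer S (x - t))%:E =
  (size S)%:R%:E)%E.
Proof.
move=> uS.
have fin : (\int[torus_measure R d]_t (fejer S (x - t))%:E \is a fin_num)%E.
  rewrite ge0_fin_numE; last by apply: integral_ge0 => t _; rewrite lee_fin fejer_ge0.
  apply: (@le_lt_trans _ _ (\int[torus_measure R d]_t (cst ((size S)%:R ^+ 2)%:E t))%E).
    apply: ge0_le_integral => //.
    - by move=> t _; rewrite lee_fin fejer_ge0.
    - apply/measurable_EFinP; apply: (@measurableT_comp _ _ _ _ _ _ (fejer S : V ->
        measurableTypeR R)) => //.
        exact: measurable_fejer.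
      exact: measurable_refl_shift.
    - by move=> t _; rewrite lee_fin; exact: fejer_le.
  by rewrite integral_cst// torT mule1 ltry.
rewrite -(fineK fin); congr EFin; apply: (@complexI R).
rewrite -integralC_real.
have -> : (fun t => real_complex R (fejer S (x - t))) =
   (fun t => \sum_(a <- S) \sum_(b <- S) character (a - b) x * character (b - a) t).
  apply/funext => t; rewrite fejer_complex; apply: eq_bigr => a _; apply: eq_bigr => b _.
  by rewrite chDr chNr -chNl opprB.
rewrite integralC_sum; last by move=> a; apply: cint_sum => b; apply: cintZ; exact: cint_ch.
transitivity (\sum_(a <- S) (1 : R[i])); last first.
  by rewrite big_const_seq count_predT iter_addr_0 rmorph_nat.
apply: eq_big_seq => a aS.
rewrite integralC_sum; last by move=> b; apply: cintZ; exact: cint_ch.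
rewrite (bigD1_seq a)//= big1 => [|b ba].
  by rewrite integralCZ ?integralC_ch ?subrr ?eqxx ?ch0 ?mulr1 ?addr0//; exact: cint_ch.
by rewrite integralCZ ?integralC_ch ?subr_eq0 ?(negbTE ba) ?mulr0//; exact: cint_ch.
Qed.

(** [K] bounds the number of frequencies of [S] that the grid cannot distinguish from a given
    one. *)
Definition overlap (S : seq Z) (K : nat) := forall a, a \in S ->
  (count (fun b => `[< exists r, (a - b = smul e r)%R >]) S <= K)%N.

(** In the double sum over [a] and [b], the sample mean of the character [b - a] is 1 if the two
    frequencies agree modulo [smul] and 0 otherwise; at most [K] values of [b] survive for each
    [a]. *)
Lemma nu_fejer S K t : uniq S -> overlap S K -> (\int[nu]_x (fejer S (x - t))%:E <=
  ((size S)%:R * K%:R)%:E)%E.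
Proof.
move=> uS oS.
rewrite integral_nu; first last.
- by move=> x; rewrite lee_fin fejer_ge0.
- apply/measurable_EFinP; apply: (@measurableT_comp _ _ _ _ _ _ (fejer S : V ->
    measurableTypeR R)) => //.
    exact: measurable_fejer.
  exact: measurable_shift.
rewrite sumEFin -EFinM lee_fin.
set s := \sum_(k <- _) _.
have s0 : 0 <= s by apply: sumr_ge0 => k _; exact: fejer_ge0.
rewrite -[leLHS]ger0_norm ?mulr_ge0 ?volV// -nc_real rcM /s rc_sum.
have -> : \sum_(k <- ds) real_complex R (fejer S (- grid k - t)) =
  \sum_(a <- S) \sum_(b <- S) character (b - a) t * \sum_(k <- ds) character (b - a) (grid k).
  under eq_bigr do rewrite fejer_complex.
  rewrite exchange_big; apply: eq_bigr => a _; rewrite exchange_big; apply: eq_bigr => b _.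
  rewrite mulr_sumr; apply: eq_bigr => k _.
  by rewrite -opprD chNr -chNl opprB chDr mulrC.
rewrite ncM nc_real ger0_norm ?volV//.
rewrite ler_pdivrMl ?vol_gt0//.
apply: (le_trans (nc_sum _ _ _)).
apply: (@le_trans _ _ (\sum_(a <- S) vol * K%:R)); last first.
  by rewrite big_const_seq count_predT iter_addr_0 -[leLHS]mulr_natl mulrCA.
rewrite big_seq [leRHS]big_seq; apply: ler_sum => a aS.
apply: (le_trans (nc_sum _ _ _)).
apply: (@le_trans _ _ (\sum_(b <- S) vol * (`[< exists r, a - b = smul e r >] : bool)%:R)).
  apply: ler_sum => b _; rewrite ncM nc_ch mul1r.
  case: asboolP => [[r hr]|nr].
    rewrite -(opprB a b) hr -smulN sum_ch_smul mulr1 -size_ds.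
    by rewrite -(rmorph_nat (real_complex R)) nc_real ger0_norm.
  rewrite sum_ch_nsmul ?nc0 ?mulr0// => -[r hr]; apply: nr; exists (- r).
  by rewrite smulN -hr opprB.
rewrite -mulr_sumr ler_pM2l ?vol_gt0//.
rewrite -natr_sum ler_nat; apply: leq_trans (oS a aS).
by rewrite -sum1_count [leqRHS]big_mkcond /=; apply: leq_sum => b _; case: asboolP.
Qed.

Section marcinkiewicz_zygmund.
Variable L : 'I_d -> nat.
Local Notation tor := (torus_measure R d).
Let A := box (fun i => (L i).*2).
Let B := box L.

(** The product of the Dirichlet kernels of the boxes [2 L] and [L], divided by the
    number of points of [L], is a de la Vallee Poussin kernel: its coefficients are [1]
    on the box [L]. *)
Lemma kernel_repr P x : trigpoly P -> (forall k, fourier P k != 0 -> boxset L k) ->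
  P x * (size B)%:R = integralC (fun t => P t * (dirichlet A (x - t) * dirichlet B (x - t))).
Proof.
move=> tP sP.
have cP : cintegrable P by have [s [_ _ ->]] := trigpolyP tP; exact: cint_TP.
have E : (fun t => P t * (dirichlet A (x - t) * dirichlet B (x - t))) =
  (fun t => \sum_(b <- B) \sum_(a <- A) character (a + b) x * (P t * conjc (character (a + b) t))).
  apply/funext => t; rewrite /dirichlet mulr_sumr mulr_sumr; apply: eq_bigr => b _;
    rewrite mulr_suml mulr_sumr; apply: eq_bigr => a _.
  by rewrite -chDl chDr chNr mulrCA.
rewrite E integralC_sum; last by move=> b; apply: cint_sum => a; apply: cintZ; exact: cint_mulch.
transitivity (\sum_(b <- B) P x).
  by rewrite big_const_seq count_predT iter_addr_0 mulr_natr.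
apply: eq_big_seq => b bB.
rewrite integralC_sum; last by move=> a; apply: cintZ; exact: cint_mulch.
(* For each [b] in the box [L], the shifted box [b + A] contains the box [L], hence the whole
   spectrum of [P]: every inner sum equals [P x]. *)
rewrite [in LHS](@TP_widen _ _ P [seq a + b | a <- A] tP).
- rewrite /TP big_map; apply: eq_bigr => a _.
  rewrite integralCZ; last exact: cint_mulch.
  by rewrite mulrC.
- by rewrite map_inj_uniq ?box_uniq//; exact: addIr.
- move=> k /sP hk; apply/mapP; exists (k - b); last by rewrite subrK.
  apply/mem_box => i; have := hk i; have := (mem_box L b).1 bB i.
  have -> : (k - b) i ord0 = k i ord0 - b i ord0 :> int by rewrite !mxE.
  by move: (k i ord0) (b i ord0) => u v; lia.
Qed.

(** AM-GM bound of the kernel of [kernel_repr] by squares, whose integrals and sample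
    sums are computed by orthogonality. *)
Definition mz_kernel (y : V) : R := (fejer A y + fejer B y) / (2 * (size B)%:R).

Lemma sizeB_gt0 : (0 : R) < (size B)%:R.
Proof. by rewrite ltr0n size_box prodn_gt0. Qed.

Lemma mz_kernel_ge0 y : 0 <= mz_kernel y.
Proof. by rewrite /mz_kernel divr_ge0 ?addr_ge0 ?fejer_ge0// mulr_ge0// ltW// sizeB_gt0. Qed.

Lemma measurable_mz_kernel : measurable_fun setT (mz_kernel : V -> measurableTypeR R).
Proof. by apply: measurable_funM => //; apply: measurable_funD; exact: measurable_fejer. Qed.

Lemma kernel_bound P x : trigpoly P -> (forall k, fourier P k != 0 -> boxset L k) ->
  ((nc (P x))%:E <= \int[tor]_t (mz_kernel (x - t) * nc (P t))%:E)%E.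
Proof.
move=> tP sP.
have [s [_ _ EP]] := trigpolyP tP.
have mP : measurable_cfun P by rewrite EP; exact: mcfun_TP.
have cP : cintegrable P by rewrite EP; exact: cint_TP.
have mAB : measurable_cfun (fun t => dirichlet A (x - t) * dirichlet B (x - t)).
  by apply: mcfunM; apply: mcfun_comp; [exact: mcfun_dirichlet|exact: measurable_refl_shift..|
    exact: mcfun_dirichlet|exact: measurable_refl_shift].
have cI : cintegrable (fun t => P t * (dirichlet A (x - t) * dirichlet B (x - t))).
  apply: (@cint_mul_bounded _ _ _ _ ((size A)%:R * (size B)%:R)) => // t.
  by rewrite ncM; apply: ler_pM; rewrite ?nc_ge0 ?nc_dirichlet.
have mk : measurable_fun setT ((fun t => mz_kernel (x - t)) : V -> measurableTypeR R).
  apply: (@measurableT_comp _ _ _ _ _ _ (mz_kernel : V -> measurableTypeR R));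
    first exact: measurable_mz_kernel.
  exact: measurable_refl_shift.
have := nc_integralC cI; rewrite -(kernel_repr x tP sP) ncM.
rewrite -(rmorph_nat (real_complex R)) nc_real ger0_norm// => H.
have B0 := sizeB_gt0.
have -> : (nc (P x))%:E = ((size B)%:R^-1%:E * (nc (P x) * (size B)%:R)%:E)%E.
  by rewrite -EFinM mulrC mulfK ?gt_eqF.
apply: (@le_trans _ _ ((size B)%:R^-1%:E * \int[tor]_x0 (nc (P x0 * (dirichlet A (x - x0) *
  dirichlet B (x - x0))))%:E)%E).
  by apply: lee_wpmul2l => //; rewrite lee_fin invr_ge0 ltW.
rewrite -ge0_integralZl//; last 2 first.
- by apply/measurable_EFinP; apply: mcfun_nc; exact: mcfunM.
- by move=> t _; rewrite lee_fin nc_ge0.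
apply: ge0_le_integral => //.
- by move=> t _; rewrite mule_ge0// lee_fin ?nc_ge0// invr_ge0 ltW.
- by apply: emeasurable_funM => //; apply/measurable_EFinP; apply: mcfun_nc; exact: mcfunM.
- by apply/measurable_EFinP; apply: measurable_funM => //; exact: mcfun_nc.
move=> t _; rewrite -EFinM lee_fin !ncM /mz_kernel /fejer.
set a := nc (dirichlet A _); set b := nc (dirichlet B _); set c := nc (P t).
have c0 : 0 <= c by exact: nc_ge0.
have ab : 2 * (a * b) <= a ^+ 2 + b ^+ 2 by have := sqr_ge0 (a - b); rewrite sqrrB; lra.
rewrite -/A -/B in B0 *; set n := (size B)%:R in B0 *.
rewrite ler_pdivrMl//.
have -> : n * ((a ^+ 2 + b ^+ 2) / (2 * n) * c) = (a ^+ 2 + b ^+ 2) / 2 * c by field;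
  rewrite gt_eqF.
rewrite mulrC; apply: ler_wpM2r => //; lra.
Qed.

(** Each square integrates to its number of frequencies, so the integral is (|A| + |B|) / (2 |B|);
    in each coordinate 4 L + 1 <= 2 (2 L + 1), whence |A| <= 2^d |B|. *)
Lemma integral_mz_kernel x : (\int[tor]_t (mz_kernel (x - t))%:E <= (2 ^+ d)%:E)%E.
Proof.
have mf S : measurable_fun setT ((fun t => fejer S (x - t)) : V -> measurableTypeR R).
  apply: (@measurableT_comp _ _ _ _ _ _ (fejer S : V -> measurableTypeR R));
    first exact: measurable_fejer.
  exact: measurable_refl_shift.
have B0 := sizeB_gt0.
under eq_integral do rewrite /mz_kernel mulrC EFinM EFinD.
rewrite ge0_integralZl//; last 2 first.
- by apply: emeasurable_funD; apply/measurable_EFinP; exact: mf.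
- by move=> t _; rewrite adde_ge0// lee_fin fejer_ge0.
rewrite ge0_integralD//; last 4 first.
- by move=> t _; rewrite lee_fin fejer_ge0.
- by apply/measurable_EFinP; exact: mf.
- by move=> t _; rewrite lee_fin fejer_ge0.
- by apply/measurable_EFinP; exact: mf.
rewrite !integral_fejer ?box_uniq// -EFinD -EFinM lee_fin ler_pdivrMl ?mulr_gt0//.
have AB : (size A)%:R <= 2 ^+ d * (size B)%:R :> R.
  rewrite !size_box -natrX -natrM ler_nat -[X in (2 ^ X)%N](card_ord d) -prod_nat_const -big_split
    /=.
  by apply: leq_prod => i _; lia.
have d1 : 1 <= 2 ^+ d :> R by apply: exprn_ege1; lra.
have : (size B)%:R <= 2 ^+ d * (size B)%:R :> R by rewrite ler_peMl// ltW.
move: AB; rewrite -/A -/B; lra.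
Qed.

(** Two frequencies of the box [2 L] differ by at most [4 L i] in the coordinate [i]; the multiples
    of [e i] in that range are counted coordinate by coordinate. *)
Definition overlapN : nat := (\prod_(i < d) (4 * L i %/ `|e i|).*2.+1)%N.

Lemma overlap_box L' : (forall i, L' i <= (L i).*2)%N -> overlap (box L') overlapN.
Proof.
move=> LL' a aA.
rewrite -size_filter.
pose b' := box (fun i => (4 * L i %/ `|e i|)%N).
have -> : overlapN = size [seq a - smul e s | s <- b'] by rewrite size_map size_box.
apply: uniq_leq_size; first by rewrite filter_uniq// box_uniq.
move=> b; rewrite mem_filter => /andP[/asboolP[r hr] bA].
apply/mapP; exists r; last by rewrite -hr opprB addrC subrK.
apply/mem_box => i; rewrite leq_divRL; last by rewrite absz_gt0.
have /mem_box/(_ i) ha := aA; have /mem_box/(_ i) hb := bA.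
have := LL' i; have := congr1 (fun M : Z => M i 0) hr; rewrite !mxE /=.
move=> E h; rewrite mulnC -abszM -[_ * _](E) => {E}.
move: ha hb h; rewrite (_ : ord0 = 0)//; lia.
Qed.

Lemma nu_mz_kernel t : (\int[nu]_x (mz_kernel (x - t))%:E <= (2 ^+ d * overlapN%:R)%:E)%E.
Proof.
have mf S : measurable_fun setT ((fun x => fejer S (x - t)) : V -> measurableTypeR R).
  apply: (@measurableT_comp _ _ _ _ _ _ (fejer S : V -> measurableTypeR R));
    first exact: measurable_fejer.
  exact: measurable_shift.
have B0 := sizeB_gt0.
under eq_integral do rewrite /mz_kernel mulrC EFinM EFinD.
rewrite ge0_integralZl//; last 2 first.
- by apply: emeasurable_funD; apply/measurable_EFinP; exact: mf.
- by move=> x _; rewrite adde_ge0// lee_fin fejer_ge0.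
rewrite ge0_integralD//; last 4 first.
- by move=> x _; rewrite lee_fin fejer_ge0.
- by apply/measurable_EFinP; exact: mf.
- by move=> x _; rewrite lee_fin fejer_ge0.
- by apply/measurable_EFinP; exact: mf.
have h1 := @nu_fejer A overlapN t (box_uniq _) (@overlap_box _ (fun i => leqnn _)).
have h2 := @nu_fejer B overlapN t (box_uniq _) (@overlap_box L (fun i => ltac:(lia))).
apply: (@le_trans _ _ ((2 * (size B)%:R)^-1%:E * (((size A)%:R * overlapN%:R)%:E + ((size B)%:R *
  overlapN%:R)%:E))%E).
  by apply: lee_wpmul2l; [rewrite lee_fin invr_ge0 mulr_ge0// ltW|exact: leeD].
rewrite -EFinD -EFinM lee_fin ler_pdivrMl ?mulr_gt0// -mulrDl mulrA; apply: ler_wpM2r => //.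
have AB : (size A)%:R <= 2 ^+ d * (size B)%:R :> R.
  rewrite !size_box -natrX -natrM ler_nat -[X in (2 ^ X)%N](card_ord d) -prod_nat_const -big_split
    /=.
  by apply: leq_prod => i _; lia.
have d1 : 1 <= 2 ^+ d :> R by apply: exprn_ege1; lra.
have : (size B)%:R <= 2 ^+ d * (size B)%:R :> R by rewrite ler_peMl// ltW.
move: AB; rewrite -/A -/B; lra.
Qed.

Local Open Scope ereal_scope.

(** Holds at every point and not just almost everywhere, because [kernel_bound] is pointwise;
    samples require this when the norm is an essential supremum. *)
Lemma marcinkiewicz_zygmund_sup (P : V -> R[i]) x : trigpoly P -> (forall k, fourier P k != 0%R ->
  boxset L k) ->
  (nc (P x))%:E <= (2 ^+ d)%:E * pnorm +oo P.
Proof.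
move=> tP sP.
have [s [_ _ EP]] := trigpolyP tP.
have mP : measurable_cfun P by rewrite EP; exact: mcfun_TP.
have mk : measurable_fun setT ((fun t => mz_kernel (x - t)%R) : V -> measurableTypeR R).
  apply: (@measurableT_comp _ _ _ _ _ _ (mz_kernel : V -> measurableTypeR R));
    first exact: measurable_mz_kernel.
  exact: measurable_refl_shift.
apply: (le_trans (kernel_bound x tP sP)).
have := hoelder1y (tor_gt0 R d) mk (mcfun_nc mP).
rewrite Lnorm1 => H; apply: le_trans _ (le_trans H _).
  rewrite le_eqVlt; apply/orP; left; apply/eqP; apply: eq_integral => t _ /=.
  by rewrite ger0_norm// mulr_ge0 ?mz_kernel_ge0 ?nc_ge0.
apply: lee_wpmul2r; first exact: Lnorm_ge0.
rewrite Lnorm1; apply: le_trans (integral_mz_kernel x).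
rewrite le_eqVlt; apply/orP; left; apply/eqP; apply: eq_integral => t _ /=.
by rewrite ger0_norm// mz_kernel_ge0.
Qed.

(** Jensen with the weight [mz_kernel (x - t)], of mass at most [2^d], costs [(2^d)^(r-1)] and puts
    the power [r] inside the integral. Exchanging integral and grid sum leaves the sample mean of
    the kernel, at most [2^d overlapN]. The product is [2^(d r) overlapN], whose r-th root is the
    constant. *)
Lemma marcinkiewicz_zygmund (P : V -> R[i]) (r : \bar R) : trigpoly P ->
  (forall k, fourier P k != 0%R -> boxset L k) -> 1 <= r ->
  Lnorm nu r (fun x => (nc (P x))%:E) <= (2 ^+ d * overlapN%:R `^ rinv r)%:E * pnorm r P.
Proof.
move=> tP sP.
have [s [_ _ EP]] := trigpolyP tP.
have mP : measurable_cfun P by rewrite EP; exact: mcfun_TP.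
have d1 : (1 <= 2 ^+ d :> R)%R by apply: exprn_ege1; lra.
have d0 : (0 < 2 ^+ d :> R)%R by apply: lt_le_trans d1.
have mk x : measurable_fun setT ((fun t => mz_kernel (x - t)%R) : V -> measurableTypeR R).
  apply: (@measurableT_comp _ _ _ _ _ _ (mz_kernel : V -> measurableTypeR R));
    first exact: measurable_mz_kernel.
  exact: measurable_refl_shift.
case: r => [r| |//].
  rewrite lee_fin => r1.
  have r0 : (0 < r)%R by apply: lt_le_trans r1.
  rewrite pnorm_rE unlock /Lnorm /rinv inver gt_eqF//=.
  set I := \int[tor]_x _.
  have I0 : 0 <= I by apply: integral_ge0 => x _; rewrite lee_fin powR_ge0.
  have mPr : measurable_fun setT (fun t => nc (P t) `^ r)%R by exact: measurable_nc_pow.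
  have pw x : (nc (P x) `^ r)%:E <= ((2 ^+ d) `^ (r - 1))%:E * \int[tor]_t (mz_kernel (x - t) * nc
    (P t) `^ r)%:E.
    rewrite -poweR_EFin.
    apply: le_trans (le_poweR (ltW r0) _ (kernel_bound x tP sP)) _; first by rewrite lee_fin nc_ge0.
    apply: le_trans (jensen_weighted _ _ _ _ _ _) _ => //.
    - exact: mk.
    - exact: mcfun_nc.
    - by move=> t; exact: mz_kernel_ge0.
    - by move=> t; exact: nc_ge0.
    apply: lee_wpmul2r; first by apply: integral_ge0 => t _;
      rewrite lee_fin mulr_ge0 ?mz_kernel_ge0 ?powR_ge0.
    rewrite -poweR_EFin; apply: le_poweR; [by rewrite subr_ge0| |exact: integral_mz_kernel].
    by apply: integral_ge0 => t _; rewrite lee_fin mz_kernel_ge0.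
  have main : \int[nu]_x `|(nc (P x))%:E| `^ r <= ((2 ^+ d) `^ r * overlapN%:R)%:E * I.
    rewrite integral_nu; last 2 first.
    - apply: (@measurableT_comp _ _ _ _ _ _ (fun x => x `^ r)); first exact: measurable_poweR.
      by apply: measurableT_comp => //; apply/measurable_EFinP; exact: mcfun_nc.
    - by move=> x; exact: poweR_ge0.
    apply: (@le_trans _ _ ((vol^-1)%:E * \sum_(k <- ds) ((2 ^+ d) `^ (r - 1))%:E * \int[tor]_t
      (mz_kernel (- grid k - t) * nc (P t) `^ r)%:E)).
      apply: lee_wpmul2l; first by rewrite lee_fin volV.
      apply: lee_sum => k _; rewrite /= ger0_norm ?nc_ge0//; exact: pw.
    rewrite -ge0_sume_distrr; last by move=> k _; apply: integral_ge0 => t _;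
      rewrite lee_fin mulr_ge0 ?mz_kernel_ge0 ?powR_ge0.
    rewrite -ge0_integral_sum//; last 2 first.
    - by move=> k; apply/measurable_EFinP; apply: measurable_funM => //; exact: mk.
    - by move=> k t _; rewrite lee_fin mulr_ge0 ?mz_kernel_ge0 ?powR_ge0.
    rewrite muleCA -ge0_integralZl//; last 2 first.
    - by apply: emeasurable_sum => k; apply/measurable_EFinP; apply: measurable_funM => //;
        exact: mk.
    - by move=> t _; apply: sume_ge0 => k _; rewrite lee_fin mulr_ge0 ?mz_kernel_ge0 ?powR_ge0.
    apply: (@le_trans _ _ (((2 ^+ d) `^ (r - 1))%:E * \int[tor]_t ((2 ^+ d * overlapN%:R)%:E * (nc
      (P t) `^ r)%:E))).
      apply: lee_wpmul2l; first by rewrite lee_fin powR_ge0.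
      apply: ge0_le_integral => //.
      - move=> t _; rewrite mule_ge0 ?lee_fin ?volV//; apply: sume_ge0 => k _;
          by rewrite lee_fin mulr_ge0 ?mz_kernel_ge0 ?powR_ge0.
      - apply: emeasurable_funM => //; apply: emeasurable_sum => k; apply/measurable_EFinP;
          apply: measurable_funM => //; exact: mk.
      - by apply: emeasurable_funM => //; exact/measurable_EFinP.
      move=> t _.
      have := @nu_mz_kernel t.
      rewrite integral_nu; last 2 first.
      - apply/measurable_EFinP; apply: (@measurableT_comp _ _ _ _ _ _ (mz_kernel : V ->
          measurableTypeR R)); first exact: measurable_mz_kernel.
        exact: measurable_shift.
      - by move=> x; rewrite lee_fin mz_kernel_ge0.
      move=> H; apply: (@le_trans _ _ ((vol^-1)%:E * (\sum_(k <- ds) (mz_kernel (- grid k - t))%:E)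
        * (nc (P t) `^ r)%:E)).
        rewrite -muleA; apply: lee_wpmul2l; first by rewrite lee_fin volV.
        by rewrite !sumEFin -EFinM lee_fin mulr_suml.
      by apply: lee_wpmul2r => //; rewrite lee_fin powR_ge0.
    rewrite ge0_integralZl//; last 2 first.
    - exact/measurable_EFinP.
    - by move=> t _; rewrite lee_fin powR_ge0.
    rewrite muleA -EFinM mulrA -/I -[X in (_ * X * _)%R](powRr1 (ltW d0)) -powRD ?subrK//.
    by rewrite gt_eqF ?implybT.
  apply: le_trans (le_poweR _ _ main) _.
  - by rewrite invr_ge0 ltW.
  - by apply: integral_ge0 => x _; exact: poweR_ge0.
  rewrite poweRM//.
  rewrite poweR_EFin powRM ?powR_ge0// -powRrM divff ?gt_eqF// powRr1//; exact: ltW.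
move=> _; rewrite unlock /Lnorm (_ : 0 < nu setT); last by rewrite nuT.
rewrite /rinv invey /= powRr0 mulr1.
by apply/ess_supP/nearW => x /=; rewrite ger0_norm ?nc_ge0//; exact: marcinkiewicz_zygmund_sup.
Qed.

End marcinkiewicz_zygmund.
End Sampling.

(** * Powers of a diagonal dilation *)

Section DiagonalDilation.
Variables (R : realType) (d : nat) (ms : 'rV[int]_d).
Local Notation M := (diag_mx ms : 'M[int]_d).
Local Notation V := 'cV[R]_d.
Local Notation Z := 'cV[int]_d.

Definition dpow (j : nat) (i : 'I_d) : int := ms 0 i ^+ j.

Lemma diag_exp j : M ^+ j = diag_mx (\row_i dpow j i).
Proof.
elim: j => [|j IH].
  by apply/matrixP => i k; rewrite expr0 !mxE /dpow expr0.
rewrite exprS IH; apply/matrixP => i k; rewrite -[_ * _]/(_ *m _) mul_diag_mx !mxE /dpow.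
by rewrite exprS mulrnAr.
Qed.

Lemma mpowE j : mpow R M j = diag_mx (\row_i (dpow j i)%:~R).
Proof.
rewrite /mpow diag_exp; apply/matrixP => i k; rewrite !mxE.
by case: eqP => // _; rewrite ?mulr1n ?mulr0n.
Qed.

Lemma adjpowE j : adjpow R M j = mpow R M j.
Proof. by rewrite /adjpow tr_diag_mx. Qed.

Lemma absdetE : absdet R M = \prod_(i < d) `|(ms 0 i)%:~R : R|.
Proof. by rewrite /absdet det_diag rmorph_prod normr_prod. Qed.

Lemma vol_dpow j : vol R (dpow j) = absdet R M ^+ j.
Proof.
rewrite absdetE -prodrXl; apply: eq_bigr => i _.
by rewrite /dpow rmorphXn normrX.
Qed.

(** The diagonal entries are eigenvalues, and an integer of modulus above 1 has modulus at least
    2. *)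
Lemma dilation_ge2 : dilation R M -> forall i, (2 <= `|ms ord0 i|)%N.
Proof.
move=> h i; have := h ((ms 0 i)%:~R); rewrite -intr_norm ltr1z => K.
have H : 1 < `|ms ord0 i|.
  apply: K; apply/eigenvalueP; exists (delta_mx 0 i); last first.
    by apply/eqP => /matrixP/(_ 0 i); rewrite !mxE !eqxx => /eqP; rewrite oner_eq0.
  rewrite map_diag_mx mul_mx_diag; apply/rowP => k; rewrite !mxE eqxx /=.
  by case: (eqVneq k i) => [->|ik]; rewrite ?mul0r ?mulr0// mul1r mulr1.
by move: H; move: (ms ord0 i) => u; lia.
Qed.

Hypothesis ge2 : forall i, (2 <= `|ms ord0 i|)%N.

Lemma ms0 i : ms 0 i != 0.
Proof. by have := ge2 i; case: eqP => // ->. Qed.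

Lemma dpow_neq0 j i : dpow j i != 0.
Proof. by rewrite expf_neq0// ms0. Qed.

Lemma dpowR_neq0 j i : (dpow j i)%:~R != 0 :> R.
Proof. by rewrite intr_eq0 dpow_neq0. Qed.

Lemma mpow_unit j : mpow R M j \in unitmx.
Proof.
rewrite unitmxE mpowE det_diag unitfE; apply/prodf_neq0 => i _; rewrite mxE; exact: dpowR_neq0.
Qed.

Lemma mpow_mul j (x : V) : mpow R M j *m x = \col_i ((dpow j i)%:~R * x i 0).
Proof. by rewrite mpowE mul_diag_mx; apply/matrixP => i k; rewrite !mxE ord1. Qed.

Lemma invmpow j (x : V) : invmx (mpow R M j) *m x = \col_i (x i 0 / (dpow j i)%:~R).
Proof.
apply: (can_inj (mulKmx (mpow_unit j))); rewrite mulKVmx ?mpow_unit// mpow_mul.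
by apply/matrixP => i k; rewrite !mxE ord1 mulrC divfK// dpowR_neq0.
Qed.

Lemma invmpow_ivec j (k : Z) : invmx (mpow R M j) *m ivec R k = grid R (dpow j) k.
Proof. by rewrite invmpow; apply/matrixP => i l; rewrite !mxE. Qed.

Lemma digitsE j : digits (mpow R M j) = dig R (dpow j).
Proof.
apply/seteqP; split => k; rewrite /dig /=.
  by move=> [x cx E]; rewrite -invmpow_ivec E mulKmx ?mpow_unit.
by move=> ck; exists (grid R (dpow j) k) => //; rewrite -invmpow_ivec mulKVmx ?mpow_unit.
Qed.

Lemma cellE j : [set invmx (mpow R M j) *m y | y in @cube R d] = @cell R d (dpow j).
Proof.
apply/seteqP; split => x /=.
  move=> [y cy <-] i; rewrite invmpow mxE mulrC divfK ?dpowR_neq0//; exact: cy.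
move=> cx; exists (mpow R M j *m x); last by rewrite mulKmx ?mpow_unit.
by move=> i; rewrite mpow_mul mxE; exact: cx.
Qed.

Lemma enormZ (c : R) (x : V) : enorm (c *: x) = `|c| * enorm x.
Proof.
rewrite /enorm -sqrtr_sqr -sqrtrM ?sqr_ge0// mulr_sumr; congr Num.sqrt.
by apply: eq_bigr => i _; rewrite mxE exprMn.
Qed.

Lemma coord_enorm (x : V) i : `|x i 0| <= enorm x.
Proof.
rewrite -sqrtr_sqr /enorm ler_wsqrtr// (bigD1 i)//= lerDl; apply: sumr_ge0 => k _; exact: sqr_ge0.
Qed.

Lemma le_enorm (x y : V) : (forall i, `|x i 0| <= `|y i 0|) -> enorm x <= enorm y.
Proof.
move=> xy; rewrite /enorm ler_wsqrtr//; apply: ler_sum => i _.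
by rewrite -[leLHS]real_normK ?num_real// -[leRHS]real_normK ?num_real// lerXn2r ?nnegrE.
Qed.

Lemma enorm0 : enorm (0 : V) = 0.
Proof. by rewrite /enorm big1 ?sqrtr0// => i _; rewrite mxE expr0n. Qed.

Lemma norm_dpow j i : `|(dpow j i)%:~R : R| = `|(ms 0 i)%:~R| ^+ j.
Proof. by rewrite /dpow rmorphXn normrX. Qed.

Lemma ms_ge2 i : 2 <= `|(ms 0 i)%:~R : R|.
Proof. by rewrite -intr_norm (ler_int R 2); have := ge2 i; rewrite -[ms 0 i]/(ms ord0 i); lia. Qed.

Lemma grid_mono j n k : (j <= n)%N -> enorm (grid R (dpow n) k) <= enorm (grid R (dpow j) k).
Proof.
move=> jn; apply: le_enorm => i; rewrite !mxE !normrM !normfV !norm_dpow.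
apply: ler_wpM2l => //; rewrite lef_pV2 ?posrE ?exprn_gt0 ?(lt_le_trans _ (ms_ge2 i))//.
by apply: ler_weXn2l => //; apply: le_trans (ms_ge2 i); rewrite ler1n.
Qed.

Lemma grid_box j k (rho : R) (c : nat) : enorm (grid R (dpow j) k) <= rho -> rho <= c%:R ->
  boxset (fun i => c * `|dpow j i|)%N k.
Proof.
move=> h rc i; have := le_trans (coord_enorm _ i) (le_trans h rc).
rewrite mxE normrM normfV ler_pdivrMr ?normr_gt0 ?dpowR_neq0//.
rewrite -!intr_norm -(mulrz_nat c) -intrM ler_int (_ : ord0 = 0)//.
by move: (k i 0) (dpow j i) => u v; lia.
Qed.

(** Digits are described by the maximum norm, class S by the Euclidean one. The [d] additional
    powers divide every coordinate by at least [2^d], so the sum of the squares is at most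
    [d / 2^d <= 1]. *)
Lemma dig_grid j k : dig R (dpow j) k -> enorm (grid R (dpow (j + d)) k) <= 1.
Proof.
move=> dk.
have h i : (grid R (dpow (j + d)) k i 0) ^+ 2 <= (2 ^+ d)^-1.
  have ci := dk i.
  have c1 : `|grid R (dpow j) k i 0| <= 1 by rewrite ler_norml; lra.
  rewrite -real_normK ?num_real//.
  have -> : `|grid R (dpow (j + d)) k i 0| = `|grid R (dpow j) k i 0| / `|(ms 0 i)%:~R| ^+ d.
    by rewrite !mxE !normrM !normfV !norm_dpow exprD invfM mulrA.
  have m1 : 2 ^+ d <= `|(ms 0 i)%:~R : R| ^+ d by rewrite lerXn2r ?nnegrE// ms_ge2.
  have p1 : (0 : R) < `|(ms 0 i)%:~R| ^+ d by apply: lt_le_trans m1.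
  have q1 : (1 : R) <= 2 ^+ d by rewrite exprn_ege1// ler1n.
  set a := `|grid _ _ _ _ _| in c1 *; set b := `|(ms 0 i)%:~R : R| ^+ d in m1 p1 *.
  have a0 : 0 <= a by exact: normr_ge0.
  have ab1 : a / b <= (2 ^+ d)^-1.
    rewrite ler_pdivrMr//; apply: (le_trans c1).
    by rewrite mulrC ler_pdivlMr// mul1r.
  have ab0 : 0 <= a / b by rewrite divr_ge0// ltW.
  have ab2 : a / b <= 1 by apply: (le_trans ab1); rewrite invf_le1.
  by rewrite expr2 -[leRHS]mulr1; apply: ler_pM.
rewrite -sqrtr1 ler_wsqrtr//.
apply: (@le_trans _ _ (\sum_(i < d) (2 ^+ d)^-1)); first by apply: ler_sum => i _; exact: h.
rewrite sumr_const card_ord -[_ *+ d]mulr_natl ler_pdivrMr ?exprn_gt0// mul1r -natrX ler_nat.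
by rewrite ltnW// ltn_expl.
Qed.

(** In the coordinate [i] the quotient in [overlapN] is exactly [4 c x] with [x = |m_i|^(n-j)], and
    [8 c x + 1 <= (8 c + 1) x] because [x >= 1]; the product over [i] yields the power of the
    determinant. *)
Lemma overlap_le j n (c : nat) : (j <= n)%N ->
  (overlapN (dpow j) (fun i => c * `|dpow n i|)%N)%:R <= (8 * c + 1)%:R ^+ d * absdet R M ^+ (n -
    j).
Proof.
move=> jn; rewrite /overlapN natr_prod absdetE -prodrXl.
rewrite -[X in _ ^+ X * _](card_ord d) -prodr_const -big_split /=.
apply: ler_prod => i _; rewrite ler0n /=.
have -> : (4 * (c * `|dpow n i|) %/ `|dpow j i| = 4 * c * `|ms ord0 i| ^ (n - j))%N.
  rewrite /dpow !abszX -(subnK jn) expnD addnK !mulnA mulnK//.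
  by rewrite expn_gt0 absz_gt0 ms0.
rewrite -intr_norm -natr_absz -natrX -natrM ler_nat -[ms 0 i]/(ms ord0 i).
have : (0 < `|ms ord0 i| ^ (n - j))%N by rewrite expn_gt0 absz_gt0 ms0.
move: (_ ^ _)%N => x; nia.
Qed.

Lemma absdet_ge1 : 1 <= absdet R M.
Proof. rewrite absdetE; apply: (big_ind (fun x : R => 1 <= x)) => // [x y x1 y1|i _];
  first exact: mulr_ege1.
by apply: le_trans (ms_ge2 i); rewrite ler1n. Qed.

End DiagonalDilation.

(** * The operator on samples: multiplier form, duality, reproduction *)

Section Qop.
Variables (R : realType) (d : nat) (ms : 'rV[int]_d).
Hypothesis ge2 : forall i, (2 <= `|ms ord0 i|)%N.
Local Notation M := (diag_mx ms : 'M[int]_d).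
Local Notation V := 'cV[R]_d.
Local Notation Z := 'cV[int]_d.
Local Notation dpow := (dpow ms).
Variable j : nat.
Local Notation grid := (grid R (dpow j)).
Local Notation ds := (fset_set (dig R (dpow j))).
Local Notation vl := (vol R (dpow j)).
Local Notation rc := (real_complex R).
Implicit Types (T H : V -> R[i]) (phi : V -> R[i]) (a : Z -> R[i]) (p q : \bar R).

Let eej0 i : dpow j i != 0. Proof. exact: dpow_neq0. Qed.
Let vl0 : 0 < vl. Proof. exact: vol_gt0. Qed.

Lemma QopE a phi x : Qop M j a phi x = rc vl^-1 * \sum_(k <- ds) a k * phi (x - grid k).
Proof.
rewrite /Qop -vol_dpow digitsE// fsbig_finite/=; last exact: finite_dig.
by congr (_ * _); apply: eq_bigr => k _; rewrite invmpow_ivec.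
Qed.

(** [bhat a] is the discrete Fourier transform of the samples, so that [Qop] becomes a product of
    coefficients in [Qop_TP]; [bil a] is the normalised pairing of the samples with values at the
    atoms of [nu]. *)
Definition bhat a (n : Z) : R[i] := rc vl^-1 * \sum_(k <- ds) a k * conjc (character n (grid k)).
Definition bil a H : R[i] := rc vl^-1 * \sum_(k <- ds) a k * H (- grid k).

Lemma Qop_TP a phi s : trigpoly phi -> uniq s -> (forall n, fourier phi n != 0 -> n \in s) ->
  Qop M j a phi = TP s (fun n => fourier phi n * bhat a n).
Proof.
move=> tp us hs; apply/funext => x; rewrite QopE {1}(TP_widen tp us hs) /TP.
transitivity (rc vl^-1 * \sum_(k <- ds) \sum_(n <- s) a k * (fourier phi n * (character n x * conjc
  (character n (grid k))))).
  congr (_ * _); apply: eq_bigr => k _; rewrite mulr_sumr; apply: eq_bigr => n _.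
  by rewrite chDr chNr.
rewrite exchange_big mulr_sumr; apply: eq_bigr => n _.
rewrite /bhat !mulr_sumr !mulr_suml; apply: eq_bigr => k _; ring.
Qed.

Lemma QopB a b phi x : Qop M j (fun k => a k - b k) phi x = Qop M j a phi x - Qop M j b phi x.
Proof.
rewrite !QopE -mulrBr; congr (_ * _); rewrite -sumrB; apply: eq_bigr => k _; by rewrite mulrBl.
Qed.

Lemma trigpoly_Qop a phi : trigpoly phi -> trigpoly (Qop M j a phi).
Proof. by move=> tp; have [s [us hs _]] := trigpolyP tp; rewrite (Qop_TP a tp us hs);
  exact: trigpoly_TP. Qed.

Lemma multiplier_fsum phi h s x : uniq s -> (forall n, fourier phi n != 0 -> n \in s) ->
  \sum_(k \in [set: Z]) fourier phi k * fourier h k * character k x =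
  TP s (fun n => fourier phi n * fourier h n) x.
Proof.
move=> us hs; apply: fsum_support => // k; rewrite !mulf_eq0 !negb_or => /andP[/andP[k0 _] _];
  exact: hs.
Qed.

Local Open Scope ereal_scope.

Lemma le_multiplier q phi h s : trigpoly phi -> uniq s -> (forall n, fourier phi n != 0%R ->
  n \in s) ->
  Lp q h -> pnorm q h <= 1 ->
  pnorm q (TP s (fun n => fourier phi n * fourier h n)%R) <= multiplier_norm q phi.
Proof.
move=> tp us hs lh h1; apply: ereal_sup_ubound; exists h => //.
by congr (pnorm q _); apply/funext => x; exact: multiplier_fsum.
Qed.

(** The constant 1 is an admissible test function, and the multiplier sends it to the constant
    [fourier phi 0]. *)
Lemma multiplier_ge q phi : 1 <= q -> trigpoly phi -> (nc (fourier phi 0))%:E <=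
  multiplier_norm q phi.
Proof.
move=> q1 tp; have [s [us hs Es]] := trigpolyP tp.
have n1 : pnorm q (fun _ : V => 1%R : R[i]) <= 1 by apply: pnorm_bounded => // x; rewrite nc1.
have L1 : Lp q (fun _ : V => 1%R : R[i]).
  by split => //; apply: le_lt_trans n1 _; rewrite ltry.
(* The frequency 0 is placed in front because it need not occur in [s]. *)
have us' : uniq (0%R :: rem 0%R s) by rewrite cons_uniq mem_rem_uniq// inE eqxx rem_uniq.
have hs' n : fourier phi n != 0%R -> n \in 0%R :: rem 0%R s.
  by move=> /hs ns; rewrite inE mem_rem_uniq// inE ns andbT; case: eqP.
apply: le_trans (le_multiplier tp us' hs' L1 n1).
have f1 k : fourier (fun _ : V => 1%R : R[i]) k = (k == 0)%:R%R.
  rewrite (_ : (fun _ => 1%R) = @character R d 0); last by apply/funext => x; rewrite ch0.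
  by rewrite fourier_ch eq_sym.
have E x : TP (0%R :: rem 0%R s) (fun n => fourier phi n * fourier (fun _ : V => 1%R : R[i]) n)%R x
  = fourier phi 0.
  rewrite /TP big_cons f1 eqxx ch0 !mulr1 big_seq big1 ?addr0// => n;
    rewrite mem_rem_uniq// inE => /andP[n0 _].
  by rewrite f1 (negbTE n0) mulr0 mul0r.
apply: le_trans (pnorm1_le _ q1); last exact: mcfun_TP.
rewrite pnorm1E; under eq_integral do rewrite E.
by rewrite integral_cst// torT mule1.
Qed.

Lemma multiplier_fin q phi : 1 <= q -> trigpoly phi -> multiplier_norm q phi \is a fin_num.
Proof.
move=> q1 tp; have [s [us hs Es]] := trigpolyP tp.
rewrite ge0_fin_numE; last by apply: le_trans (multiplier_ge q1 tp); rewrite lee_fin nc_ge0.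
apply: (@le_lt_trans _ _ (\sum_(n <- s) nc (fourier phi n))%R%:E); last by rewrite ltry.
apply: ge_ereal_sup => _ [h [lh h1] <-].
rewrite (_ : (fun x => _) = TP s (fun n => fourier phi n * fourier h n)%R); last first.
  by apply/funext => x; exact: multiplier_fsum.
apply: pnorm_bounded => //; first exact: mcfun_TP.
move=> x; apply: (le_trans (nc_TP _ _ _)); apply: ler_sum => n _.
rewrite ncM -[leRHS]mulr1; apply: ler_wpM2l; first exact: nc_ge0.
have := fourier_le n q1 (Lp_cint q1 lh) => H; have := le_trans H h1; by rewrite lee_fin.
Qed.

(** [H] is obtained from a test function [h] of the dual ball by the multiplier [phi] and
    a reflection; hence the bound of its norm by [multiplier_norm]. *)
Lemma Q_duality p q phi a (B : R) : 1 <= p -> 1 <= q -> p^-1 + q^-1 = 1 -> trigpoly phi ->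
  (forall H, trigpoly H -> (forall n, fourier H n != 0 -> fourier phi n != 0)%R ->
     pnorm q H <= multiplier_norm q phi -> (nc (bil a H) <= B)%R) ->
  pnorm p (Qop M j a phi) <= B%:E.
Proof.
move=> p1 q1 pq tp hB; have [s [us hs Es]] := trigpolyP tp.
rewrite (Qop_TP a tp us hs); set F := TP _ _.
(* The pairing in [duality] has no conjugation and would match the frequency [n] of [F] with [- n]
   of [h]; after the reflection both carry the same [n]. *)
rewrite -pnorm_opp//; [|exact: mcfun_TP|exact: TP_per].
apply: (@duality _ _ p q _ (\sum_(n <- s) nc (fourier phi n * bhat a n))%R B) => //.
- by apply: mcfun_comp; [exact: mcfun_TP|exact: measurable_cvec_opp].
- by move=> k x; rewrite opprD -ivecN /F TP_per.
- by move=> x; exact: nc_TP.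
move=> h mh ph h1.
have lh : Lp q h by split => //; apply: le_lt_trans h1 _; rewrite ltry.
have ch := Lp_cint q1 lh.
pose H := TP s (fun n => fourier phi n * fourier h n)%R.
have -> : integralC (fun x => F (- x) * h x)%R = bil a H.
  transitivity (\sum_(n <- s) (fourier phi n * bhat a n) * fourier h n)%R.
    rewrite (_ : (fun x => _) = (fun x => \sum_(n <- s) (fourier phi n * bhat a n) * (h x * conjc
      (character n x)))%R); last first.
      apply/funext => x; rewrite /F /TP mulr_suml; apply: eq_bigr => n _.
      by rewrite chNr -mulrA (mulrC _ (h x)).
    rewrite integralC_sum; last by move=> n; apply: cintZ; exact: cint_mulch.
    by apply: eq_bigr => n _; rewrite integralCZ//; exact: cint_mulch.
  rewrite /bil /H /TP.
  transitivity (rc vl^-1 * \sum_(k <- ds) \sum_(n <- s) a k * (fourier phi n * fourier h n * conjc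
    (character n (grid k))))%R; last first.
    by congr (_ * _)%R; apply: eq_bigr => k _; rewrite mulr_sumr; apply: eq_bigr => n _;
      rewrite chNr.
  rewrite exchange_big mulr_sumr; apply: eq_bigr => n _.
  by rewrite /bhat !mulr_sumr !mulr_suml; apply: eq_bigr => k _; ring.
apply: hB; first exact: trigpoly_TP.
- move=> n; rewrite /H fourier_TP//; case: ifP => _; last by rewrite eqxx.
  by rewrite mulf_eq0 negb_or => /andP[].
- exact: le_multiplier.
Qed.

Lemma hoelder_nu p q P H : 1 <= p -> 1 <= q -> p^-1 + q^-1 = 1 -> measurable_cfun P ->
  measurable_cfun H ->
  (vl^-1 * \sum_(k <- ds) nc (P (- grid k)%R) * nc (H (- grid k)%R))%R%:E <=
  Lnorm (nu R (dpow_neq0 ge2 j)) p (fun x => (nc (P x))%:E) * Lnorm (nu R (dpow_neq0 ge2 j)) q (fun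
    x => (nc (H x))%:E).
Proof.
move=> p1 q1 pq mP mH.
have nu0 : 0 < nu R (dpow_neq0 ge2 j) (setT : set V) by rewrite nuT.
have := ehoelder nu0 (mcfun_nc mP) (mcfun_nc mH) p1 q1 pq.
rewrite Lnorm1 => /(le_trans _); apply.
rewrite (_ : \int[nu R (dpow_neq0 ge2 j)]_x _ = \int[nu R (dpow_neq0 ge2 j)]_x (nc (P x) * nc (H
  x))%:E); last first.
  by apply: eq_integral => x _ /=; rewrite ger0_norm// mulr_ge0 ?nc_ge0.
rewrite integral_nu; last 2 first.
- by apply/measurable_EFinP; apply: measurable_funM; exact: mcfun_nc.
- by move=> x; rewrite lee_fin mulr_ge0 ?nc_ge0.
by rewrite sumEFin -EFinM.
Qed.

Lemma nc_bil a H : (nc (bil a H) <= vl^-1 * \sum_(k <- ds) nc (a k) * nc (H (- grid k)%R))%R.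
Proof.
rewrite /bil ncM nc_real ger0_norm ?invr_ge0 ?(ltW vl0)//.
apply: ler_wpM2l; first by rewrite invr_ge0 ltW.
by apply: (le_trans (nc_sum _ _ _)); apply: ler_sum => k _; rewrite ncM.
Qed.
Local Close Scope ereal_scope.

(** The diagonal matrix is its own adjoint, so frequency and grid index change places;
    [pair_trigpoly] thereby becomes a trigonometric polynomial evaluated on the grid. *)
Lemma ch_grid_sym k l : character k (grid l) = character l (grid k) :> R[i].
Proof.
rewrite !characterE; congr e1; apply: eq_bigr => i _; rewrite !mxE.
by rewrite mulrCA.
Qed.

Lemma pairE T u k t : trigpoly T -> uniq t -> (forall n, fourier T n != 0 -> n \in t) ->
  pair_trigpoly M T u j k = \sum_(l <- t) fourier T l * conjc (dfourier u l) * character l (grid k).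
Proof.
move=> tT ut ht; rewrite /pair_trigpoly (@fsum_support _ _ _ t)//.
  by apply: eq_bigr => l _; rewrite adjpowE invmpow_ivec// ch_grid_sym.
by move=> l; rewrite !mulf_eq0 !negb_or => /andP[/andP[l0 _] _]; exact: ht.
Qed.

Lemma cint_trigpoly T : trigpoly T -> cintegrable T.
Proof. by move=> /trigpolyP[s [_ _ ->]]; exact: cint_TP. Qed.

Lemma trigpolyB T T' : trigpoly T -> trigpoly T' -> trigpoly (fun x => T x - T' x).
Proof.
move=> tT tT'; have [s [us hs Es]] := trigpolyP tT; have [s' [us' hs' Es']] := trigpolyP tT'.
have uu : uniq (undup (s ++ s')) by exact: undup_uniq.
rewrite (TP_widen tT uu) => [|n /hs]; last by rewrite mem_undup mem_cat => ->.
rewrite (TP_widen tT' uu) => [|n /hs']; last by rewrite mem_undup mem_cat => ->; rewrite orbT.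
exists (undup (s ++ s')), (fun n => fourier T n - fourier T' n); apply/funext => x.
by rewrite /TP -sumrB; apply: eq_bigr => n _; rewrite mulrBl.
Qed.

Lemma fourier_trigB T T' k : trigpoly T -> trigpoly T' ->
  fourier (fun x => T x - T' x) k = fourier T k - fourier T' k.
Proof. by move=> tT tT'; apply: fourierB; exact: cint_trigpoly. Qed.

Lemma pairB T T' u k : trigpoly T -> trigpoly T' ->
  pair_trigpoly M (fun x => T x - T' x) u j k = pair_trigpoly M T u j k - pair_trigpoly M T' u j k.
Proof.
move=> tT tT'; have [s [us hs Es]] := trigpolyP tT; have [s' [us' hs' Es']] := trigpolyP tT'.
have uu : uniq (undup (s ++ s')) by exact: undup_uniq.
have h1 n : fourier T n != 0 -> n \in undup (s ++ s') by move=> /hs;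
  rewrite mem_undup mem_cat => ->.
have h2 n : fourier T' n != 0 -> n \in undup (s ++ s') by move=> /hs';
  rewrite mem_undup mem_cat => ->; rewrite orbT.
rewrite (pairE u k tT uu h1) (pairE u k tT' uu h2).
rewrite (@pairE _ u k (undup (s ++ s')))//; last 2 first.
- exact: trigpolyB.
- move=> n; rewrite fourier_trigB//; apply: contraNT => nn.
  have [h1n h2n] : fourier T n = 0 /\ fourier T' n = 0.
    split; apply/eqP; apply: contraNT nn; [exact: h1|exact: h2].
  by rewrite h1n h2n subrr.
by rewrite -sumrB; apply: eq_bigr => n _; rewrite fourier_trigB//; ring.
Qed.

(** If [enorm (grid l) < delta], then [phi] has no frequency congruent to [l] modulo the
    dilation except possibly [l] itself. *)
Lemma Q_repr T u phi (delta : R) : trigpoly T -> trigpoly phi ->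
  (forall l, fourier T l != 0 -> enorm (grid l) < delta) ->
  (forall l r, fourier phi l != 0 -> r != 0 -> ~ enorm (grid l - ivec R r) < delta) ->
  (forall l, enorm (grid l) < delta -> dfourier u l * conjc (fourier phi l) = 1) ->
  Qop M j (pair_trigpoly M T u j) phi = T.
Proof.
move=> tT tp hT hphi comp.
have [s [us hs Es]] := trigpolyP tp; have [t [ut ht Et]] := trigpolyP tT.
rewrite (Qop_TP _ tp us hs) [RHS]Et; apply/funext => x; rewrite /TP.
have E n : n \in s -> fourier phi n * bhat (pair_trigpoly M T u j) n = fourier T n.
  move=> ns.
  have Eb : bhat (pair_trigpoly M T u j) n = \sum_(l <- t) fourier T l * conjc (dfourier u l) *
     (rc vl^-1 * \sum_(k <- ds) character (l - n) (grid k)).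
    rewrite /bhat; under eq_bigr => k _ do rewrite (pairE u k tT ut ht) mulr_suml.
    rewrite exchange_big mulr_sumr; apply: eq_bigr => l _.
    rewrite !mulr_sumr; apply: eq_bigr => k _; rewrite chDl chNl; ring.
  (* Where [phi] vanishes, compatibility excludes [enorm (grid n) < delta]; hence [T] has no
     frequency there and both sides are 0. *)
  have [p0|p0] := eqVneq (fourier phi n) 0.
    rewrite p0 mul0r; apply/esym/eqP; apply: contraT => /hT hn.
    by have := comp n hn; rewrite p0 conjc0 mulr0 => /eqP; rewrite eq_sym oner_eq0.
  have K l : l \in t -> l != n -> fourier T l * conjc (dfourier u l) *
     (rc vl^-1 * \sum_(k <- ds) character (l - n) (grid k)) = 0.
    move=> lt ln; have [->|T0] := eqVneq (fourier T l) 0; first by rewrite !mul0r.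
    rewrite sum_ch_nsmul ?mulr0// => -[r hr].
    have r0 : r != 0 by apply: contra ln => /eqP r0; rewrite -subr_eq0 hr r0 smul0.
    apply: (hphi n (- r) p0); first by rewrite oppr_eq0.
    rewrite (_ : grid n - _ = grid l); first exact: hT.
    by rewrite ivecN opprK -(@grid_smul _ _ (dpow j))// -hr -gridD addrC subrK.
  have self : rc vl^-1 * \sum_(k <- ds) character (n - n) (grid k) = 1.
    rewrite subrr (eq_bigr (fun=> 1)); last by move=> k _; rewrite ch0.
    rewrite big_const_seq count_predT iter_addr_0 -(rmorph_nat rc) size_ds// -rcM mulVf ?gt_eqF//.
  have [nt|nt] := boolP (n \in t); last first.
    rewrite Eb big_seq big1 ?mulr0 => [|l lt].
      by apply/esym/eqP; apply: contraT => /ht; rewrite (negbTE nt).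
    by apply: K => //; apply: contraNneq nt => <-.
  rewrite Eb (bigD1_seq n)//= self mulr1 big_seq_cond big1 ?addr0; last first.
    by move=> l /andP[lt ln]; exact: K.
  have [T0|T0] := eqVneq (fourier T n) 0; first by rewrite T0 !mul0r mulr0.
  have := congr1 conjc (comp n (hT n T0)); rewrite conjcM conjcK conjc1 => c1.
  by rewrite mulrCA (mulrC (fourier phi n)) c1 mulr1.
under eq_big_seq => n ns do rewrite E//.
(* Compatibility also puts the spectrum of [T] inside that of [phi], so [T] may be expanded over
   [s]. *)
rewrite -[LHS]/(TP s (fourier T) x) -[RHS]/(TP t (fourier T) x) -Et -TP_widen// => n n0.
apply: hs; apply/eqP => p0; have := comp n (hT n n0).
by rewrite p0 conjc0 mulr0 => /eqP; rewrite eq_sym oner_eq0.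
Qed.

End Qop.

(** * Bounds for the samples, and near-best polynomials *)

Section SampleBounds.
Variables (R : realType) (d : nat) (ms : 'rV[int]_d).
Hypothesis ge2 : forall i, (2 <= `|ms ord0 i|)%N.
Local Notation M := (diag_mx ms : 'M[int]_d).
Local Notation V := 'cV[R]_d.
Local Notation dpow := (dpow ms).
Local Notation m := (absdet R M).
Local Notation ds j := (fset_set (dig R (dpow j))).
Implicit Types (T H f : V -> R[i]) (p q : \bar R).

Lemma absdet_gt0 : 0 < m. Proof. exact: lt_le_trans (absdet_ge1 R ge2). Qed.

Lemma rinv_ge0 p : (1 <= p)%E -> 0 <= rinv p.
Proof.
case: p => [r| |//]; rewrite /rinv ?invey// lee_fin => r1.
have r0 : 0 < r by apply: lt_le_trans r1.
by rewrite inver gt_eqF//= invr_ge0 ltW.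
Qed.

Lemma rinv_le1 p : (1 <= p)%E -> rinv p <= 1.
Proof.
case: p => [r| |//]; rewrite /rinv ?invey ?ler01// lee_fin => r1.
have r0 : 0 < r by apply: lt_le_trans r1.
by rewrite inver gt_eqF//= invf_le1.
Qed.

(** The exponent [rinv p] lies in [0, 1] and [(8 c + 1)^d] is at least 1, so this factor may be kept
    at full power; the constant is then the same for all [p]. *)
Lemma overlap_pow p (j n c : nat) : (1 <= p)%E -> (j <= n)%N ->
  (overlapN (dpow j) (fun i => c * `|dpow n i|)%N)%:R `^ rinv p <=
    (8 * c + 1)%:R ^+ d * m `^ (rinv p * (n%:R - j%:R)) :> R.
Proof.
move=> p1 jn; have p0 := rinv_ge0 p1; have p1' := rinv_le1 p1.
have A1 : 1 <= (8 * c + 1)%:R ^+ d :> R by rewrite exprn_ege1// ler1n addn1.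
apply: (@le_trans _ _ (((8 * c + 1)%:R ^+ d * m ^+ (n - j)) `^ rinv p)).
  by apply: ge0_ler_powR => //; rewrite ?nnegrE ?mulr_ge0 ?exprn_ge0 ?(ltW absdet_gt0)//;
    exact: overlap_le.
rewrite powRM ?exprn_ge0 ?(ltW absdet_gt0)//; apply: ler_pM; rewrite ?powR_ge0//.
  by rewrite ler1_powR.
by rewrite -(powR_mulrn _ (ltW absdet_gt0)) -powRrM natrB// mulrC.
Qed.

(** Product of three bounds: Marcinkiewicz-Zygmund for a polynomial with spectrum in the unit ball
    (radius 1, whence 9 = 8 * 1 + 1), the class S constant [cp], and Marcinkiewicz-Zygmund for [H],
    of spectral radius [c]. *)
Definition disc_const (c : nat) (cp : R) : R := 2 ^+ d * 9%:R ^+ d * cp * (2 ^+ d * (8 * c + 1)%:R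
  ^+ d).

Lemma trig_box j T c : (forall k, fourier T k != 0 -> enorm (grid R (dpow j) k) <= c%:R) ->
  forall k, fourier T k != 0 -> boxset (fun i => c * `|dpow j i|)%N k.
Proof. by move=> h k /h hk; exact: grid_box hk (lexx _). Qed.

Local Open Scope ereal_scope.

(** The samples of [T] are, up to conjugation, the values at [- grid k] of [dconv T' u],
    where [T' x = conjc (T (- x))]. *)
Lemma disc_bound p q (N cp : R) (c j n : nat) u T H :
  1 <= p -> 1 <= q -> p^-1 + q^-1 = 1 -> (0 <= cp)%R -> (j <= n)%N ->
  (forall T', trigpoly T' -> spectrum T' `<=` [set k | enorm (invmx (mpow R M n) *m ivec R k) <=
    1]%R ->
      pnorm p (dconv T' u) <= (cp * m `^ (N / d%:R * (n%:R - j%:R)))%:E * pnorm p T') ->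
  trigpoly T -> (forall k, fourier T k != 0 -> enorm (grid R (dpow n) k) <= 1)%R ->
  trigpoly H -> (forall k, fourier H k != 0 -> enorm (grid R (dpow j) k) <= c%:R)%R ->
  ((vol R (dpow j))^-1 * \sum_(k <- ds j) nc (pair_trigpoly M T u j k) * nc (H (- grid R (dpow j)
    k)))%R%:E <=
  (disc_const c cp * m `^ ((rinv p + N / d%:R) * (n%:R - j%:R)))%:E * (pnorm p T * pnorm q H).
Proof.
move=> p1 q1 pq cp0 jn hS tT sT tH sH.
have [t [ut ht Et]] := trigpolyP tT.
pose T' := TP t (fun l => conjc (fourier T l)).
pose P := TP t (fun l => conjc (fourier T l) * dfourier u l)%R.
have T'f k : fourier T' k = if k \in t then conjc (fourier T k) else 0%R by rewrite fourier_TP.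
have EP : dconv T' u = P.
  apply/funext => x; rewrite /dconv (@fsum_support _ _ _ t)//.
    by apply: eq_big_seq => k kt; rewrite T'f kt.
  by move=> k; rewrite T'f; case: ifP => // _; rewrite !mul0r eqxx.
have PT x : conjc (P (- x)%R) = (\sum_(l <- t) fourier T l * conjc (dfourier u l) * character l
  x)%R.
  rewrite conjc_sum; apply: eq_bigr => l _.
  by rewrite !conjcM conjcK chNr conjcK.
have nT' : pnorm p T' = pnorm p T.
  rewrite -(pnorm_opp (p := p) (f := T'))//; [|exact: mcfun_TP|exact: TP_per].
  apply: eq_pnorm => x; rewrite -ncJ; congr nc; rewrite [in RHS]Et conjc_sum; apply: eq_bigr => l _.
  by rewrite conjcM conjcK chNr conjcK.
have nP : pnorm p P <= (cp * m `^ (N / d%:R * (n%:R - j%:R)))%:E * pnorm p T.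
  rewrite -EP -nT'; apply: hS; first exact: trigpoly_TP.
  move=> k /=; rewrite /spectrum /= T'f; case: ifP => [_|]; last by rewrite eqxx.
  by rewrite conjc_eq0 invmpow_ivec// => /sT.
have tP : trigpoly P by exact: trigpoly_TP.
have sP k : fourier P k != 0%R -> (enorm (grid R (dpow n) k) <= 1%:R)%R.
  rewrite fourier_TP//; case: ifP => [_|]; last by rewrite eqxx.
  by rewrite mulf_eq0 conjc_eq0 negb_or => /andP[/sT].
have E : (\sum_(k <- ds j) nc (pair_trigpoly M T u j k) * nc (H (- grid R (dpow j) k)) =
   \sum_(k <- ds j) nc (P (- grid R (dpow j) k)) * nc (H (- grid R (dpow j) k)))%R.
  apply: eq_bigr => k _; congr (_ * _)%R.
  by rewrite (pairE ge2 j u k tT ut ht) -PT ncJ.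
rewrite E.
have mP : measurable_cfun P by exact: mcfun_TP.
have mH : measurable_cfun H by have [s [_ _ ->]] := trigpolyP tH; exact: mcfun_TP.
apply: (le_trans (hoelder_nu ge2 j p1 q1 pq mP mH)).
have b1 := marcinkiewicz_zygmund (dpow_neq0 ge2 j) tP (trig_box sP) p1.
have b2 := marcinkiewicz_zygmund (dpow_neq0 ge2 j) tH (trig_box sH) q1.
have m0 := absdet_gt0.
set NP := Lnorm _ p _ in b1 *; set NH := Lnorm _ q _ in b2 *.
have NP0 : 0 <= NP by exact: Lnorm_ge0.
have NH0 : 0 <= NH by exact: Lnorm_ge0.
apply: (@le_trans _ _ (((2 ^+ d * (9%:R ^+ d * m `^ (rinv p * (n%:R - j%:R))))%R%:E *
     ((cp * m `^ (N / d%:R * (n%:R - j%:R)))%R%:E * pnorm p T)) * ((2 ^+ d * (8 * c + 1)%:R ^+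
       d)%R%:E * pnorm q H))).
  (* [P] has its spectrum at scale [n] but is sampled at scale [j], which costs [m^((n-j)/p)]; [H]
     is already at scale [j], so its exponent is 0. *)
  apply: lee_pmul => //.
    apply: (le_trans b1); apply: lee_pmul;
      rewrite ?lee_fin ?pnorm_ge0 ?mulr_ge0 ?exprn_ge0 ?powR_ge0//.
    by apply: ler_wpM2l; [rewrite exprn_ge0|exact: (@overlap_pow p j n 1)].
  apply: (le_trans b2); apply: lee_wpmul2r; first exact: pnorm_ge0.
  rewrite lee_fin; apply: ler_wpM2l; first by rewrite exprn_ge0.
  by have := @overlap_pow q j j c q1 (leqnn _); rewrite subrr mulr0 powRr0 mulr1.
rewrite [X in X * _]muleA muleACA -!EFinM.
apply: lee_wpmul2r; first by rewrite mule_ge0// pnorm_ge0.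
rewrite lee_fin /disc_const mulrDl powRD; last by rewrite (gt_eqF m0) implybT.
by rewrite le_eqVlt; apply/orP; left; apply/eqP; ring.
Qed.

Lemma pnorm_cst1 q : 1 <= q -> pnorm q (fun _ : V => 1%R : R[i]) <= 1.
Proof. by move=> q1; apply: pnorm_bounded => [|//|x]; [exact: mcfun_cst|rewrite nc1]. Qed.

(** A single sample is at most [vol] times the mean over the grid, to which [disc_bound] applies
    with [H = 1] and [c = 0]. The factor [vol] depends on [j] only, which is enough for convergence
    at fixed [j]. *)
Lemma pair_bound p q (N cp : R) (j n : nat) u T k :
  1 <= p -> 1 <= q -> p^-1 + q^-1 = 1 -> (0 <= cp)%R -> (j <= n)%N ->
  (forall T', trigpoly T' -> spectrum T' `<=` [set k | enorm (invmx (mpow R M n) *m ivec R k) <=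
    1]%R ->
      pnorm p (dconv T' u) <= (cp * m `^ (N / d%:R * (n%:R - j%:R)))%:E * pnorm p T') ->
  trigpoly T -> (forall k, fourier T k != 0 -> enorm (grid R (dpow n) k) <= 1)%R -> k \in ds j ->
  (nc (pair_trigpoly M T u j k))%:E <=
  (vol R (dpow j) * (disc_const 0 cp * m `^ ((rinv p + N / d%:R) * (n%:R - j%:R))))%:E * pnorm p T.
Proof.
move=> p1 q1 pq cp0 jn hS tT sT kd.
have tH : trigpoly (fun _ : V => 1%R : R[i]).
  by exists [:: 0%R], (fun=> 1%R); apply/funext => x; rewrite big_cons big_nil ch0 addr0 mulr1.
have sH k' : fourier (fun _ : V => 1%R : R[i]) k' != 0%R -> (enorm (grid R (dpow j) k') <= 0%:R)%R.
  rewrite (_ : (fun _ => 1%R) = @character R d 0); last by apply/funext => x; rewrite ch0.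
  by rewrite fourier_ch; have [<-|_] := eqVneq 0%R k'; [rewrite grid0 enorm0|rewrite eqxx].
have := disc_bound p1 q1 pq cp0 jn hS tT sT tH sH.
under eq_bigr do rewrite nc1 mulr1.
set X := (_ `^ _)%R; set nT := pnorm p T => h.
have v0 := vol_gt0 R (dpow_neq0 ge2 j).
have C0 : (0 <= disc_const 0 cp * X)%R by rewrite /disc_const !mulr_ge0 ?exprn_ge0 ?powR_ge0.
have h2 : (nc (pair_trigpoly M T u j k))%:E <= (vol R (dpow j))%:E *
    ((vol R (dpow j))^-1 * \sum_(k <- ds j) nc (pair_trigpoly M T u j k))%R%:E.
  rewrite -EFinM lee_fin mulVKf ?gt_eqF// (big_rem k)//= lerDl; apply: sumr_ge0 => l _;
    exact: nc_ge0.
apply: (le_trans h2); rewrite [X in _ <= X * _]EFinM -muleA; apply: lee_wpmul2l;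
  first by rewrite lee_fin ltW.
apply: (le_trans h); apply: lee_wpmul2l; first by rewrite lee_fin.
rewrite -[leRHS]mule1; apply: lee_wpmul2l; first exact: pnorm_ge0.
exact: pnorm_cst1.
Qed.

Lemma best_approx_ge0 (A : 'M[R]_d) p f : 0 <= best_approx A p f.
Proof. by apply: le_ereal_inf_tmp => _ [T _ <-]; exact: pnorm_ge0. Qed.

Lemma trigpoly0 : trigpoly (fun _ : V => 0%R : R[i]).
Proof. by exists [::], (fun=> 0%R); apply/funext => x; rewrite big_nil. Qed.

Lemma fourier0 k : fourier (fun _ : V => 0%R : R[i]) k = 0%R.
Proof. by rewrite -[RHS](@integralC0 R d); congr integralC; apply/funext => x; rewrite mul0r. Qed.

Lemma best_approx_le (A : 'M[R]_d) p f : best_approx A p f <= pnorm p f.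
Proof.
apply: ereal_inf_lbound; exists (fun=> 0%R).
  by split; [exact: trigpoly0|move=> k; rewrite /spectrum /= fourier0 eqxx].
by apply: eq_pnorm => x; rewrite subr0.
Qed.

Lemma enorm_scaled (delta : R) j k : (0 < delta)%R ->
  (enorm (invmx (delta *: mpow R M j) *m ivec R k) < 1)%R = (enorm (grid R (dpow j) k) < delta)%R.
Proof.
move=> d0; rewrite invmxZ ?unitfE ?gt_eqF ?mpow_unit//;
  last by rewrite unitmxZ ?unitfE ?gt_eqF ?mpow_unit.
rewrite -scalemxAl enormZ invmpow_ivec// ger0_norm ?invr_ge0 ?(ltW d0)//.
by rewrite ltr_pdivrMl// mulr1.
Qed.

Lemma cintB f g : cintegrable f -> cintegrable g -> cintegrable (fun x : V => f x - g x)%R.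
Proof.
move=> cf cg; rewrite (_ : (fun x => _) = (fun x => f x + (-1) * g x)%R).
  by apply: cintD => //; exact: cintZ.
by apply/funext => x; rewrite mulN1r.
Qed.

(** If the best error [E] is positive, the infimum provides an error below [E + E]. If it is 0,
    equality in norm is required: the candidate is the Fourier partial sum over the finitely many
    admissible frequencies, whose coefficients differ from those of an admissible [T] by at most the
    error of [T]. *)
Lemma near_best_step p f (delta : R) j : 1 <= p -> Lp p f -> (0 < delta < 2^-1)%R ->
  exists T, [/\ trigpoly T, (forall k, fourier T k != 0 -> enorm (grid R (dpow j) k) < delta)%R &
    pnorm p (fun x => f x - T x)%R <= 2%:E * best_approx (delta *: mpow R M j) p f].
Proof.
move=> p1 Lf /andP[d0 d12].
have cf := Lp_cint p1 Lf; have [pf mf nf] := Lf.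
set E := best_approx _ _ _.
have E0 : 0 <= E by exact: best_approx_ge0.
have Efin : E \is a fin_num by rewrite ge0_fin_numE//; apply: le_lt_trans (best_approx_le _ _ _) nf.
have inS T : spectrum T `<=` [set k | enorm (invmx (delta *: mpow R M j) *m ivec R k) < 1]%R ->
   (forall k, fourier T k != 0 -> enorm (grid R (dpow j) k) < delta)%R.
  by move=> h k /h /=; rewrite enorm_scaled.
have ex (e : R) : (0 < e)%R -> exists T, [/\ trigpoly T, (forall k, fourier T k != 0 ->
  enorm (grid R (dpow j) k) < delta)%R &
    pnorm p (fun x => f x - T x)%R < E + e%:E].
  move=> e0; have : E < E + e%:E by rewrite lteDl// lte_fin.
  by move=> /ereal_inf_lt[_ [T [tT sT] <-] h]; exists T; split => //; exact: inS.
have [Ez|Enz] := eqVneq E 0; last first.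
  have fE0 : (0 < fine E)%R by rewrite fine_gt0// lt0e Enz E0 /= -ge0_fin_numE.
  have [T [tT sT hT]] := ex _ fE0; exists T; split => //.
  by rewrite fineK// in hT; apply: (le_trans (ltW hT)); rewrite -mule2n mule_natl.
pose s := [seq k <- box (fun i => 1 * `|dpow j i|)%N | (enorm (grid R (dpow j) k) < delta)%R].
have us : uniq s by rewrite filter_uniq// box_uniq.
have hs k : (enorm (grid R (dpow j) k) < delta)%R -> k \in s.
  move=> hk; rewrite mem_filter hk; apply/mem_box.
  by apply: (@grid_box _ _ _ ge2 j k delta) => //; [exact: ltW|lra].
exists (TP s (fourier f)); split; first exact: trigpoly_TP.
  by move=> k; rewrite fourier_TP//; case: ifP; [rewrite mem_filter => /andP[]|rewrite eqxx].
rewrite Ez mule0; apply/lee_addgt0Pr => e e0; rewrite add0e.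
(* Splits [e] into one share for [f - T] and one for each of the [size s] coefficients. *)
pose e' := (e / (1 + (size s)%:R))%R.
have e'0 : (0 < e')%R by rewrite divr_gt0.
have [T [tT sT hT]] := ex _ e'0; rewrite Ez add0e in hT.
have ET : T = TP s (fourier T) by apply: TP_widen => // k /sT; exact: hs.
have mT : measurable_cfun T by rewrite ET; exact: mcfun_TP.
have mTf := mcfun_TP s (fourier f).
rewrite (_ : (fun x => _) = (fun x => (f x - T x) + (T x - TP s (fourier f) x))%R); last first.
  by apply/funext => x; rewrite addrA subrK.
apply: (le_trans (pnormD _ _ p1)); [exact: mcfunB|exact: mcfunB|].
have -> : e%:E = e'%:E + (e' * (size s)%:R)%:E.
  by rewrite -EFinD; congr EFin; rewrite /e'; field; rewrite gt_eqF.
apply: leeD; first exact: ltW.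
apply: pnorm_bounded => //; first exact: mcfunB.
move=> x; rewrite {1}ET /TP -sumrB.
apply: (le_trans (nc_sum _ _ _)).
apply: (@le_trans _ _ (\sum_(k <- s) e')%R); last first.
  by rewrite big_const_seq count_predT iter_addr_0 mulr_natr lexx.
apply: ler_sum => k _; rewrite -mulrBl ncM nc_ch mulr1 ncB.
rewrite -fourierB//; last exact: cint_trigpoly.
rewrite -lee_fin; apply: le_trans (ltW hT); apply: fourier_le => //.
by apply: cintB => //; exact: cint_trigpoly.
Qed.

(** [near_best] only records that spectra lie in the digit sets; the second clause keeps the smaller
    ball that [Q_repr] needs. The ball is contained in the digit set because [delta < 1/2]. *)
Lemma near_best_exists p f (delta : R) : 1 <= p -> Lp p f -> (0 < delta < 2^-1)%R ->
  exists T : nat -> V -> R[i], near_best M delta p f 2 T /\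
    (forall mu k, fourier (T mu) k != 0 -> enorm (grid R (dpow mu) k) < delta)%R.
Proof.
move=> p1 Lf d0.
have [T hT] := choice (fun j => near_best_step j p1 Lf d0).
exists T; split; last by move=> mu; have [] := hT mu.
move=> mu; have [h1 h2 h3] := hT mu; split => // k /h2 hk.
rewrite digitsE// => i; have := le_lt_trans (coord_enorm (grid R (dpow mu) k) i) hk.
by rewrite ltr_norml; move: d0; lra.
Qed.

End SampleBounds.

(** * Convergence of sequences with summable increments *)

Section Limits.
Variable R : realType.

Lemma bounded_series_cvg (b : nat -> R) (j : nat) (S : R) : (forall n, (j <= n)%N -> 0 <= b n) ->
  (forall n, \sum_(j <= i < n) b i <= S) -> cvgn (series (fun n => b (j + n)%N)).
Proof.
move=> b0 bS; apply: nondecreasing_is_cvgn.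
  by apply/nondecreasing_seqP => n; rewrite /series /= big_nat_recr//= lerDl b0// leq_addr.
exists S => _ [n _ <-]; rewrite /series /=; have := bS (j + n)%N.
by rewrite -{1}[j]add0n big_addn addKn; under eq_bigr do rewrite addnC.
Qed.

Lemma real_tele_cvg (x b : nat -> R) (j : nat) (S : R) :
  (forall n, (j <= n)%N -> `|x n.+1 - x n| <= b n) -> (forall n, \sum_(j <= i < n) b i <= S) ->
    cvgn x.
Proof.
move=> xb bS.
pose y n := x (n + j)%N.
suff : cvgn y by move=> /cvg_ex[l yl]; apply/cvg_ex; exists l; rewrite -(cvg_shiftn j).
have yE : y = (fun n => y 0%N + series (telescope y) n).
  by apply/funext => n; rewrite -eq_sum_telescope.
rewrite yE; apply: is_cvgD; first exact: is_cvg_cst.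
apply: normed_cvg; apply: nondecreasing_is_cvgn.
  apply/nondecreasing_seqP => n.
  have -> : [normed series (telescope y)] n.+1 = [normed series (telescope y)] n + `|telescope y n|.
    by rewrite /normed_series_of /series /= big_nat_recr.
  by rewrite lerDl.
exists S => _ [n _ <-]; rewrite /series /=; apply: le_trans (bS (j + n)%N).
rewrite /series /= -[X in _ <= \sum_(X <= _ < _) _]add0n big_addn addKn; apply: ler_sum => i _.
by apply: xb; rewrite leq_addl.
Qed.

Lemma nc_le_ReIm (z : R[i]) : nc z <= `|complex.Re z| + `|complex.Im z|.
Proof.
rewrite ncE -[leRHS]ger0_norm ?addr_ge0// -sqrtr_sqr ler_wsqrtr//.
rewrite sqrrD !real_normK ?num_real//.
by rewrite -addrA lerD2l lerDr mulrn_wge0 ?mulr_ge0.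
Qed.

Lemma complex_tele_cvg (z : nat -> R[i]) (b : nat -> R) (j : nat) (S : R) :
  (forall n, (j <= n)%N -> nc (z n.+1 - z n) <= b n) -> (forall n, \sum_(j <= i < n) b i <= S) ->
  exists c : R[i], nc (z n - c) @[n --> \oo] --> (0 : R).
Proof.
move=> zb bS.
have cr : cvgn (fun n => complex.Re (z n)).
  apply: (real_tele_cvg (b := b) (j := j) (S := S)) => // n jn.
  by apply: le_trans (zb n jn); rewrite -ReN -ReD Re_le_nc.
have ci : cvgn (fun n => complex.Im (z n)).
  apply: (real_tele_cvg (b := b) (j := j) (S := S)) => // n jn.
  by apply: le_trans (zb n jn); rewrite -ImN -ImD Im_le_nc.
pose a := limn (fun n => complex.Re (z n)); pose b' := limn (fun n => complex.Im (z n)).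
exists (Complex a b').
apply: (@squeeze_cvgr _ _ _ _ (fun=> 0) (fun n => `|complex.Re (z n) - a| + `|complex.Im (z n) - b'|
  )).
- apply/nearW => n; rewrite nc_ge0 /=; apply: (le_trans (nc_le_ReIm _)).
  by rewrite ReD ImD ReN ImN.
- exact: cvg_cst.
- rewrite -[nbhs 0]/(nbhs (0 : R)) -(addr0 (0 : R)); apply: cvgD.
    by rewrite -(normr0 R) -(subrr a); apply: cvg_norm; apply: cvgB => //; exact: cvg_cst.
  by rewrite -(normr0 R) -(subrr b'); apply: cvg_norm; apply: cvgB => //; exact: cvg_cst.
Qed.

Lemma cvg0_sum (I : Type) (s : seq I) (F : I -> nat -> R) (P : pred I) :
  (forall i, P i -> F i n @[n --> \oo] --> (0 : R)) ->
  \sum_(i <- s | P i) F i n @[n --> \oo] --> (0 : R).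
Proof.
move=> h; elim: s => [|i s IH].
  by rewrite (_ : (fun n => _) = fun=> 0); [exact: cvg_cst|apply/funext => n; rewrite big_nil].
case: (boolP (P i)) => Pi; last first.
  by rewrite (_ : (fun n => _) = (fun n => \sum_(i <- s | P i) F i n))//; apply/funext => n;
    rewrite big_cons (negbTE Pi).
rewrite (_ : (fun n => _) = (fun n => F i n + \sum_(i <- s | P i) F i n)).
  have h2 := @cvgD _ _ _ _ _ _ _ (0 : R) (0 : R) (h i Pi) IH.
  rewrite addr0 in h2.
  exact: h2.
by apply/funext => n; rewrite big_cons Pi.
Qed.

(** Differences of consecutive approximants involve both [w i] and [w i.+1]; the shifted sum is a
    partial sum from [j] without its first term. *)
Lemma sum_shift_le (w : nat -> R) (a S : R) (j n : nat) : (forall n, 0 <= w n) -> 0 <= a ->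
  (forall n, \sum_(j <= nu < n) w nu <= S) ->
  \sum_(j <= i < n) (a * w i + w i.+1) <= (a + 1) * S.
Proof.
move=> w0 a0 hS; rewrite big_split /= -mulr_sumr mulrDl mul1r; apply: lerD.
  by apply: ler_wpM2l.
apply: le_trans (hS n.+1).
have [jn|nj] := leqP j n; last by rewrite big_geq ?sumr_ge0// ltnW.
by rewrite [leRHS]big_ltn ?ltnS// big_add1 /= lerDr.
Qed.

Lemma series_cvg0 (w : nat -> R) (S : R) (j : nat) : (forall n, 0 <= w n) ->
  (forall n, \sum_(j <= nu < n) w nu <= S) -> w n @[n --> \oo] --> (0 : R).
Proof.
move=> w0 hS; have := bounded_series_cvg (fun n _ => w0 n) hS.
move/cvg_series_cvg_0 => h; rewrite -(cvg_shiftn j).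
by rewrite (_ : (fun n => _) = (fun n => w (j + n)%N))//; apply/funext => n; rewrite addnC.
Qed.

(** Three rearrangements with the powers of [m] made opaque: [X = m^(-j s)], [Y = m^s],
    [W = m^(s mu)], and [e], [e'] the errors at [mu] and [mu.+1]. In [limit_increment_alg], [Y] is
    [m^(s d)] and the variable [s] stands for [sigma]. *)
Lemma increment_sum_alg (B X Y W e e' k : R) : B * (X * (Y * W)) * ((2 * e' + 2 * e) * k) =
  2 * B * k * X * (Y * (W * e) + Y * W * e').
Proof. ring. Qed.

Lemma increment_sup_alg (v B X Y W e e' : R) : v * (B * (X * (Y * W))) * (2 * e' + 2 * e) =
  v * (2 * B * X) * (Y * (W * e) + Y * W * e').
Proof. ring. Qed.

Lemma limit_increment_alg (v B X Y W e s : R) : v * (B * (X * (W * Y))) * (s * e + 2 * e) =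
  v * (B * (X * Y)) * (s + 2) * (W * e).
Proof. ring. Qed.

Lemma nc_triangle (a b c : R[i]) : nc (a - c) <= nc (a - b) + nc (b - c).
Proof. by rewrite (_ : a - c = (a - b) + (b - c)) ?ncD// addrA subrK. Qed.
End Limits.

(** * The first estimate for fixed [j] and [f] *)

Section LimitSamples.
Variables (R : realType) (d : nat) (ms : 'rV[int]_d).
Hypothesis ge2 : forall i, (2 <= `|ms ord0 i|)%N.
Local Notation M := (diag_mx ms : 'M[int]_d).
Local Notation V := 'cV[R]_d.
Local Notation dpow := (dpow ms).
Local Notation m := (absdet R M).

Variables (p q : \bar R) (N delta cp : R) (j : nat) (u : periodic_distribution R d) (f : V -> R[i]).
Hypotheses (p1 : (1 <= p)%E) (q1 : (1 <= q)%E) (pq : (p^-1 + q^-1 = 1)%E).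
Hypotheses (delta0 : 0 < delta < 2^-1) (cp0 : 0 <= cp).
Hypothesis hS : forall n T', (j <= n)%N -> trigpoly T' ->
  spectrum T' `<=` [set k | enorm (invmx (mpow R M n) *m ivec R k) <= 1] ->
  (pnorm p (dconv T' u) <= (cp * m `^ (N / d%:R * (n%:R - j%:R)))%:E * pnorm p T')%E.
Hypothesis Lf : Lp p f.

Local Notation ds := (fset_set (dig R (dpow j))).
Local Notation vl := (vol R (dpow j)).
Local Notation gridj := (grid R (dpow j)).
Let s : R := rinv p + N / d%:R.
Let E (nu : nat) : R := fine (best_approx (delta *: mpow R M nu) p f).
Let w (nu : nat) : R := m `^ (s * nu%:R) * E nu.

Let m0 : 0 < m. Proof. exact: absdet_gt0. Qed.

Lemma approx_fin nu : (best_approx (delta *: mpow R M nu) p f = (E nu)%:E)%E.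
Proof.
rewrite fineK// ge0_fin_numE ?best_approx_ge0//.
by have [_ _ h] := Lf; apply: le_lt_trans (best_approx_le _ _ _) h.
Qed.
Let E0 nu : 0 <= E nu. Proof. by rewrite fine_ge0// best_approx_ge0. Qed.
Let w0 nu : 0 <= w nu. Proof. by rewrite mulr_ge0 ?powR_ge0. Qed.

Lemma absdet_powB (n : nat) : (m `^ (s * (n%:R - j%:R)) = m `^ (- j%:R * s) * m `^ (s * n%:R) :> R).
Proof.
rewrite -powRD; last by rewrite (gt_eqF m0) implybT.
by congr (_ `^ _); ring.
Qed.

Lemma absdet_powS (n : nat) : (m `^ (s * n.+1%:R) = m `^ s * m `^ (s * n%:R) :> R).
Proof.
rewrite -powRD; last by rewrite (gt_eqF m0) implybT.
by congr (_ `^ _); rewrite -natr1; ring.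
Qed.

Variables (S : R).
Hypothesis hSum : forall n, \sum_(j <= nu < n) w nu <= S.

Lemma sum_w n : \sum_(j <= i < n) (m `^ s * w i + w i.+1) <= (m `^ s + 1) * S.
Proof.
exact: sum_shift_le w0 (powR_ge0 _ _) hSum.
Qed.

Lemma w_cvg0 : w n @[n --> \oo] --> (0 : R).
Proof.
exact: series_cvg0 w0 hSum.
Qed.

Variable T : nat -> V -> R[i].
Hypothesis nbT : near_best M delta p f 2 T.
Hypothesis sT : forall mu k, fourier (T mu) k != 0 -> enorm (grid R (dpow mu) k) < delta.

Let tT mu : trigpoly (T mu). Proof. by have [] := nbT mu. Qed.
Let fT mu : (pnorm p (fun x => f x - T mu x)%R <= (2 * E mu)%:E)%E.
Proof. by have [_ _] := nbT mu; rewrite approx_fin -EFinM. Qed.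
Let mf : measurable_cfun f. Proof. by have [] := Lf. Qed.
Let mT mu : measurable_cfun (T mu). Proof. by have [] := cint_trigpoly (tT mu). Qed.

(** Two sequences and two indices are allowed at once: consecutive terms of [T], and [T'] against
    [T] at the same index, are both instances. *)
Lemma near_diff sigma T' mu nu : near_best M delta p f sigma T' ->
  (pnorm p (fun x => T' mu x - T nu x)%R <= (sigma * E mu + 2 * E nu)%:E)%E.
Proof.
move=> nb; have [tT' _ hT'] := nb mu.
have mT' : measurable_cfun (T' mu) by have [] := cint_trigpoly tT'.
rewrite (_ : (fun x => _) = (fun x => (f x - T nu x) - (f x - T' mu x))); last first.
  by apply/funext => x; rewrite opprB [RHS]addrC addrA subrK.
apply: (le_trans (pnormB _ _ p1)); [exact: mcfunB|exact: mcfunB|].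
rewrite [(_ * _ + _)%R]addrC EFinD; apply: leeD; first exact: fT.
by rewrite EFinM -approx_fin.
Qed.

Lemma specD mu k : fourier (fun x => T mu.+1 x - T mu x) k != 0 -> enorm (grid R (dpow mu.+1) k) <=
  1.
Proof.
rewrite fourier_trigB// => h.
have dl : delta <= 1 by move: delta0; lra.
have [h1|h1] := eqVneq (fourier (T mu.+1) k) 0.
  have h2 : fourier (T mu) k != 0 by apply: contra h => /eqP h2; rewrite h1 h2 subrr.
  by apply: (le_trans (grid_mono R ge2 k (leqnSn mu))); apply: ltW; exact: lt_le_trans (sT h2) dl.
by apply: ltW; exact: lt_le_trans (sT h1) dl.
Qed.

Lemma incr_bound H c K mu : (j <= mu)%N -> trigpoly H ->
  (forall k, fourier H k != 0 -> enorm (gridj k) <= c%:R) -> (pnorm q H <= K%:E)%E -> 0 <= K ->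
  vl^-1 * \sum_(k <- ds) nc (pair_trigpoly M (T mu.+1) u j k - pair_trigpoly M (T mu) u j k) * nc
    (H (- gridj k)) <=
  2 * disc_const d c cp * K * m `^ (- j%:R * s) * (m `^ s * w mu + w mu.+1).
Proof.
move=> jmu tH sH HK K0.
have tD : trigpoly (fun x => T mu.+1 x - T mu x) by exact: trigpolyB.
under eq_bigr do rewrite -pairB//.
have := disc_bound ge2 p1 q1 pq cp0 (leqW jmu) (fun T' => @hS mu.+1 T' (leqW jmu)) tD (@specD mu)
  tH sH.
rewrite -lee_fin => /le_trans; apply.
have C0 : 0 <= disc_const d c cp by rewrite /disc_const !mulr_ge0 ?exprn_ge0.
apply: (@le_trans _ _ ((disc_const d c cp * m `^ ((rinv p + N / d%:R) * (mu.+1%:R - j%:R)))%:E *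
  ((2 * E mu.+1 + 2 * E mu)%:E * K%:E))%E).
  apply: lee_wpmul2l; first by rewrite lee_fin mulr_ge0 ?powR_ge0.
  by apply: lee_pmul; rewrite ?pnorm_ge0//; exact: near_diff.
rewrite -!EFinM lee_fin -/s absdet_powB absdet_powS /w absdet_powS le_eqVlt; apply/orP; left;
  apply/eqP; exact: increment_sum_alg.
Qed.

Lemma pair_cvg k : k \in ds -> exists c : R[i], nc (pair_trigpoly M (T mu) u j k - c) @[mu --> \oo]
  --> (0 : R).
Proof.
move=> kd.
have v0 : 0 < vl by exact: vol_gt0 (dpow_neq0 ge2 j).
pose A := vl * (2 * disc_const d 0 cp * m `^ (- j%:R * s)).
apply: (@complex_tele_cvg _ _ (fun mu => A * (m `^ s * w mu + w mu.+1)) j (A * ((m `^ s + 1) * S))).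
  move=> mu jmu.
  have tD : trigpoly (fun x => T mu.+1 x - T mu x) by exact: trigpolyB.
  rewrite -pairB//.
  have := pair_bound ge2 p1 q1 pq cp0 (leqW jmu) (fun T' => @hS mu.+1 T' (leqW jmu)) tD (@specD mu)
    kd.
  rewrite -lee_fin => /le_trans; apply.
  apply: (@le_trans _ _ ((vl * (disc_const d 0 cp * m `^ ((rinv p + N / d%:R) * (mu.+1%:R -
    j%:R))))%:E * ((2 * E mu.+1 + 2 * E mu)%:E))%E).
    apply: lee_wpmul2l; first by rewrite lee_fin !mulr_ge0 ?powR_ge0// ltW.
    exact: near_diff.
  rewrite -!EFinM lee_fin -/s absdet_powB absdet_powS /w absdet_powS /A le_eqVlt; apply/orP; left;
    apply/eqP; exact: increment_sup_alg.
move=> n; rewrite -mulr_sumr; apply: ler_wpM2l; last exact: sum_w.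
by rewrite /A /disc_const !mulr_ge0 ?exprn_ge0 ?powR_ge0// ltW.
Qed.

(** [pair_limit] is an [xget], so a value valid for all near-best sequences must be shown to exist.
    It is the limit [c] along [T]: against another sequence [T'], the samples of [T' mu - T mu] are
    bounded by a multiple of [w mu], which tends to 0. The chosen value then serves [T] itself, with
    [sigma = 2]. *)
Lemma pair_limit_cvg k : k \in ds ->
  nc (pair_trigpoly M (T mu) u j k - pair_limit M delta p f u j k) @[mu --> \oo] --> (0 : R).
Proof.
move=> kd; rewrite /pair_limit.
have [c hc] := pair_cvg kd.
have v0 : 0 < vl by exact: vol_gt0 (dpow_neq0 ge2 j).
set A := [set c | _].
(* The spectrum of [T' mu] lies in the digit set, which is only contained in the ball of
   the dilation of order [mu + d]. *)
have Ac : A c.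
  move=> sigma T' nb.
  pose B := vl * (disc_const d 0 cp * (m `^ (- j%:R * s) * m `^ (s * d%:R))) * (sigma + 2).
  apply: (@squeeze_cvgr _ _ _ _ (fun=> 0) (fun mu => B * w mu + nc (pair_trigpoly M (T mu) u j k -
    c))).
  - near=> mu.
    have jmu : (j <= mu)%N by near: mu; exact: nbhs_infty_ge.
    rewrite nc_ge0 /=.
    have [tT' dT' _] := nb mu.
    apply: (le_trans (nc_triangle _ (pair_trigpoly M (T mu) u j k) _)); apply: lerD => //.
    rewrite -pairB//.
    have tD : trigpoly (fun x => T' mu x - T mu x) by exact: trigpolyB.
    have sD k' : fourier (fun x => T' mu x - T mu x) k' != 0 ->
      enorm (grid R (dpow (mu + d)) k') <= 1.
      rewrite fourier_trigB// => h; apply: dig_grid => //.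
      have [h1|h1] := eqVneq (fourier (T' mu) k') 0.
        have h2 : fourier (T mu) k' != 0 by apply: contra h => /eqP h2; rewrite h1 h2 subrr.
        by rewrite -digitsE//; have [_ + _] := nbT mu; apply.
      by rewrite -digitsE//; exact: dT'.
    have jd : (j <= mu + d)%N by rewrite (leq_trans jmu)// leq_addr.
    have := pair_bound ge2 p1 q1 pq cp0 jd (fun T' => @hS _ T' jd) tD sD kd.
    rewrite -lee_fin => /le_trans; apply.
    apply: (@le_trans _ _ ((vl * (disc_const d 0 cp * m `^ ((rinv p + N / d%:R) * ((mu + d)%:R -
      j%:R))))%:E * ((sigma * E mu + 2 * E mu)%:E))%E).
      apply: lee_wpmul2l; first by rewrite lee_fin !mulr_ge0 ?powR_ge0// ltW.
      exact: near_diff.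
    rewrite -!EFinM lee_fin -/s absdet_powB natrD [s * (_ + _)]mulrDr powRD;
      last by rewrite (gt_eqF m0) implybT.
    by rewrite /B /w le_eqVlt; apply/orP; left; apply/eqP; exact: limit_increment_alg.
  - exact: cvg_cst.
  - rewrite -[nbhs 0]/(nbhs (0 : R)) -(addr0 (0 : R)); apply: cvgD => //.
    by rewrite -(mulr0 B); apply: cvgM; [exact: cvg_cst|exact: w_cvg0].
have AA : A (xget 0 A) by apply: (@xgetPex _ 0 A); exists c.
exact: (AA 2 T nbT).
Unshelve. all: by end_near.
Qed.

Variables (phi : V -> R[i]) (c : nat) (cs : R).
Hypothesis tphi : trigpoly phi.
Hypothesis sphi : forall l, fourier phi l != 0 -> enorm (gridj l) <= c%:R.
Hypothesis aphi : forall l r, fourier phi l != 0 -> r != 0 -> ~ enorm (gridj l - ivec R r) < delta.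
Hypothesis comp : forall l, enorm (gridj l) <= delta -> dfourier u l * conjc (fourier phi l) = 1.
Hypothesis cs0 : nc (dfourier u 0) <= cs.

Lemma tele_bound (b : nat -> R) (z : nat -> R[i]) (B : R) : (forall n, (j <= n)%N ->
  nc (z n.+1 - z n) <= b n) ->
  (forall n, \sum_(j <= i < n) b i <= B) -> forall n, (j <= n)%N -> nc (z n - z j) <= B.
Proof.
move=> zb bB n jn; apply: le_trans (bB n).
elim: n jn {bB} => [|n IH].
  by rewrite leqn0 => /eqP ->; rewrite subrr nc0 big_geq.
rewrite leq_eqVlt => /predU1P[<-|]; first by rewrite subrr nc0 big_geq.
rewrite ltnS => jn; rewrite big_nat_recr//= addrC.
by apply: (le_trans (nc_triangle _ (z n) _)); apply: lerD; [exact: zb|exact: IH].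
Qed.

(** The error is split into [f - T j] and the operator applied to [a' - a j]. For each dual [H], the
    pairings with [a n] telescope from [j] with a bound independent of [n], and then [n] tends to
    infinity. In the constant, [2 * cs] pays for [f - T j] and the rest for the increments. *)
Lemma quasi_interp_limit_fin :
  (pnorm p (fun x => f x - Qop M j (pair_limit M delta p f u j) phi x)%R <=
   ((2 * cs + 2 * disc_const d c cp * (m `^ s + 1)) * fine (multiplier_norm q phi) * m `^ (- j%:R *
     s) * S)%:E)%E.
Proof.
set K := fine (multiplier_norm q phi).
have EK : multiplier_norm q phi = K%:E by rewrite fineK// multiplier_fin.
have K0 : nc (fourier phi 0) <= K by rewrite -lee_fin -EK multiplier_ge.
have Kge0 : 0 <= K by apply: le_trans K0; exact: nc_ge0.
have csK : 1 <= cs * K.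
  have := comp (l := 0); rewrite grid0 enorm0 => h.
  have dl : 0 <= delta by move: delta0; lra.
  have := congr1 (@Normc.normc R) (h dl); rewrite ncM ncJ nc1 => <-.
  by apply: ler_pM; rewrite ?nc_ge0.
pose a' := pair_limit M delta p f u j.
pose a n := pair_trigpoly M (T n) u j.
have QT : Qop M j (a j) phi = T j.
  apply: (Q_repr ge2 (delta := delta)) => //; first exact: sT.
  by move=> l /ltW; exact: comp.
pose B := 2 * disc_const d c cp * K * m `^ (- j%:R * s) * ((m `^ s + 1) * S).
have QB : (pnorm p (Qop M j (fun k => a' k - a j k)%R phi) <= B%:E)%E.
  apply: (Q_duality ge2 p1 q1 pq tphi) => H tH sH HK; rewrite EK in HK.
  have sH' k : fourier H k != 0 -> enorm (gridj k) <= c%:R by move=> /sH; exact: sphi.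
  pose z n := bil ms j (a n) H.
  have bilB b b' : bil ms j b H - bil ms j b' H = bil ms j (fun k => b k - b' k) H.
    by rewrite /bil -mulrBr -sumrB; congr (_ * _); apply: eq_bigr => k _; rewrite mulrBl.
  have zb n : (j <= n)%N -> nc (z n.+1 - z n) <= 2 * disc_const d c cp * K * m `^ (- j%:R * s) * (m
    `^ s * w n + w n.+1).
    move=> jn; rewrite bilB; apply: (le_trans (nc_bil ge2 _ _ _)).
    exact: incr_bound.
  have bB n : \sum_(j <= i < n) (2 * disc_const d c cp * K * m `^ (- j%:R * s) * (m `^ s * w i + w
    i.+1)) <= B.
    rewrite -mulr_sumr; apply: ler_wpM2l; last exact: sum_w.
    by rewrite !mulr_ge0 ?powR_ge0.
  have tb := tele_bound zb bB.
  (* The filter [k \in ds] hands the membership to [cvg0_sum], since convergence of the samples is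
     known for digits; finitely many such terms give [r n --> 0]. *)
  pose r n := vl^-1 * \sum_(k <- ds | k \in ds) nc (a n k - a' k) * nc (H (- gridj k)).
  have rc : r n @[n --> \oo] --> (0 : R).
    rewrite -(mulr0 vl^-1); apply: cvgM; first exact: cvg_cst.
    apply: (@cvg0_sum _ _ _ (fun k n => nc (a n k - a' k) * nc (H (- gridj k)))) => k kd.
    rewrite -(mul0r (nc (H (- gridj k)))); apply: cvgM; last exact: cvg_cst.
    exact: pair_limit_cvg.
  apply/ler_addgt0Pr => e e0.
  have /cvgrPdist_lt/(_ e e0) rn := rc.
  near \oo => n.
  have jn : (j <= n)%N by near: n; exact: nbhs_infty_ge.
  have re : r n < e.
    have : `|0 - r n| < e by near: n; exact: rn.
    rewrite sub0r normrN; apply: le_lt_trans; exact: ler_norm.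
  rewrite -bilB; apply: (le_trans (nc_triangle _ (z n) _)); rewrite addrC; apply: lerD;
    first exact: tb.
  rewrite ncB bilB; apply: le_trans (ltW re); apply: (le_trans (nc_bil ge2 _ _ _)).
  by rewrite /r -big_seq.
rewrite (_ : (fun x => _) = (fun x => (f x - T j x) - Qop M j (fun k => a' k - a j k) phi x));
  last first.
  by apply/funext => x; rewrite QopB// QT -/a' opprB addrA subrK.
apply: (le_trans (pnormB _ _ p1)); [exact: mcfunB| |].
  by have [] := cint_trigpoly (trigpoly_Qop ge2 j (fun k => a' k - a j k) tphi).
apply: (@le_trans _ _ ((2 * E j)%:E + B%:E)%E); first exact: leeD.
rewrite -EFinD lee_fin /B.
(* [E j] occurs in the first term of the series: [w j <= S], and the factor [m^(-j s)] cancels the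
   power in [w j]. *)
have EjS : E j <= m `^ (- j%:R * s) * S.
  have wS : w j <= S by have := hSum j.+1; rewrite big_nat1.
  apply: le_trans (ler_wpM2l _ wS); last exact: powR_ge0.
  rewrite /w mulrA -powRD; last by rewrite (gt_eqF m0) implybT.
  by rewrite (_ : _ + _ = 0) ?powRr0 ?mul1r//; ring.
set X := _ `^ (_ * _) in EjS *; set Y := _ `^ s.
have E2 : E j <= (cs * K) * (X * S).
  by apply: (le_trans EjS); apply: ler_peMl => //; exact: le_trans (E0 j) EjS.
rewrite -subr_ge0.
have -> : (2 * cs + 2 * disc_const d c cp * (Y + 1)) * K * X * S - (2 * E j + 2 * disc_const d c cp
  * K * X * ((Y + 1) * S)) =
   2 * (cs * K * (X * S) - E j) by ring.
by rewrite mulr_ge0// subr_ge0.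
Unshelve. all: by end_near.
Qed.

End LimitSamples.

(** * The first estimate *)

Section LimitEstimate.
Variables (R : realType) (d : nat) (ms : 'rV[int]_d).
Hypothesis ge2 : forall i, (2 <= `|ms ord0 i|)%N.
Local Notation M := (diag_mx ms : 'M[int]_d).
Local Notation V := 'cV[R]_d.
Local Notation dpow := (dpow ms).
Local Notation m := (absdet R M).

(** [Num.bound] gives a natural radius above [rho], as the boxes of the sampling inequality have
    natural sides; for a diagonal matrix the point [x] in [class_B] is [grid l]. *)
Lemma class_B_grid (delta : R) phi : class_B M delta phi ->
  exists c : nat, forall j, (0 < j)%N -> [/\ trigpoly (phi j),
    (forall l, fourier (phi j) l != 0 -> enorm (grid R (dpow j) l) <= c%:R) &
    forall l r, fourier (phi j) l != 0 -> r != 0 -> ~ enorm (grid R (dpow j) l - ivec R r) < delta].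
Proof.
move=> [rho [c [rho0 _ h]]]; exists (Num.bound rho) => j /h[tp sp _].
have X l x : ivec R l = adjpow R M j *m x -> x = grid R (dpow j) l.
  by rewrite adjpowE => lx; rewrite -invmpow_ivec// lx mulKmx// mpow_unit.
split=> // l => [/sp[x [/X -> xr _]]|r /sp[x [/X -> _ ]]]; last exact.
by apply: ltW; apply: (lt_trans xr); exact: archi_boundP (ltW rho0).
Qed.

(** The frequency 0 is a digit, so class S bounds the zeroth coefficient uniformly in [j]; in
    [quasi_interp_limit_fin] this gives [1 <= cs * K]. *)
Lemma dfourier0_le N p (psi : nat -> periodic_distribution R d) : class_S M N p psi ->
  exists c cp : R, [/\ 0 < c, 0 < cp, forall j, (0 < j)%N -> nc (dfourier (psi j) 0) <= c &
    forall n j T, (0 < j)%N -> (j <= n)%N -> trigpoly T ->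
      spectrum T `<=` [set k | enorm (invmx (mpow R M n) *m ivec R k) <= 1] ->
      (pnorm p (dconv T (psi j)) <=
        (cp * m `^ (N / d%:R * (n%:R - j%:R)))%:E * pnorm p T)%E].
Proof.
move=> [c [cp [c0 cp0 h1 h2]]]; exists c, cp; split => // j j0.
have [_ ] := h1 j 0 j0; apply; exists 0; last by rewrite mulmx0 ivec0.
by move=> i; rewrite mxE; lra.
Qed.

Lemma compat_grid delta (phi : nat -> V -> R[i]) psi j : strictly_compatible M delta phi psi ->
  (0 < j)%N ->
  forall l, enorm (grid R (dpow j) l) <= delta -> dfourier (psi j) l * conjc (fourier (phi j) l) =
    1.
Proof. by move=> h j0 l hl; apply: h => //; rewrite adjpowE invmpow_ivec. Qed.

Lemma multiplier_gt0 q (phi : V -> R[i]) w : (1 <= q)%E -> trigpoly phi ->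
  w * conjc (fourier phi 0) = 1 ->
  (0 < multiplier_norm q phi)%E.
Proof.
move=> q1 tp h; apply: lt_le_trans (multiplier_ge q1 tp).
rewrite lte_fin lt_neqAle nc_ge0 andbT eq_sym; apply/eqP => /(@Normc.eq0_normc R) e.
by move: h; rewrite e conjc0 mulr0 => /esym/eqP; rewrite oner_eq0.
Qed.

Lemma quasi_interp_limit_le (p q : \bar R) (N delta : R) (phi : nat -> V -> R[i]) (psi : nat ->
  periodic_distribution R d) :
  (1 <= p)%E -> (1 <= q)%E -> (p^-1 + q^-1 = 1)%E -> 0 < delta < 2^-1 ->
  class_S M N p psi -> class_B M delta phi -> strictly_compatible M delta phi psi ->
  exists C : R, 0 < C /\
    forall f : V -> R[i], Lp p f -> forall j : nat, (0 < j)%N ->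
      let s := rinv p + N / d%:R in
      let Qf := Qop M j (pair_limit M delta p f (psi j) j) (phi j) in
      (pnorm p (fun x => f x - Qf x)%R <=
        C%:E * multiplier_norm q (phi j) * (m `^ (- j%:R * s))%:E *
        \sum_(j <= nu <oo) (m `^ (s * nu%:R))%:E *
          best_approx (delta *: mpow R M nu) p f)%E.
Proof.
move=> p1 q1 pq delta0 hS /class_B_grid[c hB] hC.
have [cs [cp [cs0 cp0 hs hcp]]] := dfourier0_le hS.
have m0 : 0 < m by exact: absdet_gt0.
set s := rinv p + N / d%:R.
have B0 : 0 <= disc_const d c cp by rewrite /disc_const !mulr_ge0 ?exprn_ge0// ltW.
pose C := 2 * cs + 2 * disc_const d c cp * (m `^ s + 1).
have C0 : 0 < C.
  apply: ltr_pwDl; first by apply: mulr_gt0.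
  by apply: mulr_ge0; [apply: mulr_ge0|apply: addr_ge0 => //; exact: powR_ge0].
exists C; split => // f Lf j j0 /=; set S := \big[_/_]_(_ <= _ <oo) _.
have [tp sp ap] := hB j j0; have hc := compat_grid hC j0.
have K0 : (0 < multiplier_norm q (phi j))%E.
  apply: (multiplier_gt0 (w := dfourier (psi j) 0)) => //; apply: hc.
  by rewrite grid0 enorm0; move: delta0; lra.
have Kf := multiplier_fin q1 tp.
have t0 nu : (0 <= (m `^ (s * nu%:R))%:E * best_approx (delta *: mpow R M nu) p f)%E.
  by rewrite mule_ge0 ?lee_fin ?powR_ge0 ?best_approx_ge0.
have S0 : (0 <= S)%E by apply: nneseries_ge0 => n _ _; exact: t0.
(* An infinite series makes the right-hand side infinite; since [0 * +oo = 0], this relies on strict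
   positivity of the other factors. *)
have [->|Sfin] := eqVneq S +oo%E.
  by rewrite gt0_muley ?leey// !mule_gt0// lte_fin powR_gt0.
have SE : S = (fine S)%:E by rewrite fineK// ge0_fin_numE// ltey.
have hSum n : \sum_(j <= nu < n) (m `^ (s * nu%:R) * fine (best_approx (delta *: mpow R M nu) p f))
  <= fine S.
  rewrite -lee_fin -SE -sumEFin; under eq_bigr do rewrite EFinM -(approx_fin _ _ Lf).
  by apply: nneseries_lim_ge => k _ _; exact: t0.
have [T [nT sT]] := near_best_exists ge2 p1 Lf delta0.
rewrite SE -(fineK Kf) -!EFinM.
have := quasi_interp_limit_fin ge2 p1 q1 pq delta0 (ltW cp0) (fun n T' => @hcp n j T' j0) Lf hSum
  nT sT tp sp ap hc (hs j j0).
exact.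
Qed.
End LimitEstimate.

(** * Characters as smooth test functions for distributions *)

Section Smooth.
Variables (R : realType) (d : nat).
Local Notation V := 'cV[R]_d.
Local Notation Z := 'cV[int]_d.

Definition phase (k : Z) (x : V) : R := 2 * pi * \sum_i (k i 0)%:~R * x i 0.

Lemma phaseD k x y : phase k (x + y) = phase k x + phase k y.
Proof.
rewrite /phase -mulrDr -big_split; congr (_ * _); apply: eq_bigr => i _.
by rewrite mxE mulrDr.
Qed.

Lemma phaseZ k (h : R) x : phase k (h *: x) = h * phase k x.
Proof.
rewrite /phase mulrCA; congr (_ * _); rewrite mulr_sumr; apply: eq_bigr => i _.
by rewrite mxE mulrCA.
Qed.

Lemma phase_continuous k : continuous (phase k : V -> R).
Proof.
have h : continuous (fun x : V => \sum_i (k i 0)%:~R * x i 0).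
  apply: continuous_big; first exact: add_continuous.
  by move=> i _ x; apply: continuousM; [exact: cst_continuous|exact: coord_continuous].
rewrite (_ : phase k = (fun=> 2 * pi) \* (fun x : V => \sum_i (k i 0)%:~R * x i 0))//.
by move=> x; apply: continuousM; [exact: cst_continuous|exact: h].
Qed.

(** Combinations of cosine and sine of one phase are closed under directional derivatives, so all
    iterated partial derivatives stay in this class. Real and imaginary parts of a conjugated
    character are the cases (1, 0) and (0, -1). *)
Definition wave k (a b : R) : V -> R := fun x => a * cos (phase k x) + b * sin (phase k x).

Lemma wave_continuous k a b : continuous (wave k a b).
Proof.
rewrite (_ : wave k a b = ((fun=> a) \* (fun x => cos (phase k x))) + ((fun=> b) \* (fun x => sin
  (phase k x))))//.
move=> x; apply: continuousD; (apply: continuousM; first exact: cst_continuous).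
  by apply: (@continuous_comp _ _ _ (phase k) cos); [exact: phase_continuous|exact: continuous_cos].
by apply: (@continuous_comp _ _ _ (phase k) sin); [exact: phase_continuous|exact: continuous_sin].
Qed.

Lemma is_derive_line (g : V -> R) (x v : V) (l : R) :
  is_derive (0 : R) 1 (fun h : R => g (h *: v + x)) l -> is_derive x v g l.
Proof.
have E : (fun h : R => h^-1 *: ((g \o shift x) (h *: v) - g x)) =
  (fun h : R => h^-1 *: (((fun h : R => g (h *: v + x)) \o shift 0) (h *: (1:R)) - g (0 *: v + x))).
  apply/funext => h /=; rewrite scale0r add0r; congr (_ *: (g _ - _)).
  by rewrite -[h *: 1]/(h * 1) mulr1 addr0.
move=> [d1 d2]; split.
  by rewrite /derivable E.
by rewrite -d2 /derive E.
Qed.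

Lemma is_derive_wave k a b x v :
  is_derive x v (wave k a b) (wave k (b * phase k v) (- (a * phase k v)) x).
Proof.
apply: is_derive_line.
have -> : (fun h : R => wave k a b (h *: v + x)) =
  (fun h : R => a * cos (h * phase k v + phase k x) + b * sin (h * phase k v + phase k x)).
  by apply/funext => h; rewrite /wave phaseD phaseZ.
set c := phase k v; set t := phase k x.
have D1 : is_derive (0 : R) 1 (fun h : R => h * c + t) c.
  by apply: is_derive_eq; rewrite ?scaler0 ?addr0 ?add0r /=; rewrite -[c *: 1]/(c * 1) mulr1.
apply: is_derive_eq.
by rewrite mul0r add0r /wave -/t -[_ *: _]/(a * (- sin t * c)) -[_ *: _]/(b * (cos t * c)); ring.
Qed.

Lemma smooth_wave k a b : smooth_real (wave k a b).
Proof.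
have H s : exists a' b', iter_partial s (wave k a b) = wave k a' b'.
  elim: s => [|i s [a' [b' E]]]; first by exists a, b.
  exists (b' * phase k (delta_mx i 0)), (- (a' * phase k (delta_mx i 0))).
  rewrite /= -/(iter_partial s _) E; apply/funext => x.
  by have := is_derive_wave k a' b' x (delta_mx i 0) => h; exact: derive_val.
move=> s; have [a' [b' ->]] := H s; split; first exact: wave_continuous.
by move=> i x; have := is_derive_wave k a' b' x (delta_mx i 0) => h; exact: ex_derive.
Qed.

Lemma Cinfty_conj_ch k : Cinfty (fun x : V => conjc (character k x)).
Proof.
split.
- by move=> n x; rewrite ch_per.
- rewrite (_ : (fun x => _) = wave k 1 0); first exact: smooth_wave.
  by apply/funext => x; rewrite /wave mul1r mul0r addr0.
- rewrite (_ : (fun x => _) = wave k 0 (-1)); first exact: smooth_wave.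
  by apply/funext => x; rewrite /wave mul0r add0r mulN1r.
Qed.

Lemma dfourier_regular (u : periodic_distribution R d) g k : regular_distribution u g ->
  dfourier u k = fourier g k.
Proof. by move=> h; exact: h (Cinfty_conj_ch k). Qed.
End Smooth.

Lemma pnorm_trigpoly (R : realType) d (p : \bar R) (T : 'cV[R]_d -> R[i]) : (1 <= p)%E ->
  trigpoly T ->
  (pnorm p T < +oo)%E.
Proof.
move=> p1 tT; have [s [_ _ ET]] := trigpolyP tT; have [mT _] := cint_trigpoly tT.
apply: le_lt_trans (ltry (\sum_(k <- s) nc (fourier T k))); apply: pnorm_bounded => // x.
by rewrite {1}ET; exact: nc_TP.
Qed.

(** * The grid mean of [g] and the norm [Lnormj] *)

Section MeanAbs.
Variables (R : realType) (d : nat) (ms : 'rV[int]_d).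
Hypothesis ge2 : forall i, (2 <= `|ms ord0 i|)%N.
Local Notation M := (diag_mx ms : 'M[int]_d).
Local Notation V := 'cV[R]_d.
Local Notation Z := 'cV[int]_d.
Local Notation tor := (torus_measure R d).
Local Notation dpow := (dpow ms).
Variables (j : nat) (g : V -> R[i]).
Hypotheses (pg : Defs.periodic g) (mg : measurable_cfun g).
Local Notation grid := (grid R (dpow j)).
Local Notation ds := (fset_set (dig R (dpow j))).
Local Notation vl := (vol R (dpow j)).
Local Notation rc := (real_complex R).
Local Notation mean := (mean_abs M j g).

Let v0 : 0 < vl. Proof. exact: vol_gt0 (dpow_neq0 ge2 j). Qed.

(** With [b k = nc (H (- grid k))] this is the function Theta of the overview, with [b = 1] the mean
    [mean_abs]. *)
Definition wavg (b : Z -> R) (t : V) : R := vl^-1 * \sum_(k <- ds) nc (g (t - grid k)) * b k.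

Lemma mean_absE x : mean x = vl^-1 * \sum_(k <- ds) nc (g (x - grid k)).
Proof.
rewrite /mean_abs digitsE// -vol_dpow fsbig_finite /=; last exact: finite_dig (dpow_neq0 ge2 j).
by congr (_ * _); apply: eq_bigr => k _; rewrite invmpow_ivec.
Qed.

Lemma mean_wavg : mean = wavg (fun=> 1).
Proof. by apply/funext => x; rewrite mean_absE; congr (_ * _); apply: eq_bigr => k _;
  rewrite mulr1. Qed.

Lemma mean_grid l x : mean (x + grid l) = mean x.
Proof.
rewrite /mean_abs digitsE//; congr (_ * _).
pose F k := nc (g (x - grid k)).
have FS k r : F (k + smul (dpow j) r) = F k.
  by rewrite /F gridD grid_smul; [rewrite opprD addrA -ivecN pg|exact: dpow_neq0].
transitivity (\sum_(k \in dig R (dpow j)) F (k + - l)).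
  apply: eq_fsbigr => k _; rewrite /F invmpow_ivec// gridD gridN.
  by rewrite opprD opprK [- _ + _]addrC addrA.
rewrite dig_sum_shift//; last exact: dpow_neq0.
by apply: eq_fsbigr => k _; rewrite /F invmpow_ivec.
Qed.

Lemma mean_ivec l x : mean (x + ivec R l) = mean x.
Proof. by rewrite -(grid_smul R (dpow_neq0 ge2 j)) mean_grid. Qed.

Lemma mean_ge0 x : 0 <= mean x.
Proof. by rewrite mean_absE mulr_ge0 ?invr_ge0 ?(ltW v0)//; apply: sumr_ge0 => k _;
  exact: nc_ge0. Qed.

Lemma measurable_gshift k : measurable_fun setT (fun t : V => nc (g (t - grid k)) : measurableTypeR
  R).
Proof. exact: mcfun_nc (mcfun_comp mg (measurable_shift _)). Qed.

Lemma measurable_wavg b : measurable_fun setT (wavg b : V -> measurableTypeR R).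
Proof.
apply: measurable_funM; first exact: measurable_cst.
by apply: measurable_sum => k; apply: measurable_funM; [exact: measurable_gshift|
  exact: measurable_cst].
Qed.

Lemma measurable_mean : measurable_fun setT (mean : V -> measurableTypeR R).
Proof. by rewrite mean_wavg; exact: measurable_wavg. Qed.

Lemma int_avg (u : Z -> V -> R) (s : seq Z) (v : R) : 0 <= v ->
  (forall k, measurable_fun setT (u k : V -> measurableTypeR R)) -> (forall k t, 0 <= u k t) ->
  (\int[tor]_t (v * \sum_(k <- s) u k t)%:E = v%:E * \sum_(k <- s) \int[tor]_t (u k t)%:E)%E.
Proof.
move=> v00 mu u0.
under eq_integral do rewrite EFinM -sumEFin.
rewrite ge0_integralZl//; last 2 first.
- by apply: emeasurable_sum => k; apply/measurable_EFinP; exact: mu.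
- by move=> t _; apply: sume_ge0 => k _; rewrite lee_fin.
rewrite ge0_integral_sum//; first by move=> k; apply/measurable_EFinP; exact: mu.
by move=> k t _; rewrite lee_fin.
Qed.

(** The mean is invariant under the grid, so the left-hand side does not depend on [k]
    and can be averaged over [k]. *)
Lemma int_mean_pow (a : R) k : 0 <= a ->
  (\int[tor]_t (mean t `^ a * nc (g (t - grid k)))%:E = \int[tor]_t (mean t `^ (a + 1))%:E)%E.
Proof.
move=> a0.
have mp : measurable_fun setT (fun t => mean t `^ a : measurableTypeR R).
  exact: measurableT_comp (measurable_powR _) measurable_mean.
pose F t := (mean t `^ a * nc (g t))%:E.
have Fk l : (\int[tor]_t (mean t `^ a * nc (g (t - grid l)))%:E = \int[tor]_t F t)%E.
  rewrite -(integral_torus_shift (- grid l) (F := F)).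
  - by apply: eq_integral => t _; rewrite /F -[in mean (_ - _)]gridN mean_grid.
  - by apply/measurable_EFinP; apply: measurable_funM => //; exact: mcfun_nc.
  - by move=> n x; rewrite /F mean_ivec pg.
rewrite Fk; transitivity (\int[tor]_t (vl^-1 * \sum_(l <- ds) (mean t `^ a * nc (g (t - grid
  l))))%:E)%E; last first.
  apply: eq_integral => t _; rewrite -mulr_sumr mulrCA -mean_absE.
  rewrite powRD ?powRr1 ?mean_ge0//; apply/implyP => /eqP.
  by lra.
rewrite int_avg ?invr_ge0 ?(ltW v0)//; last 2 first.
- by move=> l; apply: measurable_funM => //; exact: measurable_gshift.
- by move=> l t; rewrite mulr_ge0 ?powR_ge0 ?nc_ge0.
under eq_bigr do rewrite Fk.
have F0 : (0 <= \int[tor]_t F t)%E.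
  by apply: integral_ge0 => t _; rewrite lee_fin mulr_ge0 ?powR_ge0 ?nc_ge0.
transitivity ((vl^-1)%:E * ((size ds)%:R%:E * \int[tor]_t F t))%E.
  rewrite muleA -EFinM size_ds; last exact: dpow_neq0.
  by rewrite mulVf ?mul1e// gt_eqF.
by rewrite big_const_seq count_predT iter_addr_0 mule_natl.
Qed.

Lemma int_mean : (\int[tor]_t (nc (g t))%:E = \int[tor]_t (mean t)%:E)%E.
Proof.
have := int_mean_pow 0 (lexx (0 : R)).
under eq_integral do rewrite powRr0 mul1r grid0 subr0.
by move=> ->; apply: eq_integral => t _; rewrite add0r powRr1// mean_ge0.
Qed.

(** The mean is invariant under the grid, so [tile_integral] assembles the [m^j] copies of the cell
    into the cube: the norm is a plain torus norm of the mean. *)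
Lemma Lnormj_fin (r : R) : (Lnormj M r%:E j g = (\int[tor]_t (mean t `^ r)%:E) `^ r^-1)%E.
Proof.
rewrite /Lnormj cellE//; congr (_ `^ _)%E.
have mp : measurable_fun setT (fun t => (mean t `^ r)%:E).
  by apply/measurable_EFinP; exact: measurableT_comp (measurable_powR _) measurable_mean.
have -> := integral_torus mp.
have -> := tile_integral (dpow_neq0 ge2 j) mp (fun x => _) (fun k x => _) (fun k x => _).
- by rewrite size_ds ?vol_dpow//; exact: dpow_neq0.
- by move=> x; rewrite lee_fin powR_ge0.
- by move=> k x; rewrite mean_ivec.
- by move=> k x; rewrite mean_grid.
Qed.

Lemma mcfun_mean : measurable_cfun (fun t => rc (mean t)).
Proof. exact: mcfun_real measurable_mean. Qed.

(** An equality for finite [q]. For [q = +oo], [Lnormj] takes the supremum over all points and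
    [pnorm] the essential one. *)
Lemma mean_Lnormj q : (1 <= q)%E -> (pnorm q (fun t => rc (mean t)) <= Lnormj M q j g)%E.
Proof.
case: q => [r| |//] q1.
  rewrite pnorm_rE Lnormj_fin le_eqVlt; apply/orP; left; apply/eqP.
  apply: (congr1 (fun z => z `^ r^-1)%E).
  by apply: eq_integral => t _; rewrite nc_real ger0_norm ?mean_ge0.
rewrite /Lnormj; set S := ereal_sup _.
have S0 : (0 <= S)%E.
  by apply: (@le_trans _ _ (mean 0)%:E); [rewrite lee_fin mean_ge0|apply: ereal_sup_ubound;
    exists 0].
have [->|Sfin] := eqVneq S +oo%E; first by rewrite leey.
have SE : S = (fine S)%:E by rewrite fineK// ge0_fin_numE// ltey.
rewrite SE; apply: pnorm_bounded => //; first exact: mcfun_mean.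
move=> x; rewrite nc_real ger0_norm ?mean_ge0// -lee_fin -SE.
by apply: ereal_sup_ubound; exists x.
Qed.

(** For fixed [t], Jensen for the measure [nu] with the weight [nc (g (x + t))], of mass [mean t],
    gives the integrand [F t]. After integration over [t], [int_mean_pow] replaces each
    [mean^(r-1) |g (t - grid k)|] by [mean^r], and the two variables separate. *)
Lemma wavg_jensen r (H : V -> R[i]) : 1 <= r -> measurable_cfun H ->
  (\int[tor]_t (wavg (fun k => nc (H (- grid k))) t `^ r)%:E <=
   (\int[tor]_t (mean t `^ r)%:E) * \int[nu R (dpow_neq0 ge2 j)]_x (nc (H x) `^ r)%:E)%E.
Proof.
move=> r1 mH; have e0 := dpow_neq0 ge2 j.
pose F t := vl^-1 * \sum_(k <- ds) mean t `^ (r - 1) * nc (g (t - grid k)) * nc (H (- grid k)) `^ r.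
have mp : measurable_fun setT (fun t => mean t `^ (r - 1) : measurableTypeR R).
  exact: measurableT_comp (measurable_powR _) measurable_mean.
have mu k : measurable_fun setT (fun t => mean t `^ (r - 1) * nc (g (t - grid k)) * nc (H (- grid
  k)) `^ r : measurableTypeR R).
  apply: measurable_funM; last exact: measurable_cst.
  by apply: measurable_funM => //; exact: measurable_gshift.
have pt t : wavg (fun k => nc (H (- grid k))) t `^ r <= F t.
  have mw : measurable_fun setT (fun y : V => nc (g (y + t))).
    exact: mcfun_nc (mcfun_comp mg (measurable_shift _)).
  have nu0 : (0 < nu R (dpow_neq0 ge2 j) (setT : set V))%E by rewrite nuT.
  have := jensen_weighted (nu R e0) mw (mcfun_nc mH) (fun x => nc_ge0 _) (fun x => nc_ge0 _) r1.
  have i1 : (\int[nu R e0]_x (nc (g (x + t)) * nc (H x))%:E =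
    (wavg (fun k => nc (H (- grid k))) t)%:E)%E.
    rewrite integral_nu; last 2 first.
    - by apply/measurable_EFinP; apply: measurable_funM => //; exact: mcfun_nc.
    - by move=> x; rewrite lee_fin mulr_ge0 ?nc_ge0.
    by rewrite sumEFin -EFinM /wavg; under eq_bigr do rewrite addrC.
  have i2 : (\int[nu R e0]_x (nc (g (x + t)))%:E = (mean t)%:E)%E.
    rewrite integral_nu; last 2 first.
    - exact/measurable_EFinP.
    - by move=> x; rewrite lee_fin nc_ge0.
    by rewrite sumEFin -EFinM mean_absE; under eq_bigr do rewrite addrC.
  have i3 : (\int[nu R e0]_x (nc (g (x + t)) * nc (H x) `^ r)%:E =
    (vl^-1 * \sum_(k <- ds) nc (g (t - grid k)) * nc (H (- grid k)) `^ r)%:E)%E.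
    rewrite integral_nu; last 2 first.
    - by apply/measurable_EFinP; apply: measurable_funM => //; exact: measurable_nc_pow.
    - by move=> x; rewrite lee_fin mulr_ge0 ?nc_ge0 ?powR_ge0.
    by rewrite sumEFin -EFinM; under eq_bigr do rewrite addrC.
  rewrite i1 i2 i3 !poweR_EFin -EFinM lee_fin => /le_trans; apply.
  by rewrite /F mulrCA mulr_sumr; under eq_bigr do rewrite mulrA.
have mT : measurable_fun setT (fun t => (wavg (fun k => nc (H (- grid k))) t `^ r)%:E).
  by apply/measurable_EFinP; exact: measurableT_comp (measurable_powR _) (measurable_wavg _).
have mF : measurable_fun setT (fun t => (F t)%:E).
  apply/measurable_EFinP; apply: measurable_funM; first exact: measurable_cst.
  by apply: measurable_sum => k; exact: mu.
apply: (@le_trans _ _ (\int[tor]_t (F t)%:E)%E).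
  by apply: ge0_le_integral => //= t _; rewrite ?lee_fin ?powR_ge0 //.
rewrite int_avg ?invr_ge0 ?(ltW v0)//; last by move=> k t; rewrite !mulr_ge0 ?powR_ge0 ?nc_ge0.
rewrite integral_nu//; last 2 first.
- by apply/measurable_EFinP; exact: measurable_nc_pow.
- by move=> x; rewrite lee_fin powR_ge0.
have I0 : (0 <= \int[tor]_t (mean t `^ r)%:E)%E by apply: integral_ge0 => t _;
  rewrite lee_fin powR_ge0.
rewrite muleCA; apply: lee_wpmul2l; first by rewrite lee_fin invr_ge0 ltW.
rewrite ge0_sume_distrr; last by move=> k _; rewrite lee_fin powR_ge0.
apply: lee_sum => k _.
rewrite -[X in (_ <= \int[_]_t (mean t `^ X)%:E * _)%E](subrK 1) -(int_mean_pow k) ?subr_ge0//.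
rewrite -ge0_integralZr//.
- by apply/measurable_EFinP; apply: measurable_funM => //; exact: measurable_gshift.
- by move=> t _; rewrite lee_fin mulr_ge0 ?powR_ge0 ?nc_ge0.
- by rewrite lee_fin powR_ge0.
Qed.

(** For finite [q], the root of [wavg_jensen] is followed by Marcinkiewicz-Zygmund at the scale of
    the grid itself. For [q = +oo] the bound is pointwise: the mean is at most its supremum, and
    [marcinkiewicz_zygmund_sup] bounds every sample of [H]. *)
Lemma pnorm_wavg_le q (H : V -> R[i]) (c : nat) : (1 <= q)%E -> (Lnormj M q j g < +oo)%E ->
  trigpoly H ->
  (forall k, fourier H k != 0 -> enorm (grid k) <= c%:R) ->
  (pnorm q (fun t => rc (wavg (fun k => nc (H (- grid k)%R)) t)) <=
   (2 ^+ d * (8 * c + 1)%:R ^+ d)%:E * (Lnormj M q j g * pnorm q H))%E.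
Proof.
move=> q1 Lf tH sH.
have mH : measurable_cfun H by have [] := cint_trigpoly tH.
have b0 t : 0 <= wavg (fun k => nc (H (- grid k))) t.
  by rewrite mulr_ge0 ?invr_ge0 ?(ltW v0)//; apply: sumr_ge0 => k _; rewrite mulr_ge0 ?nc_ge0.
case: q q1 Lf => [r| |//] q1 Lf.
  have r0 : 0 < r by move: q1; rewrite lee_fin; lra.
  rewrite pnorm_rE.
  apply: (@le_trans _ _ (((\int[tor]_t (mean t `^ r)%:E) * \int[nu R (dpow_neq0 ge2 j)]_x (nc (H x)
    `^ r)%:E) `^ r^-1)%E).
    apply: le_poweR; first by rewrite invr_ge0 ltW.
      by apply: integral_ge0 => t _; rewrite lee_fin powR_ge0.
    apply: le_trans (wavg_jensen q1 mH); rewrite le_eqVlt; apply/orP; left; apply/eqP.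
    by apply: eq_integral => t _; rewrite nc_real ger0_norm.
  rewrite poweRM; last 2 first.
  - by apply: integral_ge0 => t _; rewrite lee_fin powR_ge0.
  - by apply: integral_ge0 => t _; rewrite lee_fin powR_ge0.
  rewrite -Lnormj_fin muleCA; apply: lee_wpmul2l; first by rewrite Lnormj_fin poweR_ge0.
  have := marcinkiewicz_zygmund (dpow_neq0 ge2 j) tH (trig_box ge2 sH) q1.
  rewrite [X in (X <= _)%E -> _](_ : _ = ((\int[nu R (dpow_neq0 ge2 j)]_x (nc (H x) `^ r)%:E) `^
    r^-1)%E); last first.
    rewrite unlock /Lnorm; apply: (congr1 (fun z => z `^ r^-1)%E).
    by apply: eq_integral => t _ /=; rewrite ger0_norm ?nc_ge0.
  move=> /le_trans; apply; apply: lee_wpmul2r; first exact: pnorm_ge0.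
  rewrite lee_fin; apply: ler_wpM2l; first exact: exprn_ge0.
  apply: (le_trans (overlap_pow ge2 c q1 (leqnn j))).
  by rewrite subrr mulr0 powRr0 mulr1.
have L0 : (0 <= Lnormj M +oo j g)%E by apply: le_trans (mean_Lnormj q1); exact: pnorm_ge0.
have LE : Lnormj M +oo j g = (fine (Lnormj M +oo j g))%:E by rewrite fineK// ge0_fin_numE.
set S := fine _ in LE.
have HE : pnorm +oo H = (fine (pnorm +oo H))%:E.
  by rewrite fineK// ge0_fin_numE ?pnorm_ge0//; exact: pnorm_trigpoly.
set B := fine _ in HE.
have B0 : 0 <= B by rewrite -lee_fin -HE pnorm_ge0.
have S0 : 0 <= S by rewrite -lee_fin -LE.
rewrite LE HE -!EFinM; apply: pnorm_bounded => //; first exact: mcfun_real (measurable_wavg _).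
move=> t; rewrite nc_real ger0_norm//.
have hB k : nc (H (- grid k)) <= 2 ^+ d * B.
  by rewrite -lee_fin EFinM -HE; exact: (marcinkiewicz_zygmund_sup (dpow_neq0 ge2 j) _ tH (trig_box
    ge2 sH)).
have mS : mean t <= S by rewrite -lee_fin -LE; apply: ereal_sup_ubound; exists t.
apply: (@le_trans _ _ (mean t * (2 ^+ d * B))).
  rewrite mean_absE /wavg -mulrA; apply: ler_wpM2l; first by rewrite invr_ge0 ltW.
  by rewrite mulr_suml; apply: ler_sum => k _; apply: ler_wpM2l => //; exact: nc_ge0.
apply: (@le_trans _ _ (S * (2 ^+ d * B))); first by apply: ler_wpM2r => //;
  rewrite mulr_ge0 ?exprn_ge0.
rewrite mulrCA -mulrA; apply: ler_wpM2l; first exact: exprn_ge0.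
by apply: ler_peMl; rewrite ?mulr_ge0// exprn_ege1// ler1n addn1.
Qed.

End MeanAbs.

(** * Samples given by integrals *)

Section IntegralSamples.
Variables (R : realType) (d : nat) (ms : 'rV[int]_d).
Hypothesis ge2 : forall i, (2 <= `|ms ord0 i|)%N.
Local Notation M := (diag_mx ms : 'M[int]_d).
Local Notation V := 'cV[R]_d.
Local Notation tor := (torus_measure R d).
Local Notation dpow := (dpow ms).
Variables (j : nat) (g : V -> R[i]) (p q : \bar R).
Hypotheses (p1 : (1 <= p)%E) (q1 : (1 <= q)%E) (pq : (p^-1 + q^-1 = 1)%E).
Hypotheses (pg : Defs.periodic g) (mg : measurable_cfun g) (Lg : (Lnormj M q j g < +oo)%E).
Local Notation grid := (grid R (dpow j)).
Local Notation ds := (fset_set (dig R (dpow j))).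
Local Notation vl := (vol R (dpow j)).
Local Notation rc := (real_complex R).
Local Notation mean := (mean_abs M j g).

Let v0 : 0 < vl. Proof. exact: vol_gt0 (dpow_neq0 ge2 j). Qed.

Lemma pair_integralE F k :
  pair_integral M F g j k = integralC (fun t => F t * conjc (g (t - grid k))).
Proof. by rewrite /pair_integral invmpow_ivec. Qed.

Lemma Lnormj_ge0 : (0 <= Lnormj M q j g)%E.
Proof. by apply: le_trans (mean_Lnormj ge2 j pg mg q1); exact: pnorm_ge0. Qed.

Lemma g_le_mean k t : k \in ds -> nc (g (t - grid k)) <= vl * mean t.
Proof.
move=> kd; rewrite mean_absE// mulrA mulfV ?gt_eqF// mul1r (big_rem k)//= lerDl.
by apply: sumr_ge0 => l _; exact: nc_ge0.
Qed.

Lemma mcfun_pair F k : measurable_cfun F -> measurable_cfun (fun t => F t * conjc (g (t - grid k))).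
Proof.
move=> mF; apply: mcfunM => //; apply: mcfunJ; exact: mcfun_comp mg (measurable_shift _).
Qed.

(** Integrability of the shifts of [g] must come from [Lnormj]: a single shift is at most [vl] times
    the mean, and the mean lies in L_q. *)
Lemma cint_pair F k : measurable_cfun F -> (pnorm p F < +oo)%E -> k \in ds ->
  cintegrable (fun t => F t * conjc (g (t - grid k))).
Proof.
move=> mF nF kd; split; first exact: mcfun_pair.
have mm := measurable_mean ge2 j mg.
have mp : measurable_fun setT (fun t => nc (F t) * mean t : measurableTypeR R).
  by apply: measurable_funM => //; exact: mcfun_nc.
have h : (\int[tor]_t (nc (F t) * mean t)%:E <= pnorm p F * pnorm q (fun t => rc (mean t)))%E.
  apply: le_trans (hoelder_torus mF (mcfun_mean ge2 j mg) p1 q1 pq).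
  rewrite le_eqVlt; apply/orP; left; apply/eqP; apply: eq_integral => t _.
  by rewrite nc_real ger0_norm// mean_ge0.
apply: (@le_lt_trans _ _ (\int[tor]_t (vl%:E * (nc (F t) * mean t)%:E))%E).
  apply: ge0_le_integral => //=.
  - by move=> t _; rewrite lee_fin nc_ge0.
  - by apply/measurable_EFinP; exact: mcfun_nc (mcfun_pair k mF).
  - by apply: measurable_funeM; apply/measurable_EFinP.
  - move=> t _; rewrite -EFinM lee_fin ncM ncJ mulrCA; apply: ler_wpM2l; first exact: nc_ge0.
    exact: g_le_mean.
rewrite ge0_integralZl//; last 3 first.
- exact/measurable_EFinP.
- by move=> t _; rewrite lee_fin mulr_ge0 ?nc_ge0 ?mean_ge0.
- by rewrite lee_fin ltW.
apply: lte_mul_pinfty; rewrite ?lee_fin ?(ltW v0)//.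
apply: (le_lt_trans h); apply: lte_mul_pinfty; rewrite ?pnorm_ge0//.
  by rewrite ge0_fin_numE ?pnorm_ge0.
by apply: le_lt_trans (mean_Lnormj ge2 j pg mg q1) Lg.
Qed.

(** By grid invariance [g] and its mean have the same L_1 norm, and on a space of mass 1 this is at
    most the L_q norm of the mean. *)
Lemma int_g_le : (\int[tor]_t (nc (g t))%:E <= Lnormj M q j g)%E.
Proof.
rewrite (int_mean ge2 j pg mg); apply: le_trans (mean_Lnormj ge2 j pg mg q1).
apply: le_trans (pnorm1_le (mcfun_mean ge2 j mg) q1).
rewrite pnorm1E le_eqVlt; apply/orP; left; apply/eqP; apply: eq_integral => t _.
by rewrite nc_real ger0_norm// mean_ge0.
Qed.

Lemma cint_g : cintegrable g.
Proof. by split => //; apply: le_lt_trans int_g_le Lg. Qed.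

Lemma pair_sum_le F (H : V -> R[i]) : measurable_cfun F -> (pnorm p F < +oo)%E ->
  ((vl^-1 * \sum_(k <- ds) nc (pair_integral M F g j k) * nc (H (- grid k)))%:E <=
   pnorm p F * pnorm q (fun t => rc (wavg ms j g (fun k => nc (H (- grid k)%R)) t)))%E.
Proof.
move=> mF nF.
have mk k : measurable_fun setT (fun t => nc (F t) * (nc (g (t - grid k)) * nc (H (- grid k))) :
  measurableTypeR R).
  apply: measurable_funM; first exact: mcfun_nc.
  by apply: measurable_funM; [exact: measurable_gshift|exact: measurable_cst].
apply: (@le_trans _ _ (\int[tor]_t (vl^-1 * \sum_(k <- ds) nc (F t) * (nc (g (t - grid k)) * nc (H
  (- grid k))))%:E)%E).
  rewrite int_avg ?invr_ge0 ?(ltW v0)//; last by move=> k t; rewrite !mulr_ge0 ?nc_ge0.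
  rewrite EFinM; apply: lee_wpmul2l; first by rewrite lee_fin invr_ge0 ltW.
  rewrite -sumEFin big_seq [leRHS]big_seq; apply: lee_sum => k kd.
  under eq_integral do rewrite mulrA EFinM.
  rewrite ge0_integralZr//; last 3 first.
  - by apply/measurable_EFinP; apply: measurable_funM; [exact: mcfun_nc|exact: measurable_gshift].
  - by move=> t _; rewrite lee_fin mulr_ge0 ?nc_ge0.
  - by rewrite lee_fin nc_ge0.
  rewrite EFinM; apply: lee_wpmul2r; first by rewrite lee_fin nc_ge0.
  rewrite pair_integralE; apply: (le_trans (nc_integralC (cint_pair mF nF kd))).
  rewrite le_eqVlt; apply/orP; left; apply/eqP.
  by apply: eq_integral => t _; rewrite ncM ncJ.
have mW := measurable_wavg ms j mg (fun k => nc (H (- grid k))).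
apply: le_trans (hoelder_torus mF (mcfun_real mW) p1 q1 pq).
rewrite le_eqVlt; apply/orP; left; apply/eqP; apply: eq_integral => t _.
rewrite nc_real -mulr_sumr mulrCA -/(wavg ms j g (fun k => nc (H (- grid k))) t) ger0_norm//.
by rewrite mulr_ge0 ?invr_ge0 ?(ltW v0)//; apply: sumr_ge0 => k _; rewrite mulr_ge0 ?nc_ge0.
Qed.

Variables (phi : V -> R[i]) (c : nat).
Hypothesis tphi : trigpoly phi.
Hypothesis sphi : forall l, fourier phi l != 0 -> enorm (grid l) <= c%:R.

Lemma Q_pair_le F : measurable_cfun F -> (pnorm p F < +oo)%E ->
  (pnorm p (Qop M j (pair_integral M F g j) phi) <=
   (2 ^+ d * (8 * c + 1)%:R ^+ d)%:E * multiplier_norm q phi * Lnormj M q j g * pnorm p F)%E.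
Proof.
move=> mF nF.
set K := multiplier_norm q phi; set L := Lnormj M q j g.
have Kf : K \is a fin_num by exact: multiplier_fin.
have Lf : L \is a fin_num by rewrite ge0_fin_numE// Lnormj_ge0.
have Ff : pnorm p F \is a fin_num by rewrite ge0_fin_numE// pnorm_ge0.
rewrite -(fineK Kf) -(fineK Lf) -(fineK Ff) -!EFinM.
apply: (Q_duality ge2 p1 q1 pq tphi) => H tH sH HK.
apply: (le_trans (nc_bil ge2 _ _ _)).
have sH' k : fourier H k != 0 -> enorm (grid k) <= c%:R by move=> /sH; exact: sphi.
rewrite -lee_fin; apply: (le_trans (pair_sum_le H mF nF)).
rewrite !EFinM (fineK Kf) (fineK Lf) (fineK Ff) muleC; apply: lee_wpmul2r; first exact: pnorm_ge0.
apply: (le_trans (pnorm_wavg_le ge2 pg mg q1 Lg tH sH')).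
rewrite -EFinM muleAC -!muleA; apply: lee_wpmul2l; first by rewrite lee_fin mulr_ge0 ?exprn_ge0.
by apply: lee_wpmul2l; first exact: Lnormj_ge0.
Qed.

Lemma integralCJ (F : V -> R[i]) : cintegrable F ->
  integralC (fun t => conjc (F t)) = conjc (integralC F).
Proof.
move=> cF; rewrite /integralC /=; congr Complex; first by apply: eq_Rintegral => x _; rewrite ReJ.
rewrite -mulN1r -RintegralZl//; last exact: cint_Im.
by apply: eq_Rintegral => x _; rewrite ImJ mulN1r.
Qed.

(** On trigonometric polynomials the integral against [g] and the distributional pairing agree,
    which makes [Q_repr] available for integral samples. Shifting the variable by [grid k] produces
    the factor [character l (grid k)]. *)
Lemma pair_integral_trig (T : V -> R[i]) u k : trigpoly T -> (forall l, dfourier u l =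
  fourier g l) ->
  pair_integral M T g j k = pair_trigpoly M T u j k.
Proof.
move=> tT ug; have [s [us hs Es]] := trigpolyP tT.
rewrite (pairE ge2 j u k tT us hs) pair_integralE.
have mgk : measurable_cfun (fun t => conjc (g (t - grid k))).
  by apply: mcfunJ; exact: mcfun_comp mg (measurable_shift _).
have cg : cintegrable (fun t => conjc (g (t - grid k))).
  split => //; have [_] := cint_g; apply: le_lt_trans.
  rewrite -(integral_torus_shift (- grid k) (F := fun t => (nc (g t))%:E)).
  - by under eq_integral do rewrite ncJ.
  - by apply/measurable_EFinP; exact: mcfun_nc.
  - by move=> n x; rewrite pg.
have ci l : cintegrable (fun t => fourier T l * (conjc (g (t - grid k)) * character l t)).
  apply: cintZ; apply: (cint_mul_bounded (b := 1)) => //; first exact: mcfun_ch.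
  by move=> x; rewrite nc_ch.
transitivity (integralC (fun t => \sum_(l <- s) fourier T l * (conjc (g (t - grid k)) * character l
  t))).
  congr integralC; apply/funext => t; rewrite [in LHS]Es mulr_suml; apply: eq_bigr => l _.
  by rewrite -mulrA [character _ _ * _]mulrC.
rewrite integralC_sum//; apply: eq_bigr => l _.
rewrite integralCZ; last first.
  by apply: (cint_mul_bounded (b := 1)) => //; [exact: mcfun_ch|move=> x; rewrite nc_ch].
rewrite -mulrA ug; congr (_ * _).
rewrite -(integralC_shift (grid k)); last 2 first.
- by apply: mcfunM => //; exact: mcfun_ch.
- by move=> n x; rewrite ch_per addrAC pg.
transitivity (integralC (fun t => character l (grid k) * conjc (g t * conjc (character l t)))).
  congr integralC; apply/funext => t; rewrite addrK chDr conjcM conjcK.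
  by rewrite mulrA mulrC.
have cgl : cintegrable (fun t => g t * conjc (character l t)).
  apply: (cint_mul_bounded (b := 1)); [exact: cint_g|apply: mcfunJ; exact: mcfun_ch|].
  by move=> x; rewrite ncJ nc_ch.
rewrite integralCZ; first by rewrite integralCJ// mulrC.
by case: cgl => m1 h; split; [exact: mcfunJ|under eq_integral do rewrite ncJ].
Qed.

End IntegralSamples.

(** * The second estimate *)

Section IntegralEstimate.
Variables (R : realType) (d : nat) (ms : 'rV[int]_d).
Hypothesis ge2 : forall i, (2 <= `|ms ord0 i|)%N.
Local Notation M := (diag_mx ms : 'M[int]_d).
Local Notation V := 'cV[R]_d.
Local Notation dpow := (dpow ms).

Lemma quasi_interp_integral_le (p q : \bar R) (delta : R) (phi : nat -> V -> R[i]) (psi : nat ->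
  periodic_distribution R d) :
  (1 <= p)%E -> (1 <= q)%E -> (p^-1 + q^-1 = 1)%E -> 0 < delta < 2^-1 ->
  class_B M delta phi -> strictly_compatible M delta phi psi ->
  exists C : R, 0 < C /\
    forall g : nat -> V -> R[i],
      class_L M q g -> (forall j, (0 < j)%N -> regular_distribution (psi j) (g j)) ->
      forall f : V -> R[i], Lp p f -> forall j : nat, (0 < j)%N ->
      let Qf := Qop M j (pair_integral M f (g j) j) (phi j) in
      (pnorm p (fun x => f x - Qf x)%R <=
        C%:E * multiplier_norm q (phi j) * Lnormj M q j (g j) *
        best_approx (delta *: mpow R M j) p f)%E.
Proof.
move=> p1 q1 pq delta0 /(class_B_grid ge2)[c hB] hC.
have d0 : 0 < delta by case/andP: delta0.
pose C := 2 ^+ d * (8 * c + 1)%:R ^+ d : R.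
have C0 : 0 <= C by rewrite mulr_ge0 ?exprn_ge0.
(* The summand 1 pays for [f - T], absorbed by [1 <= K * L]; the constant is fixed before [g]. *)
exists (1 + C); split; first by rewrite ltr_pwDl.
move=> g hL hreg f [pf mf nf] j j0 /=.
have [tp sp ap] := hB j j0; have hc := compat_grid ge2 hC j0.
have [pg mg Lg] := hL j j0.
have ug l := dfourier_regular l (hreg j j0).
have K1 := multiplier_ge q1 tp; have Kf := multiplier_fin q1 tp.
have L0 := Lnormj_ge0 ge2 j q1 pg mg.
have L1 : ((nc (dfourier (psi j) 0))%:E <= Lnormj M q j (g j))%E.
  rewrite ug; apply: le_trans (int_g_le ge2 j q1 pg mg); rewrite -pnorm1E.
  exact: fourier_le (cint_g ge2 q1 pg mg Lg).
set K := multiplier_norm q (phi j) in K1 Kf *; set L := Lnormj M q j (g j) in Lg L0 L1 *.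
have KE : K = (fine K)%:E by rewrite fineK.
have LE : L = (fine L)%:E by rewrite fineK// ge0_fin_numE.
have KL : 1 <= fine K * fine L.
  have := hc 0; rewrite grid0 enorm0 => /(_ (ltW d0)) /(congr1 (@Normc.normc R)).
  rewrite ncM ncJ nc1 mulrC => <-; rewrite -!lee_fin -?KE -?LE.
  by apply: ler_pM; rewrite ?nc_ge0// -lee_fin -?KE -?LE.
have KL0 : 0 < fine K * fine L by apply: lt_le_trans KL.
(* Dividing by the positive constant leaves the infimum alone on the right, so the estimate may be
   proved for each admissible [T]. *)
rewrite KE LE -!EFinM -lee_pdivrMl; last by rewrite -mulrA mulr_gt0// ltr_pwDl.
apply: le_ereal_inf_tmp => _ [T [tT sT] <-].
rewrite lee_pdivrMl; last by rewrite -mulrA mulr_gt0// ltr_pwDl.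
pose F x := f x - T x.
have [mT _] := cint_trigpoly tT; have nT := pnorm_trigpoly p1 tT.
have mF : measurable_cfun F by exact: mcfunB.
have nF : (pnorm p F < +oo)%E by apply: le_lt_trans (pnormB mf mT p1) _; exact: lte_add_pinfty.
have QT : Qop M j (pair_integral M T (g j) j) (phi j) = T.
  rewrite (_ : pair_integral M T (g j) j = pair_trigpoly M T (psi j) j); last first.
    by apply/funext => k; exact: (pair_integral_trig ge2 q1 pg mg Lg).
  apply: (Q_repr ge2 (delta := delta)) => // [l /sT /=|l /ltW]; last exact: hc.
  by rewrite enorm_scaled.
have QF x : Qop M j (pair_integral M f (g j) j) (phi j) x =
    Qop M j (pair_integral M F (g j) j) (phi j) x + T x.
  rewrite -[in T x]QT !(QopE ge2) -mulrDr -big_split /=; congr (_ * _).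
  apply: eq_big_seq => k kd; rewrite -mulrDl; congr (_ * _); rewrite !pair_integralE//.
  rewrite -integralCD; first by congr integralC; apply/funext => t; rewrite -mulrDl subrK.
    exact: (cint_pair ge2 p1 q1 pq).
  exact: (cint_pair ge2 p1 q1 pq).
rewrite (_ : (fun x => _) = (fun x => F x - Qop M j (pair_integral M F (g j) j) (phi j) x));
  last first.
  by apply/funext => x; rewrite QF opprD addrA addrAC.
apply: (le_trans (pnormB mF _ p1)).
  by have [] := cint_trigpoly (trigpoly_Qop ge2 j (pair_integral M F (g j) j) tp).
have := Q_pair_le ge2 p1 q1 pq pg mg Lg tp sp mF nF.
rewrite -/K -/L KE LE => h; apply: (le_trans (leeD2l _ h)).
rewrite -!EFinM -/C -[X in (X + _ <= _)%E]mul1e -ge0_muleDl ?lee_fin//; last first.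
  by rewrite -mulrA mulr_ge0// ltW.
apply: lee_wpmul2r; first exact: pnorm_ge0.
rewrite -EFinD lee_fin /= -subr_ge0.
rewrite (_ : _ - _ = fine K * fine L - 1); last by ring.
by rewrite subr_ge0.
Qed.
End IntegralEstimate.

Theorem theorem19 (R : realType) (d : nat) (ms : 'rV[int]_d) (p q : \bar R)
    (N delta : R) (phi : nat -> 'cV[R]_d -> R[i])
    (psi : nat -> periodic_distribution R d) :
  let M := diag_mx ms : 'M[int]_d in
  (0 < d)%N -> dilation R M ->
  (1 <= p)%E -> (1 <= q)%E -> (p^-1 + q^-1 = 1)%E -> 0 <= N ->
  0 < delta < 2^-1 ->
  class_S M N p psi -> class_B M delta phi ->
  strictly_compatible M delta phi psi ->
  exists C : R,
    (forall f : 'cV[R]_d -> R[i], besov M p (d%:R * rinv p + N) f ->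
      forall j : nat, (0 < j)%N ->
      let s := rinv p + N / d%:R in
      let Qf := Qop M j (pair_limit M delta p f (psi j) j) (phi j) in
      (pnorm p (fun x => f x - Qf x)%R <=
        C%:E * multiplier_norm q (phi j) * (absdet R M `^ (- j%:R * s))%:E *
        \sum_(j <= nu <oo) (absdet R M `^ (s * nu%:R))%:E *
          best_approx (delta *: mpow R M nu) p f)%E) /\
    (forall g : nat -> 'cV[R]_d -> R[i],
      class_L M q g -> (forall j, (0 < j)%N -> regular_distribution (psi j) (g j)) ->
      forall f : 'cV[R]_d -> R[i], Lp p f -> forall j : nat, (0 < j)%N ->
      let Qf := Qop M j (pair_integral M f (g j) j) (phi j) in
      (pnorm p (fun x => f x - Qf x)%R <=
        C%:E * multiplier_norm q (phi j) * Lnormj M q j (g j) *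
        best_approx (delta *: mpow R M j) p f)%E).
Proof.
move=> M d0 dil p1 q1 pq N0 delta0 hS hB hC.
have ge2 := dilation_ge2 dil.
have [C1 [C10 h1]] := quasi_interp_limit_le ge2 p1 q1 pq delta0 hS hB hC.
have [C2 [C20 h2]] := quasi_interp_integral_le ge2 p1 q1 pq delta0 hB hC.
(* One constant for both estimates: the remaining factors are nonnegative, so either constant may be
   enlarged to the maximum. *)
have mono C (y z w : \bar R) : C <= Num.max C1 C2 -> (0 <= y)%E -> (0 <= z)%E -> (0 <= w)%E ->
    (C%:E * y * z * w <= (Num.max C1 C2)%:E * y * z * w)%E.
  by move=> hC' y0 z0 w0; rewrite !lee_wpmul2r// lee_fin.
have K0 j : (0 < j)%N -> (0 <= multiplier_norm q (phi j))%E.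
  move=> j0; have [_ [_ [_ _ /(_ j j0)[tp _ _]]]] := hB.
  by apply: le_trans (multiplier_ge q1 tp); rewrite lee_fin nc_ge0.
exists (Num.max C1 C2); split=> [f [Lf _] j j0|g hL hreg f Lf j j0].
  apply: (le_trans (h1 f Lf j j0)); apply: mono; rewrite ?le_max ?lexx ?K0 ?lee_fin ?powR_ge0//.
  by apply: nneseries_ge0 => n _ _; rewrite mule_ge0 ?lee_fin ?powR_ge0 ?best_approx_ge0.
apply: (le_trans (h2 g hL hreg f Lf j j0)); apply: mono;
  rewrite ?le_max ?lexx ?orbT ?K0 ?best_approx_ge0//.
by have [pg mg _] := hL j j0; exact: (Lnormj_ge0 ge2 j q1 pg mg).
Qed.
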